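(* Let $d\le n$, let $A$ be a based quasi-hereditary graded $\Bbbk$-superalgebra with $\mathfrak a$-conforming heredity data $I,X,Y$, and let $\Bbbk\to\mathbb F$ be a ring homomorphism to a field. Suppose that $(A,\mathfrak a)$ is a unital pair and $(A_{\mathbb F})_{\bar1}\subset J(A_{\mathbb F})$, where $J$ denotes the Jacobson radical. Moreover, suppose that $A_{\mathbb F}$ is indecomposable and $|I|>1$. Then $T^A_{\mathfrak a}(n,d)_{\mathbb F}$ is indecomposable.
   Context: $\Bbbk$ is a commutative integral domain of characteristic $0$, $n\in\mathbb Z_{>0}$, $d\in\mathbb Z_{\ge0}$. An algebra is indecomposable if it is not the direct sum of two nonzero two-sided ideals (ideals of graded superalgebras being homogeneous). $A_{\mathbb F}=A\otimes_\Bbbk\mathbb F$ and $T^A_{\mathfrak a}(n,d)_{\mathbb F}=T^A_{\mathfrak a}(n,d)\otimes_\Bbbk\mathbb F$. Based quasi-hereditary algebras. A graded $\Bbbk$-supermodule is $V=\bigoplus_{m\in\mathbb Z,\varepsilon\in\mathbb Z/2}V^m_\varepsilon$, with $V_\varepsilon=\bigoplus_mV^m_\varepsilon$; elements of the $V^m_\varepsilon$ are homogeneous; for a set $S$ of homogeneous elements, $S_\varepsilon=S\cap V_\varepsilon$. A graded $\Bbbk$-superalgebra is a (not necessarily unital) associative algebra $A$ with $A^m_\varepsilon A^l_\delta\subseteq A^{m+l}_{\varepsilon+\delta}$. Heredity data on $A$ consist of a finite poset $I$ and finite sets $X=\bigsqcup_{i\in I}X(i)$, $Y=\bigsqcup_{i\in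 I}Y(i)$ of homogeneous elements with distinguished initial elements $e_i\in X(i)\cap Y(i)$ such that, with $A^{>i}=\mathrm{span}(xy\mid j>i,\ x\in X(j),\ y\in Y(j))$: (a) $B=\{xy\mid i\in I,x\in X(i),y\in Y(i)\}$ is a basis of $A$; (b) for $x\in X(i)$, $y\in Y(i)$, $a\in A$, $ax$ is congruent mod $A^{>i}$ to a linear combination of elements of $X(i)$, and $ya$ to one of elements of $Y(i)$; (c) for $i,j\in I$, $x\in X(i)$, $y\in Y(i)$: $xe_i=x$, $e_ix=\delta_{x,e_i}x$, $e_iy=y$, $ye_i=\delta_{y,e_i}y$, $e_jx\in\{x,0\}$, $ye_j\in\{y,0\}$. Then $A$ is called based quasi-hereditary. For a subalgebra $\mathfrak a\subseteq A_{\bar0}$ the data is $\mathfrak a$-conforming if $I,X_{\bar0},Y_{\bar0}$ is heredity data for $\mathfrak a$; if moreover $A$ is unital and $1_A\in\mathfrak a$, then $(A,\mathfrak a)$ is a unital pair. The algebra $T^A_{\mathfrak a}(n,d)$. Let $B_{\mathfrak c}=\{xy\mid i\in I,\ x\in X(i)_{\bar1},\ y\in Y(i)_{\bar1}\}$. $\mathrm{Tri}^B(n,d)$ is the set of $(\boldsymbol b,\boldsymbol r,\boldsymbol s)\in B^d\times[1,n]^d\times[1,n]^d$ such that for $k\ne l$, $(b_k,r_k,s_k)=(b_l,r_l,s_l)$ only if $b_k$ is even. $\mathfrak S_d$ acts on words by $(z_1\cdots z_d)\sigma=z_{\sigma1}\cdots z_{\sigma d}$, diagonally on triples. Put $\xi^a_{r,s}=aE_{r,s}\in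 M_n(A)$. $\mathfrak S_d$ acts on the superalgebra $M_n(A)^{\otimes d}$ by $(\xi^{a_1}_{r_1,s_1}\otimes\cdots\otimes\xi^{a_d}_{r_d,s_d})^\sigma=(-1)^{\langle\sigma;\boldsymbol a\rangle}\xi^{a_{\sigma1}}_{r_{\sigma1},s_{\sigma1}}\otimes\cdots\otimes\xi^{a_{\sigma d}}_{r_{\sigma d},s_{\sigma d}}$, $\langle\sigma;\boldsymbol a\rangle=\#\{k<l\mid\sigma^{-1}k>\sigma^{-1}l,\ a_k,a_l\text{ odd}\}$; $S^A(n,d)$ is the algebra of invariants. For $(\boldsymbol b,\boldsymbol r,\boldsymbol s)\in\mathrm{Tri}^B(n,d)$, $\xi^{\boldsymbol b}_{\boldsymbol r,\boldsymbol s}=\sum_\sigma(\xi^{b_1}_{r_1,s_1}\otimes\cdots\otimes\xi^{b_d}_{r_d,s_d})^\sigma$ over shortest representatives of $\mathrm{Stab}(\boldsymbol b,\boldsymbol r,\boldsymbol s)\backslash\mathfrak S_d$, and $\eta^{\boldsymbol b}_{\boldsymbol r,\boldsymbol s}=\big(\prod_{b\in B_{\mathfrak c},\,r,s\in[1,n]}\#\{k\mid(b_k,r_k,s_k)=(b,r,s)\}!\big)\,\xi^{\boldsymbol b}_{\boldsymbol r,\boldsymbol s}$. Then $T^A_{\mathfrak a}(n,d)=\mathrm{span}_\Bbbk(\eta^{\boldsymbol b}_{\boldsymbol r,\boldsymbol s})$, a subalgebra of $S^A(n,d)$. *)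

(* Defs.v *)
From HB Require Import structures.
From mathcomp Require Import all_boot all_order all_fingroup all_algebra.
From mathcomp Require Import finmap.
From mathcomp Require Import boolp classical_sets.

Set Implicit Arguments.
Unset Strict Implicit.
Unset Printing Implicit Defensive.

Import Order.TTheory GRing.Theory.
Local Open Scope ring_scope.

Section Submodules.
Variables (R : pzRingType) (V : lmodType R).

Definition is_submodule (J : set V) : Prop :=
  J 0 /\ forall (c : R) u v, J u -> J v -> J (c *: u + v).

Definition span (S : set V) : set V := fun v =>
  exists2 s : seq (R * V),
    forall p, p \in s -> S p.2 & v = \sum_(p <- s) p.1 *: p.2.

Definition span_pred (S : set V) : {pred V} := fun v => `[< span S v >].

Lemma span_submod_closed (S : set V) : submod_closed (span_pred S).
Proof.
split=> [|c u v /asboolP[s sS ->] /asboolP[t tS ->]]; apply/asboolP.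
  by exists [::] => //; rewrite big_nil.
exists ([seq (c * p.1, p.2) | p <- s] ++ t).
  move=> p; rewrite mem_cat => /orP[/mapP[q qs ->]|]; first exact: (sS q).
  exact: tS.
rewrite big_cat big_map scaler_sumr; congr (_ + _).
by apply: eq_bigr => p _ /=; rewrite scalerA.
Qed.

HB.instance Definition _ (S : set V) :=
  GRing.isSubmodClosed.Build R V (span_pred S) (span_submod_closed S).

Definition span_type (S : set V) : Type := {v : V | v \in span_pred S}.
HB.instance Definition _ (S : set V) := [isSub of span_type S for @sval _ _].
HB.instance Definition _ (S : set V) := [Choice of span_type S by <:].
HB.instance Definition _ (S : set V) :=
  [SubChoice_isSubLmodule of span_type S by <:].

End Submodules.

(* Degrees (m, eps) with m in Z and eps in Z/2; the sum is componentwise. *)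
Notation deg := (int * 'Z_2)%type.

Section Graded.
Variables (R : pzRingType) (V : lmodType R).
Implicit Types (gr : deg -> set V) (mul : V -> V -> V) (J : set V).

(* V is the internal direct sum of the gr p. *)
Record is_grading gr : Prop := IsGrading {
  grading_submodule : forall p, is_submodule (gr p);
  grading_generates : forall v, exists (s : seq deg) (c : deg -> V),
    [/\ uniq s, forall p, gr p (c p) & v = \sum_(p <- s) c p];
  grading_independent : forall (s : seq deg) (c : deg -> V),
    uniq s -> (forall p, gr p (c p)) -> \sum_(p <- s) c p = 0 ->
    forall p, p \in s -> c p = 0 }.

Definition is_graded_superalgebra mul gr : Prop :=
  is_grading gr /\
  forall p q u v, gr p u -> gr q v -> gr (p + q) (mul u v).

Definition homogeneous gr (v : V) : Prop := exists p, gr p v.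

Definition parity_part gr (eps : 'Z_2) : set V :=
  span (fun v => exists m : int, gr (m, eps) v).

(* Ideals of a not necessarily unital algebra are required to be submodules. *)
Definition is_homogeneous_ideal mul gr J : Prop :=
  [/\ is_submodule J,
      forall u v, J v -> J (mul u v) /\ J (mul v u)
    & forall v, J v -> exists (s : seq deg) (c : deg -> V),
        [/\ uniq s, forall p, gr p (c p), forall p, J (c p)
          & v = \sum_(p <- s) c p]].

Definition nonzero_set J : Prop := exists2 v, J v & v != 0.

Definition indecomposable mul gr : Prop :=
  ~ exists J1 J2 : set V,
      [/\ is_homogeneous_ideal mul gr J1 /\ is_homogeneous_ideal mul gr J2,
          nonzero_set J1 /\ nonzero_set J2,
          forall v, J1 v -> J2 v -> v = 0
        & forall v, exists v1 v2, [/\ J1 v1, J2 v2 & v = v1 + v2]].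

End Graded.

Section Jacobson.
Variable R : pzRingType.
Implicit Types L : set R.

Definition is_left_ideal L : Prop :=
  [/\ L 0, forall x y, L x -> L y -> L (x + y) & forall a x, L x -> L (a * x)].

Definition is_maximal_left_ideal L : Prop :=
  [/\ is_left_ideal L, ~ L 1
    & forall L', is_left_ideal L' -> (forall x, L x -> L' x) -> ~ L' 1 ->
      forall x, L' x -> L x].

Definition jacobson_radical : set R :=
  fun x => forall L, is_maximal_left_ideal L -> L x.

End Jacobson.

Section ScalarExtension.
Variables (k : pzRingType) (F : pzRingType) (phi : {rmorphism k -> F}).

(* N, with iota v standing for v (x) 1, is the extension of scalars of M along
   phi: the universal property of the tensor product. *)
Definition is_scalar_extension (M : lmodType k) (N : lmodType F)
    (iota : {linear M -> N | phi \; *:%R}) : Prop :=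
  (forall (W : lmodType F) (f : {linear M -> W | phi \; *:%R}),
     exists g : {linear N -> W}, forall v, g (iota v) = f v) /\
  (forall (W : lmodType F) (g h : {linear N -> W}),
     (forall v, g (iota v) = h (iota v)) -> forall w, g w = h w).

(* The grading of N by the images of the gr p (x) F. *)
Definition extended_grading (M : lmodType k) (N : lmodType F)
    (iota : M -> N) (gr : deg -> set M) : deg -> set N :=
  fun p => span (fun w => exists2 v, gr p v & w = iota v).

End ScalarExtension.

Section TensorPower.
Variables (k : comNzRingType) (d : nat).

Definition multilinear (V W : lmodType k) (f : {ffun 'I_d -> V} -> W) : Prop :=
  forall (i : 'I_d) (x : {ffun 'I_d -> V}),
    linear (fun u => f [ffun j => if j == i then u else x j]).

Definition is_tensor_power (V TP : lmodType k) (tens : {ffun 'I_d -> V} -> TP) :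
    Prop :=
  [/\ multilinear tens,
      forall (W : lmodType k) (f : {ffun 'I_d -> V} -> W), multilinear f ->
        exists g : {linear TP -> W}, forall x, g (tens x) = f x
    & forall (W : lmodType k) (g h : {linear TP -> W}),
        (forall x, g (tens x) = h (tens x)) -> forall t, g t = h t].

(* Moving y_l past x_m for l < m contributes the sign (-1)^(|x_m||y_l|). *)
Definition is_super_tensor_power (V : lmodType k) (mul : V -> V -> V)
    (gr : deg -> set V) (TP : algType k) (tens : {ffun 'I_d -> V} -> TP) :
    Prop :=
  is_tensor_power tens /\
  forall (p q : {ffun 'I_d -> deg}) (x y : {ffun 'I_d -> V}),
    (forall i, gr (p i) (x i)) -> (forall i, gr (q i) (y i)) ->
    tens x * tens y =
      (-1) ^+ (\sum_(m < d) \sum_(l < d | l < m) (p m).2 * (q l).2)%N *: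
        tens [ffun i => mul (x i) (y i)].

Definition tensor_grading (V TP : lmodType k) (gr : deg -> set V)
    (tens : {ffun 'I_d -> V} -> TP) : deg -> set TP :=
  fun p => span (fun t => exists (q : {ffun 'I_d -> deg})
                                 (x : {ffun 'I_d -> V}),
    [/\ forall i, gr (q i) (x i), \sum_i q i = p & t = tens x]).

End TensorPower.

(* M_n(A) as a k-module; MathComp's own scaling on 'M[A]_n is by A. *)
Definition mat (k : comNzRingType) (A : algType k) (n : nat) : Type := 'M[A]_n.

Section Mat.
Variables (k : comNzRingType) (A : algType k) (n : nat).

HB.instance Definition _ := GRing.Zmodule.on (mat A n).

Definition mat_scale (c : k) (M : mat A n) : mat A n := \matrix_(i, j) (c *: M i j).

Fact mat_scalerA a b M : mat_scale a (mat_scale b M) = mat_scale (a * b) M.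
Proof. by apply/matrixP=> i j; rewrite !mxE scalerA. Qed.
Fact mat_scale1r : left_id 1 mat_scale.
Proof. by move=> M; apply/matrixP=> i j; rewrite !mxE scale1r. Qed.
Fact mat_scalerDr : right_distributive mat_scale +%R.
Proof. by move=> a M N; apply/matrixP=> i j; rewrite !mxE scalerDr. Qed.
Fact mat_scalerDl M : {morph mat_scale^~ M : a b / a + b}.
Proof. by move=> a b; apply/matrixP=> i j; rewrite !mxE scalerDl. Qed.

HB.instance Definition _ := GRing.Zmodule_isLmodule.Build k (mat A n)
  mat_scalerA mat_scale1r mat_scalerDr mat_scalerDl.

Definition mat_mul (M N : mat A n) : mat A n := M *m N.

Definition mat_grading (gr : deg -> set A) : deg -> set (mat A n) :=
  fun p M => forall i j, gr p (M i j).

Definition xi_mat (a : A) (r s : 'I_n) : mat A n :=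
  (a *: delta_mx r s : 'M[A]_n).

End Mat.

Section Heredity.
Variables (k : comNzRingType) (A : algType k) (gr : deg -> set A).
Variables (disp : Order.disp_t) (I : finPOrderType disp).
Implicit Types (S a : set A) (X Y : I -> {fset A}) (e : I -> A).

Definition above X Y (i : I) : set A :=
  span (fun v => exists (j : I) (x y : A),
    [/\ (i < j)%O, x \in X j, y \in Y j & v = x * y]).

(* Heredity data on the subalgebra S of A. The basis B is understood as a
   family indexed by the triples (i, x, y), so distinct triples have distinct
   products. *)
Record heredity_data S X Y e : Prop := HeredityData {
  hd_X : forall i x, x \in X i -> S x /\ homogeneous gr x;
  hd_Y : forall i y, y \in Y i -> S y /\ homogeneous gr y;
  hd_X_disjoint : forall i j x, x \in X i -> x \in X j -> i = j;
  hd_Y_disjoint : forall i j y, y \in Y i -> y \in Y j -> i = j;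
  hd_initial : forall i, e i \in X i /\ e i \in Y i;
  hd_span : forall v, S v <-> exists c : I -> A -> A -> k,
    v = \sum_i \sum_(x <- X i) \sum_(y <- Y i) c i x y *: (x * y);
  hd_free : forall c : I -> A -> A -> k,
    \sum_i \sum_(x <- X i) \sum_(y <- Y i) c i x y *: (x * y) = 0 ->
    forall i x y, x \in X i -> y \in Y i -> c i x y = 0;
  hd_left : forall i x v, x \in X i -> S v ->
    exists2 u, span [set` X i] u & above X Y i (v * x - u);
  hd_right : forall i y v, y \in Y i -> S v ->
    exists2 u, span [set` Y i] u & above X Y i (y * v - u);
  hd_X_e : forall i x, x \in X i ->
    x * e i = x /\ e i * x = if x == e i then x else 0;
  hd_e_Y : forall i y, y \in Y i ->
    e i * y = y /\ y * e i = if y == e i then y else 0;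
  hd_e_X : forall i j x, x \in X i -> e j * x = x \/ e j * x = 0;
  hd_Y_e : forall i j y, y \in Y i -> y * e j = y \/ y * e j = 0 }.

Definition parity_sub (eps : 'Z_2) X (i : I) : {fset A} :=
  [fset x in X i | `[< parity_part gr eps x >]]%fset.

Definition is_even_subalgebra a : Prop :=
  [/\ is_submodule a, forall x y, a x -> a y -> a (x * y)
    & forall x, a x -> parity_part gr 0 x].

Definition conforming a X Y e : Prop :=
  is_even_subalgebra a /\
  heredity_data a (parity_sub 0 X) (parity_sub 0 Y) e.

Definition products X Y : {fset A} :=
  \big[fsetU/fset0]_(i : I) [fset x * y | x in X i, y in Y i]%fset.

End Heredity.

Section SchurAlgebra.
Variables (k : comNzRingType) (A : algType k) (gr : deg -> set A).
Variables (disp : Order.disp_t) (I : finPOrderType disp).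
Variables (X Y : I -> {fset A}) (n d : nat).
Variables (TP : lmodType k) (tens : {ffun 'I_d -> mat A n} -> TP).

(* A triple (b, r, s) of words of length d is encoded as the word of the
   letters (b_i, r_i, s_i). *)
Notation letter := (A * 'I_n * 'I_n)%type.
Notation word := {ffun 'I_d -> letter}.
Implicit Types (z : word) (sigma tau : 'S_d).

Definition even_letter (t : letter) : Prop := parity_part gr 0 t.1.1.
Definition odd_letter (t : letter) : Prop := parity_part gr 1 t.1.1.

Definition Tri z : Prop :=
  (forall i, (z i).1.1 \in products X Y) /\
  (forall i j, i != j -> z i = z j -> even_letter (z i)).

Definition word_act z sigma : word := [ffun i => z (sigma i)].

Definition perm_length sigma : nat :=
  #|[set p : 'I_d * 'I_d | (p.1 < p.2)%N && (sigma p.2 < sigma p.1)%N]|.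

(* Words carry a right action, z (tau \o sigma) = (z tau) sigma, and tau \o sigma
   is (sigma * tau)%g: the coset of sigma consists of these for tau in Stab z. *)
Definition shortest_rep z sigma : bool :=
  [forall tau, (word_act z tau == z) ==>
    (perm_length sigma <= perm_length (sigma * tau)%g)%N].

Definition sign_exponent z sigma : nat :=
  #|[set p : 'I_d * 'I_d |
      [&& (p.1 < p.2)%N, (sigma^-1%g p.2 < sigma^-1%g p.1)%N,
          `[< odd_letter (z p.1) >] & `[< odd_letter (z p.2) >]]]|.

Definition pure_act z sigma : TP :=
  (-1) ^+ sign_exponent z sigma *:
    tens [ffun i => let: (b, r, s) := z (sigma i) in xi_mat b r s].

Definition xi z : TP := \sum_(sigma | shortest_rep z sigma) pure_act z sigma.

Definition B_c : {fset A} := products (parity_sub gr 1 X) (parity_sub gr 1 Y).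

Definition multiplicity z (t : letter) : nat := #|[set i | z i == t]|.

(* Factorials are only taken over the letters with b a product of odd x and y. *)
Definition eta z : TP :=
  (\prod_(b <- B_c) \prod_(r < n) \prod_(s < n)
     (multiplicity z (b, r, s))`!)%N%:R *: xi z.

Definition etas : set TP := fun t => exists2 z, Tri z & t = eta z.

Definition schurT : lmodType k := span_type etas.

Definition schurT_grading : deg -> set schurT :=
  fun p t => tensor_grading (mat_grading gr) tens p (val t).

End SchurAlgebra.

Arguments schurT_grading {k A} gr {disp I} X Y {n d TP} tens _ _.

(* Main.v *)
Require Import Defs.
From HB Require Import structures.
From mathcomp Require Import all_boot all_order all_fingroup all_algebra.
From mathcomp Require Import finmap zify.
From mathcomp Require Import boolp classical_sets.

Set Implicit Arguments.
Unset Strict Implicit.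
Unset Printing Implicit Defensive.

Import Order.TTheory GRing.Theory.
Local Open Scope ring_scope.

(** Write chi_i for the coordinate along e_i in the basis B. Heredity gives
    chi_i (u e_i v) = chi_i u * chi_i v, and shows that products which pass
    through e_i only involve basis vectors of index at least i. These facts are
    recorded in [heredity_basis], which is stable under change of scalars
    ([extend_heredity_basis]). Over F the elements v with chi_i (u v w) = 0 for all
    i, u, w form a nilpotent ideal rad ([prod_rad0]), and the odd elements lie in
    it ([odd_rad]). Since A_F is indecomposable with several simple modules, the
    two-sided annihilator of rad lies in rad ([ann_sub_rad]), and a central element
    acts by the same scalar on all simple modules ([central_char]).

    The factorials in the definition of T are the orders of groups [Kz] of place
    permutations that move only letters of B_c. A finite sum of tensors permuted
    by the symmetric group, such that only letters of M_n(a) occur at the places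
    moved by a stabilizer, has coefficients divisible by these orders, and is thus
    a combination of the eta's ([equivariant_sum_eta]). Products of eta's and
    symmetrized tensors are such sums, and counting radical factors filters them;
    a sum of large filtration degree becomes zero in T_F even after division by
    the factorials ([filtered_vanish]), so that idempotents of positive filtration
    degree vanish ([filF_idem]).

    Suppose that T_F is the direct sum of ideals J1 and J2. As d <= n, there is an
    idempotent eps, the symmetrization of E_11 (x) ... (x) E_dd, whose corner
    eps T_F eps has a basis that multiplies like the wreath product of A_F with the
    symmetric group ([wreath_mul], [corner_expand]). The component x of eps in J1
    commutes with the elements of A_F placed in a single position. Evaluate
    matrix coefficients of simple modules at all positions but one. The part of x at a
    permutation moving the remaining position then gives an element that
    annihilates rad, hence lies in rad; the part at the identity gives a central
    element, hence a scalar. So x is a scalar multiple of eps up to a nilpotent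
    element, and x = 0 or x = eps ([wr_unit_in_summand]).

    Say that eps lies in J2. The component f of 1 in J1 annihilates T_F eps. Right
    multiplication by elements of T_F eps reads off all coefficients of f at words
    over the basis of M_n(a) ([coefF_theta]), and where these vanish the filtration
    degree is positive ([filF1_of_coef]). Thus the idempotent f is 0, 1 lies in J2,
    and J1 = 0 ([summand_zero]). *)

(** * Elementary facts on spans, supports and generalized inverses *)

Lemma ffun_neq (T : finType) (W : eqType) (f g : {ffun T -> W}) :
  f != g -> exists i, f i != g i.
Proof.
by move=> fg; apply/existsP; apply: contraNT fg => /existsPn no; apply/eqP/ffunP => i; apply/eqP/negPn/no.
Qed.

Lemma perm_neq (T : finType) (g h : {perm T}) : g != h -> exists i, g i != h i.
Proof.
by move=> gh; apply/existsP; apply: contraNT gh => /existsPn no; apply/eqP/permP => i; apply/eqP/negPn/no.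
Qed.

(** The generalized inverse of a matrix, with f C f = f. Applied to matrix
    coefficients, it produces elements with prescribed action on simple modules. *)
Lemma generalized_inverse (F : fieldType) (T1 T2 : finType) (f : T1 -> T2 -> F) :
  exists C : T2 -> T1 -> F, forall a b,
    \sum_y \sum_x f a y * C y x * f x b = f a b.
Proof.
pose M := \matrix_(i < #|T1|, j < #|T2|) f (enum_val i) (enum_val j).
exists (fun y x => pinvmx M (enum_rank y) (enum_rank x)) => a b.
have := congr1 (fun N : 'M_(_, _) => N (enum_rank a) (enum_rank b)) (mulmxKpV (submx_refl M)).
rewrite /= !mxE !enum_rankK => <-.
rewrite exchange_big /= (reindex_onto enum_val enum_rank) /=; last by move=> i _; rewrite enum_rankK.
rewrite (eq_bigl xpredT) => [|i]; last by rewrite enum_valK eqxx.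
apply: eq_bigr => x _; rewrite !mxE enum_valK enum_rankK mulr_suml.
rewrite (reindex_onto enum_val enum_rank) /=; last by move=> i _; rewrite enum_rankK.
rewrite (eq_bigl xpredT) => [|i]; last by rewrite enum_valK eqxx.
by apply: eq_bigr => y _; rewrite !mxE enum_valK enum_rankK.
Qed.

Section Span.
Variables (R : pzRingType) (V : lmodType R).

Lemma span_in (S : set V) v : S v -> Defs.span S v.
Proof.
move=> Sv; exists [:: (1, v)]; last by rewrite big_seq1 scale1r.
by move=> p; rewrite inE => /eqP->.
Qed.

Lemma span_submod (S : set V) : is_submodule (Defs.span S).
Proof.
split=> [|c u v Su Sv]; first by exists [::]; rewrite ?big_nil.
have [_ /(_ c u v)] := span_submod_closed S.
by move/(_ (asboolT Su) (asboolT Sv))/asboolP.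
Qed.

Lemma submodD (P : set V) u v : is_submodule P -> P u -> P v -> P (u + v).
Proof. by case=> _ h Pu Pv; rewrite -[u]scale1r; apply: h. Qed.

Lemma submodZ (P : set V) c u : is_submodule P -> P u -> P (c *: u).
Proof. by case=> h0 h Pu; rewrite -[_ *: _]addr0; apply: h. Qed.

Lemma submodB (P : set V) u v : is_submodule P -> P u -> P v -> P (u - v).
Proof. by move=> sP Pu Pv; rewrite -scaleN1r; apply: submodD => //; apply: submodZ. Qed.

Lemma submod_sum (P : set V) (T : Type) (r : seq T) (p : pred T) (f : T -> V) :
  is_submodule P -> (forall i, p i -> P (f i)) -> P (\sum_(i <- r | p i) f i).
Proof. by move=> sP fP; elim/big_ind: _ => //; [case: sP | move=> u v; apply: submodD]. Qed.

Lemma span_sub (S P : set V) v :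
  is_submodule P -> (forall u, S u -> P u) -> Defs.span S v -> P v.
Proof.
move=> sP SP [s sS ->]; rewrite big_seq; apply: submod_sum => // p ps.
by apply: submodZ => //; apply/SP/sS.
Qed.
End Span.

Lemma supp_submod (R : comNzRingType) (V : lmodType R) (Bt : finType)
    (cA : Bt -> {scalar V}) (P : pred Bt) :
  is_submodule (fun v => forall b, cA b v != 0 -> P b).
Proof.
split=> [b|c u v Pu Pv b]; first by rewrite linear0 eqxx.
rewrite linearP /=; have [->|/Pu//] := eqVneq (cA b u) 0.
by rewrite mulr0 add0r => /Pv.
Qed.

(** * Algebras with a heredity basis *)

(** Heredity data seen from the basis B: [cA] gives the coordinates, [dg] and [ix]
    the degree and the index in I of a basis vector. Every clause about products is
    linear in each element of A, and so carries over to A_F from the image of A. *)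
Record heredity_basis (R : comNzRingType) (A : algType R) (gr : deg -> set A)
    (disp : Order.disp_t) (I : finPOrderType disp) (Bt : finType)
    (bv : Bt -> A) (cA : Bt -> {scalar A}) (dg : Bt -> deg)
    (ix : Bt -> I) (e : I -> Bt) : Prop := HeredityBasis {
  hb_coord : forall b b', cA b (bv b') = (b == b')%:R;
  hb_expand : forall v, v = \sum_b cA b v *: bv b;
  hb_gr : forall p v, gr p v <-> forall b, cA b v != 0 -> dg b = p;
  hb_deg : forall b b', gr (dg b + dg b') (bv b * bv b');
  hb_ix_e : forall i, ix (e i) = i;
  hb_e_deg : forall i, dg (e i) = 0;
  hb_e_idem : forall i, bv (e i) * bv (e i) = bv (e i);
  hb_chiM : forall i u v,
    cA (e i) (u * bv (e i) * v) = cA (e i) u * cA (e i) v;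
  hb_above : forall i u v b, cA b (u * bv (e i) * v) != 0 -> (i <= ix b)%O;
  hb_corner : forall i u b,
    cA b (bv (e i) * u * bv (e i) - cA (e i) u *: bv (e i)) != 0 ->
    (i < ix b)%O;
  hb_factor : forall b, exists u v, bv b = u * bv (e (ix b)) * v }.

Section Part.
Variables (R : comNzRingType) (A : algType R) (Bt : finType).
Variables (bv : Bt -> A) (cA : Bt -> {scalar A}) (dg : Bt -> deg).

(** The homogeneous component of degree p. *)
Definition part p v := \sum_(b | dg b == p) cA b v *: bv b.

Lemma part_linear p : linear (part p).
Proof.
move=> c u v; rewrite /part scaler_sumr -big_split /=; apply: eq_bigr => b _.
by rewrite linearP /= scalerDl scalerA.
Qed.
HB.instance Definition _ p := GRing.isLinear.Build R A A _ (part p) (part_linear p).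
End Part.

Section BasisFacts.
Variables (R : comNzRingType) (A : algType R) (gr : deg -> set A).
Variables (disp : Order.disp_t) (I : finPOrderType disp) (Bt : finType).
Variables (bv : Bt -> A) (cA : Bt -> {scalar A}) (dg : Bt -> deg).
Variables (ix : Bt -> I) (e : I -> Bt).
Hypothesis hb : heredity_basis gr bv cA dg ix e.

Local Notation chi i := (cA (e i)).
Local Notation ee i := (bv (e i)).
Local Notation part := (part bv cA dg).

Lemma cA_ext u v : (forall b, cA b u = cA b v) -> u = v.
Proof.
by move=> uv; rewrite (hb_expand hb u) (hb_expand hb v); apply: eq_bigr => b _; rewrite uv.
Qed.

(** Bilinear identities between products only have to be checked on the basis. *)
Lemma cA_mul b u v :
  cA b (u * v) = \sum_b1 \sum_b2 cA b1 u * cA b2 v * cA b (bv b1 * bv b2).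
Proof.
rewrite {1}(hb_expand hb u) {1}(hb_expand hb v) mulr_suml linear_sum.
apply: eq_bigr => b1 _; rewrite mulr_sumr linear_sum; apply: eq_bigr => b2 _.
by rewrite -scalerAl -scalerAr scalerA linearZ.
Qed.

Lemma cA_mul3 b u v w : cA b (u * v * w) =
  \sum_b1 \sum_b2 cA b1 u * cA b2 w * cA b (bv b1 * v * bv b2).
Proof.
rewrite {1}(hb_expand hb u) {1}(hb_expand hb w) !mulr_suml linear_sum.
apply: eq_bigr => b1 _; rewrite mulr_sumr linear_sum; apply: eq_bigr => b2 _.
by rewrite -!scalerAl -scalerAr scalerA linearZ.
Qed.

Lemma chi_e i : chi i (ee i) = 1.
Proof. by rewrite (hb_coord hb) eqxx. Qed.

Lemma chi1 i : chi i 1 = 1.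
Proof.
by have := hb_chiM hb i 1 (ee i); rewrite mul1r (hb_e_idem hb) chi_e mulr1.
Qed.

Lemma chi_er i v : chi i (v * ee i) = chi i v.
Proof. by have := hb_chiM hb i v 1; rewrite mulr1 chi1 mulr1. Qed.

Lemma chi_el i v : chi i (ee i * v) = chi i v.
Proof. by have := hb_chiM hb i 1 v; rewrite mul1r chi1 mul1r. Qed.

Lemma gr_mul p q u v : gr p u -> gr q v -> gr (p + q) (u * v).
Proof.
move=> /(hb_gr hb) gu /(hb_gr hb) gv; apply/(hb_gr hb) => b.
apply: contraNeq => nb; rewrite cA_mul big1 // => b1 _; rewrite big1 // => b2 _.
have [->|/gu e1] := eqVneq (cA b1 u) 0; first by rewrite !mul0r.
have [->|/gv e2] := eqVneq (cA b2 v) 0; first by rewrite mulr0 mul0r.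
have /(hb_gr hb)/(_ b) g := hb_deg hb b1 b2.
case: (eqVneq (cA b (bv b1 * bv b2)) 0) => [->|/g]; first by rewrite mulr0.
by rewrite e1 e2 => /eqP; rewrite (negPf nb).
Qed.

Lemma cA_part b p v : cA b (part p v) = if dg b == p then cA b v else 0.
Proof.
rewrite linear_sum; case: ifP => bp; last first.
  by apply: big1 => b' b'p; rewrite linearZ /= (hb_coord hb); case: (b =P b') b'p => [<-|]; rewrite ?bp ?mulr0.
rewrite (bigD1 b) //= linearZ /= (hb_coord hb) eqxx mulr1 big1 ?addr0 // => b' /andP[_].
by rewrite linearZ /= (hb_coord hb) eq_sym => /negPf->; rewrite mulr0.
Qed.

Lemma gr_part p v : gr p (part p v).
Proof. by apply/(hb_gr hb) => b; rewrite cA_part; case: (dg b =P p) => // _; rewrite eqxx. Qed.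

Lemma part_id p v : gr p v -> part p v = v.
Proof.
move=> /(hb_gr hb) g; apply: cA_ext => b; rewrite cA_part; case: (dg b =P p) => // np.
by have [->//|/g] := eqVneq (cA b v) 0.
Qed.

Lemma part_other p q v : gr p v -> q != p -> part q v = 0.
Proof.
move=> /(hb_gr hb) g qp; apply: cA_ext => b; rewrite cA_part linear0.
case: (dg b =P q) => // bq; apply/eqP; by apply: contraNT qp => /g <-; rewrite bq.
Qed.

Lemma gr_submod p : is_submodule (gr p).
Proof.
split=> [|c u v /(hb_gr hb) gu /(hb_gr hb) gv]; apply/(hb_gr hb) => b; first by rewrite linear0 eqxx.
rewrite linearP /=; have [->|/gu->//] := eqVneq (cA b u) 0.
by rewrite mulr0 add0r => /gv.
Qed.

Definition degs : seq deg := undup [seq dg b | b : Bt].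

Lemma part_sum v : v = \sum_(p <- degs) part p v.
Proof.
apply: cA_ext => b; rewrite linear_sum.
rewrite (bigD1_seq (dg b)) ?undup_uniq //=; last first.
  by rewrite mem_undup; apply/mapP; exists b; rewrite ?mem_enum.
rewrite cA_part eqxx big1 ?addr0 // => p np; by rewrite cA_part eq_sym (negPf np).
Qed.

(** Ideals will be given by linear conditions, and for these closure under
    homogeneous components is what can be verified. *)
Lemma homogeneous_ideal_from_parts (J : set A) : is_submodule J ->
  (forall u v, J v -> J (u * v) /\ J (v * u)) ->
  (forall p v, J v -> J (part p v)) -> is_homogeneous_ideal *%R gr J.
Proof.
move=> sJ iJ pJ; split=> // v Jv; exists degs, (fun p => part p v); split.
- exact: undup_uniq.
- by move=> p; apply: gr_part.
- by move=> p; apply: pJ.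
- exact: part_sum.
Qed.

Lemma part_mulr p q u v : gr q u -> part (p + q) (v * u) = part p v * u.
Proof.
move=> gu; rewrite {1}(part_sum v) mulr_suml linear_sum /=.
have [pin|pnin] := boolP (p \in degs).
  rewrite (bigD1_seq p) ?undup_uniq //= (part_id (gr_mul (gr_part p v) gu)).
  rewrite big1 ?addr0 // => r rp; rewrite (part_other (gr_mul (gr_part r v) gu)) //.
  by apply: contra rp => /eqP/addIr->.
have -> : part p v = 0.
  apply: cA_ext => b; rewrite cA_part linear0; case: (dg b =P p) => // bp; case/negP: pnin.
  by rewrite -bp mem_undup; apply/mapP; exists b; rewrite ?mem_enum.
rewrite mul0r big_seq big1 // => r rin; rewrite (part_other (gr_mul (gr_part r v) gu)) //.
by apply: contraNneq pnin => /addIr->.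
Qed.

Lemma part_mull p q u v : gr q u -> part (q + p) (u * v) = u * part p v.
Proof.
move=> gu; rewrite {1}(part_sum v) mulr_sumr linear_sum /=.
have [pin|pnin] := boolP (p \in degs).
  rewrite (bigD1_seq p) ?undup_uniq //= (part_id (gr_mul gu (gr_part p v))).
  rewrite big1 ?addr0 // => r rp; rewrite (part_other (gr_mul gu (gr_part r v))) //.
  by apply: contra rp => /eqP/addrI->.
have -> : part p v = 0.
  apply: cA_ext => b; rewrite cA_part linear0; case: (dg b =P p) => // bp; case/negP: pnin.
  by rewrite -bp mem_undup; apply/mapP; exists b; rewrite ?mem_enum.
rewrite mulr0 big_seq big1 // => r rin; rewrite (part_other (gr_mul gu (gr_part r v))) //.
by apply: contraNneq pnin => /addrI->.
Qed.

Lemma gr_bv b : gr (dg b) (bv b).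
Proof. by apply/(hb_gr hb) => b'; rewrite (hb_coord hb); case: (b' =P b) => [->|]; rewrite ?eqxx. Qed.

Lemma chi_part i p v : chi i (part p v) = if p == 0 then chi i v else 0.
Proof. by rewrite cA_part (hb_e_deg hb) eq_sym. Qed.

End BasisFacts.

(** * The radical over a field *)

Section HeredityOverField.
Variables (F : fieldType) (A : algType F) (gr : deg -> set A).
Variables (disp : Order.disp_t) (I : finPOrderType disp) (Bt : finType).
Variables (bv : Bt -> A) (cA : Bt -> {scalar A}) (dg : Bt -> deg).
Variables (ix : Bt -> I) (e : I -> Bt).
Hypothesis hb : heredity_basis gr bv cA dg ix e.

Local Notation chi i := (cA (e i)).
Local Notation ee i := (bv (e i)).
Local Notation part := (part bv cA dg).

(** The simple module with label i is the head of A e_i, and the functions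
    v |-> chi_i (u v w) are its matrix coefficients; so [rad] consists of the elements
    that act as zero on all simple modules. *)
Definition rad : set A := fun v => forall i u w, chi i (u * v * w) = 0.

Lemma rad_mul u v : rad v -> rad (u * v) /\ rad (v * u).
Proof.
move=> rv; split=> i x y; first by rewrite mulrA rv.
by rewrite mulrA -mulrA rv.
Qed.

Lemma chi_mid i b1 p v b2 : chi i (bv b1 * part p v * bv b2) =
  if dg b1 + p + dg b2 == 0 then chi i (bv b1 * v * bv b2) else 0.
Proof.
rewrite -(part_mull hb p v (gr_bv hb b1)) -(part_mulr hb _ _ (gr_bv hb b2)).
exact: (chi_part hb).
Qed.

Lemma chi_basis i v : (forall b1 b2, chi i (bv b1 * v * bv b2) = 0) ->
  forall u w, chi i (u * v * w) = 0.
Proof.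
move=> h u w; rewrite (cA_mul3 hb) big1 // => b1 _; rewrite big1 // => b2 _.
by rewrite h mulr0.
Qed.

Lemma rad_part p v : rad v -> rad (part p v).
Proof.
move=> rv i; apply: chi_basis => b1 b2; rewrite chi_mid rv.
by case: ifP.
Qed.

(** The vectors v with chi_i (h v) = 0 for all h form a maximal left ideal: a
    vector outside it has a left multiple that is congruent to 1. *)
Lemma jacobson_chi i v : jacobson_radical v -> forall h, chi i (h * v) = 0.
Proof.
move=> Jv; apply: (Jv (fun x => forall h, chi i (h * x) = 0)); split.
- split=> [h|x y Lx Ly h|a x Lx h]; first by rewrite mulr0 linear0.
  + by rewrite mulrDr linearD /= Lx Ly addr0.
  + by rewrite mulrA.
- by move=> /(_ 1); rewrite mulr1 (chi1 hb) => /eqP; rewrite oner_eq0.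
move=> L' [L0 LD LM] sub no1 x L'x h; apply/eqP/negPn/negP => nz; apply: no1.
pose c := chi i (h * x).
have -> : 1 = (1 - c^-1 *: (ee i * (h * x))) + c^-1 *: (ee i * (h * x)) by rewrite subrK.
apply: LD; last by rewrite scalerAl mulrA; apply: LM.
apply: sub => h'; rewrite mulrBr mulr1 linearB /= -scalerAr linearZ /= mulrA (hb_chiM hb).
by rewrite mulrC -/c mulfK // subrr.
Qed.

Lemma Z2_cases (x : 'Z_2) : x = 0 \/ x = 1.
Proof. by case: x => [[|[|//]] h]; [left|right]; apply/val_inj. Qed.

Section Odd.
Hypothesis oddJ : forall x, parity_part gr 1 x -> jacobson_radical x.

(** Between two basis vectors, either v b2 or b2 is odd, and the odd factor makes
    chi_i vanish. *)
Lemma odd_rad m v : gr (m, 1) v -> rad v.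
Proof.
move=> gv i; apply: chi_basis => b1 b2.
have gb : gr (dg b2) (bv b2) := gr_bv hb b2; case: (dg b2) gb => m2 q.
case: (Z2_cases q) => -> gb.
  rewrite -mulrA; apply: jacobson_chi; apply: oddJ; apply: span_in.
  by exists (m + m2); have := gr_mul hb gv gb; rewrite /GRing.add /= /add_pair /= addr0.
by apply: jacobson_chi; apply: oddJ; apply: span_in; exists m2.
Qed.
End Odd.

Definition height (i : I) := #|[pred j | (j < i)%O]|.

Lemma height_lt i j : (i < j)%O -> (height i < height j)%N.
Proof.
move=> ij; apply/proper_card/properP; split.
  by apply/fintype.subsetP => l; rewrite !inE => /lt_trans; apply.
by exists i; rewrite !inE ?ltxx.
Qed.

Lemma height_max i : (height i < #|I|)%N.
Proof. by apply/proper_card/properP; split; [exact/fintype.subsetP | exists i; rewrite ?inE ?ltxx]. Qed.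

(** The filtration of A by two-sided ideals attached to the height of labels. *)
Definition height_ge (t : nat) : set A := fun v => forall b, cA b v != 0 -> (t <= height (ix b))%N.

Lemma cA_above b u v w : cA b (u * v * w) != 0 ->
  exists2 b', cA b' v != 0 & (ix b' <= ix b)%O.
Proof.
move=> nz; suff /existsP[b' /andP[? ?]] : [exists b', (cA b' v != 0) && (ix b' <= ix b)%O] by exists b'.
apply: contraNT nz => /existsPn no.
rewrite (hb_expand hb v) mulr_sumr mulr_suml linear_sum big1 // => b' _.
rewrite -scalerAr -scalerAl linearZ /=.
have [->|nb'] := eqVneq (cA b' v) 0; first by rewrite mul0r.
have [x [y ->]] := hb_factor hb b'.
have [->|] := eqVneq (cA b (u * (x * ee (ix b') * y) * w)) 0; first by rewrite mulr0.
rewrite !mulrA -mulrA => /(hb_above hb) le.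
by case/negP: (no b'); rewrite nb' le.
Qed.

(** A product through e_i and e_j with i <> j involves only indices above both,
    and one through e_i twice has index i only with the coefficient chi_i of the
    middle factor, which vanishes on the radical. *)
Lemma height_ge_sandwich t u v w : height_ge t u -> rad v -> height_ge t w -> height_ge t.+1 (u * v * w).
Proof.
move=> uu rv uw b; apply: contraNT => nb.
rewrite (cA_mul3 hb) big1 // => b1 _; rewrite big1 // => b2 _.
have [->|/uu h1] := eqVneq (cA b1 u) 0; first by rewrite !mul0r.
have [->|/uw h2] := eqVneq (cA b2 w) 0; first by rewrite mulr0 mul0r.
have [->|nz] := eqVneq (cA b (bv b1 * v * bv b2)) 0; first by rewrite mulr0.
case/negP: nb; move: nz.
have [x1 [y1 ->]] := hb_factor hb b1; have [x2 [y2 ->]] := hb_factor hb b2.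
set i := ix b1 in h1 *; set j := ix b2 in h2 *.
have [ij|ij] := eqVneq i j.
  rewrite -ij.
  have -> : x1 * ee i * y1 * v * (x2 * ee i * y2) =
    x1 * (ee i * (y1 * v * x2) * ee i - chi i (y1 * v * x2) *: ee i) * y2.
    by rewrite rv scale0r subr0 !mulrA.
  move=> /cA_above[b' /(hb_corner hb) lt1 le2].
  exact: leq_ltn_trans h1 (height_lt (lt_le_trans lt1 le2)).
move=> nz.
have le1 : (i <= ix b)%O.
  by apply: (hb_above hb (i := i) (u := x1) (v := y1 * v * (x2 * ee j * y2))); rewrite !mulrA in nz *.
have le2 : (j <= ix b)%O.
  by apply: (hb_above hb (i := j) (u := x1 * ee i * y1 * v * x2) (v := y2)); rewrite !mulrA in nz *.
move: le1; rewrite le_eqVlt => /predU1P[ib|/height_lt lt]; last exact: leq_ltn_trans h1 lt.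
move: le2; rewrite le_eqVlt => /predU1P[jb|/height_lt lt]; last exact: leq_ltn_trans h2 lt.
by case/eqP: ij; rewrite ib jb.
Qed.

(** A product of 3 ^ (t + 1) factors splits into three thirds, and the outer two
    are sandwiched around the middle one. *)
Definition nilbound := (3 ^ #|I|)%N.

Lemma prod_rad (s : seq A) : (forall x, x \in s -> rad x) -> s != [::] ->
  rad (\prod_(x <- s) x).
Proof.
case: s => // x s h _; rewrite big_cons; apply: (proj2 (rad_mul _ _)).
by apply: h; rewrite inE eqxx.
Qed.

Lemma prod_height_ge t (s : seq A) : (forall x, x \in s -> rad x) -> (3 ^ t <= size s)%N ->
  height_ge t (\prod_(x <- s) x).
Proof.
elim: t s => [|t IH] s rs ls; first by move=> b _.
have l3 : (3 ^ t <= size (drop (3 ^ t) (drop (3 ^ t) s)))%N.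
  by rewrite !size_drop; move: ls; rewrite expnS; lia.
rewrite -(cat_take_drop (3 ^ t) s) -(cat_take_drop (3 ^ t) (drop (3 ^ t) s)) !big_cat /= mulrA.
apply: height_ge_sandwich; last 1 first.
- by apply: IH => // x /mem_drop/mem_drop/rs.
- by apply: IH => [x /mem_take/rs //|]; rewrite size_takel //; move: ls; rewrite expnS; lia.
- apply: prod_rad => [x /mem_take/mem_drop/rs //|].
  rewrite -size_eq0 size_takel; last by rewrite size_drop; move: ls {l3 IH}; rewrite expnS; move: (3 ^ t)%N (size s) => p q; lia.
  by rewrite -lt0n expn_gt0.
Qed.

Lemma height_ge_zero t v : (#|I| <= t)%N -> height_ge t v -> v = 0.
Proof.
move=> lt uv; apply: (cA_ext hb) => b; rewrite linear0; apply/eqP/negPn/negP => /uv.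
by rewrite leqNgt (leq_trans (height_max _)).
Qed.

Lemma prod_rad0 (s : seq A) : (forall x, x \in s -> rad x) -> (nilbound <= size s)%N ->
  \prod_(x <- s) x = 0.
Proof. by move=> rs ls; apply: (@height_ge_zero #|I|) => //; apply: prod_height_ge. Qed.

(** The powers of the radical; the left factor u makes the zeroth power all of A. *)
Definition rad_pow (t : nat) : set A := Defs.span (fun v => exists (u : A) (s : seq A),
  [/\ size s = t, forall x, x \in s -> rad x & v = u * \prod_(x <- s) x]).

Lemma rad_pow0 v : rad_pow 0 v.
Proof. by apply: span_in; exists v, [::]; rewrite big_nil mulr1. Qed.

Lemma rad_pow1 v : rad v -> rad_pow 1 v.
Proof.
move=> rv; apply: span_in; exists 1, [:: v]; split=> //; last by rewrite big_seq1 mul1r.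
by move=> x; rewrite inE => /eqP->.
Qed.

Lemma rad_pow_nil t v : (nilbound <= t)%N -> rad_pow t v -> v = 0.
Proof.
move=> lt; apply: (span_sub (P := fun v => v = 0)) => [|w [u [s [ss rs ->]]]].
  by split=> // c x y -> ->; rewrite scaler0 addr0.
by rewrite prod_rad0 ?mulr0 ?ss.
Qed.

Lemma rad_pow_submod t : is_submodule (rad_pow t).
Proof. exact: span_submod. Qed.

Lemma rad_pow_mul t1 t2 v w : rad_pow t1 v -> rad_pow t2 w -> rad_pow (t1 + t2) (v * w).
Proof.
move=> h1 h2; apply: (span_sub (P := fun v => rad_pow (t1 + t2) (v * w))) h1.
  have [s0 sZ] := rad_pow_submod (t1 + t2); split=> [|c x y hx hy]; first by rewrite mul0r.
  by rewrite mulrDl -scalerAl; apply: sZ.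
move=> _ [u [s [ss rs ->]]].
apply: (span_sub (P := fun w => rad_pow (t1 + t2) (u * \prod_(x <- s) x * w))) h2.
  have [s0 sZ] := rad_pow_submod (t1 + t2); split=> [|c x y hx hy]; first by rewrite mulr0.
  by rewrite mulrDr -scalerAr; apply: sZ.
move=> _ [u' [s' [ss' rs' ->]]]; apply: span_in.
(* The factor u' is absorbed by the last radical element of the first product. *)
case: (lastP s) ss rs => [|s1 x] ss rs.
  by exists (u * u'), s'; rewrite -ss add0n big_nil mulr1 mulrA.
exists u, (rcons s1 (x * u') ++ s'); split.
- by rewrite size_cat size_rcons ss' -ss size_rcons.
- move=> y; rewrite mem_cat mem_rcons inE => /orP[/predU1P[->|ys]|/rs' //].
    by apply: (proj2 (rad_mul _ _)); apply: rs; rewrite mem_rcons inE eqxx.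
  by apply: rs; rewrite mem_rcons inE ys orbT.
by rewrite big_cat /= -!cats1 !big_cat /= !big_seq1 !mulrA.
Qed.

End HeredityOverField.

(** * Consequences of indecomposability *)

Section Linkage.
Variables (F : fieldType) (A : algType F) (gr : deg -> set A).
Variables (disp : Order.disp_t) (I : finPOrderType disp) (Bt : finType).
Variables (bv : Bt -> A) (cA : Bt -> {scalar A}) (dg : Bt -> deg).
Variables (ix : Bt -> I) (e : I -> Bt).
Hypothesis hb : heredity_basis gr bv cA dg ix e.
Hypothesis indecA : indecomposable *%R gr.

Local Notation chi i := (cA (e i)).
Local Notation ee i := (bv (e i)).
Local Notation part := (part bv cA dg).
Local Notation rad := (rad cA e).

Definition annihilates_rad x := forall v, rad v -> v * x = 0 /\ x * v = 0.

Lemma ann_submod : is_submodule annihilates_rad.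
Proof.
split=> [v _|c x y ax ay v rv]; first by rewrite mulr0 mul0r.
have [vx xv] := ax v rv; have [vy yv] := ay v rv.
by rewrite mulrDr mulrDl -scalerAr -scalerAl vx xv vy yv scaler0 addr0.
Qed.

Lemma ann_mul u x w : annihilates_rad x -> annihilates_rad (u * x * w).
Proof.
move=> ax v rv; have [vux _] := ax _ (proj2 (rad_mul u rv)).
have [_ xwv] := ax _ (proj1 (rad_mul w rv)).
by rewrite !mulrA vux mul0r -!mulrA xwv mulr0.
Qed.

Lemma ann_part p x : annihilates_rad x -> annihilates_rad (part p x).
Proof.
move=> ax v rv; rewrite {1}(part_sum hb v) {2}(part_sum hb v) mulr_suml mulr_sumr.
by split; apply: big1 => q _; have [h1 h2] := ax _ (rad_part hb q rv);
  [rewrite -(part_mull hb _ _ (gr_part hb q v)) h1 | rewrite -(part_mulr hb _ _ (gr_part hb q v)) h2];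
  rewrite linear0.
Qed.

Lemma chi_basis_eq i (f g : A -> A) :
  (forall b1 b2, chi i (bv b1 * f 1 * bv b2) = chi i (bv b1 * g 1 * bv b2)) ->
  forall u w, chi i (u * f 1 * w) = chi i (u * g 1 * w).
Proof.
move=> h u w; rewrite !(cA_mul3 hb); apply: eq_bigr => b1 _; apply: eq_bigr => b2 _.
by rewrite h.
Qed.

Lemma chi_part0_unit i z : (forall u w, chi i (u * z * w) = chi i (u * w)) ->
  forall u w, chi i (u * part 0 z * w) = chi i (u * w).
Proof.
move=> h u w; rewrite -[in RHS](mulr1 u); apply: (@chi_basis_eq i (fun _ => part 0 z) id) => b1 b2 /=.
rewrite (chi_mid hb) h mulr1 addr0; case: ifP => // ne; apply/esym.
by rewrite -(part_id hb (gr_mul hb (gr_bv hb b1) (gr_bv hb b2))) (chi_part hb) ne.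
Qed.

Lemma chi_part0_zero i z : (forall u w, chi i (u * z * w) = 0) ->
  forall u w, chi i (u * part 0 z * w) = 0.
Proof.
by move=> h; apply: (chi_basis hb) => b1 b2; rewrite (chi_mid hb) h; case: ifP.
Qed.

(** If the two-sided annihilator of the radical were not contained in the
    radical, it would act as a full matrix block on some simple module; an
    element acting as the identity of that block and as 0 on the others squares
    to a central idempotent of degree 0, because its defect from being central
    and idempotent lies in the radical, which it annihilates. *)
Lemma ann_sub_rad (i0 j0 : I) : i0 != j0 ->
  forall x, annihilates_rad x -> rad x.
Proof.
move=> ij0 x0 ax0; apply: contrapT => nr.
pose P i := `[< exists2 x, annihilates_rad x & chi i x != 0 >].
have [i1 Pi1] : exists i, P i.
  move/existsNP: nr => [i /existsNP[u /existsNP[w /eqP nz]]]; exists i; apply/asboolP.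
  by exists (u * x0 * w) => //; apply: ann_mul.
(* For a label i of maximal height, z' below vanishes on the other simple modules. *)
case: (arg_maxnP (fun i => height i) Pi1) => i /asboolP[x ax nx] maxi.
have notP j : (i < j)%O -> forall y, annihilates_rad y -> chi j y = 0.
  move=> ij y ay; apply/eqP/negPn/negP => ny.
  by have := maxi j (asboolT (ex_intro2 _ _ y ay ny)); rewrite /= leqNgt (height_lt ij).
(* z' acts as the identity on the simple module with label i. *)
have [C CP] := generalized_inverse (fun b b' => chi i (bv b * bv b')).
pose z' := \sum_b \sum_b' (C b b' * (chi i x)^-1) *: (bv b * ee i * x * ee i * bv b').
have az' : annihilates_rad z'.
  apply: submod_sum => [|b _]; first exact: ann_submod.
  apply: submod_sum => [|b' _]; first exact: ann_submod.
  apply: (submodZ _ ann_submod); rewrite -[_ * ee i * bv b']mulrA; exact: ann_mul.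
have z'i u w : chi i (u * z' * w) = chi i (u * w).
  rewrite -[in RHS](mulr1 u); apply: (@chi_basis_eq i (fun _ => z') id) => b1 b2 /=.
  rewrite mulr1 -CP mulr_sumr mulr_suml linear_sum; apply: eq_bigr => b _.
  rewrite mulr_sumr mulr_suml linear_sum; apply: eq_bigr => b' _.
  rewrite -scalerAr -scalerAl linearZ /=.
  have -> : bv b1 * (bv b * ee i * x * ee i * bv b') * bv b2 =
    bv b1 * bv b * ee i * (x * ee i * (bv b' * bv b2)) by rewrite !mulrA.
  rewrite !(hb_chiM hb) mulrCA !mulrA; congr (_ * _).
  by rewrite -!mulrA mulVf // mulr1.
have z'j j : j != i -> forall u w, chi j (u * z' * w) = 0.
  move=> ji u w; have [/andP[_ ij]|nij] := boolP ((j != i) && (i <= j)%O).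
    by apply: notP; [rewrite lt_neqAle eq_sym ji | apply: ann_mul].
  rewrite mulr_sumr mulr_suml linear_sum big1 // => b _.
  rewrite mulr_sumr mulr_suml linear_sum big1 // => b' _.
  rewrite -scalerAr -scalerAl linearZ /=.
  have [->|] := eqVneq (chi j (u * (bv b * ee i * x * ee i * bv b') * w)) 0; first by rewrite mulr0.
  have -> : u * (bv b * ee i * x * ee i * bv b') * w =
    (u * bv b) * ee i * (x * ee i * bv b' * w) by rewrite !mulrA.
  by move/(hb_above hb); rewrite (hb_ix_e hb) => ij; rewrite ji ij in nij.
pose z1 := part 0 z'; pose z := z1 * z1.
have az1 : annihilates_rad z1 by apply: ann_part.
have z1i := chi_part0_unit z'i; have z1j j ji := chi_part0_zero (z'j j ji).
have defect v : rad (z1 * v - v * z1).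
  move=> j u w; rewrite mulrBr mulrBl linearB /=; have [->|ji] := eqVneq j i.
    by rewrite !mulrA -[u * z1 * v * w]mulrA z1i mulrA z1i subrr.
  by rewrite !mulrA -[u * z1 * v * w]mulrA !z1j // subrr.
have idem : rad (z1 * z1 - z1).
  move=> j u w; rewrite mulrBr mulrBl linearB /=; have [->|ji] := eqVneq j i.
    by rewrite !mulrA -[u * z1 * z1 * w]mulrA z1i mulrA z1i subrr.
  by rewrite !mulrA -[u * z1 * z1 * w]mulrA !z1j // subrr.
have cz v : z * v = v * z.
  apply/eqP; rewrite -subr_eq0; apply/eqP.
  have -> : z * v - v * z = z1 * (z1 * v - v * z1) + (z1 * v - v * z1) * z1.
    by rewrite mulrBr mulrBl !mulrA addrA subrK.
  by have [-> ->] := az1 _ (defect v); rewrite addr0.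
have z1_3 : z1 * z = z1 * z1.
  by apply/eqP; rewrite -subr_eq0 -mulrBr; have [_ ->] := az1 _ idem.
have zz : z * z = z by rewrite /z -mulrA z1_3.
have gz : gr 0 z by have := gr_mul hb (gr_part hb 0 z') (gr_part hb 0 z'); rewrite addr0.
have chiz : chi i z = 1.
  by have := z1i z1 1; have := z1i 1 1; rewrite !mul1r !mulr1 => -> ->; rewrite (chi1 hb).
case: indecA; exists (fun v => z * v = v), (fun v => z * v = 0); split.
- split; apply: (homogeneous_ideal_from_parts hb).
  + by split=> [|c u v zu zv]; rewrite ?mulr0 // mulrDr -scalerAr zu zv.
  + by move=> u v zv; split; [rewrite mulrA cz -mulrA zv | rewrite mulrA zv].
  + by move=> p v zv; rewrite -(part_mull hb _ _ gz) add0r zv.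
  + by split=> [|c u v zu zv]; rewrite ?mulr0 // mulrDr -scalerAr zu zv scaler0 addr0.
  + by move=> u v zv; split; [rewrite mulrA cz -mulrA zv mulr0 | rewrite mulrA zv mul0r].
  + by move=> p v zv; rewrite -(part_mull hb _ _ gz) zv linear0.
- split; first by exists z => //; apply: contra_eqN chiz => /eqP->; rewrite linear0 eq_sym oner_eq0.
  exists (1 - z); first by rewrite mulrBr mulr1 zz subrr.
  have [j ji] : exists j, j != i.
    by have [ei|] := eqVneq i0 i; [exists j0; rewrite -ei eq_sym | exists i0].
  apply/eqP => /(congr1 (chi j)); rewrite linearB linear0 /= (chi1 hb).
  by have := z1j j ji z1 1; rewrite mulr1 => ->; rewrite subr0 => /eqP; rewrite oner_eq0.
- by move=> v zv; rewrite zv.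
- move=> v; exists (z * v), (v - z * v); split; first by rewrite mulrA zz.
    by rewrite mulrBr mulrA zz subrr.
  by rewrite addrC subrK.
Qed.

Section Central.
Variable x : A.
Hypothesis cx : forall v, x * v = v * x.

Lemma central_part0 v : part 0 x * v = v * part 0 x.
Proof.
rewrite (hb_expand hb v) mulr_sumr [RHS]mulr_suml; apply: eq_bigr => b _.
rewrite -scalerAr -scalerAl -(part_mulr hb _ _ (gr_bv hb b)) -(part_mull hb _ _ (gr_bv hb b)).
by rewrite cx addrC.
Qed.

Local Notation ev := (horner_alg (part 0 x)).

Lemma chi_mul_central i u y : (forall v, y * v = v * y) ->
  chi i (u * y) = chi i u * chi i y.
Proof. by move=> cy; rewrite -(chi_er hb) -mulrA cy mulrA (hb_chiM hb). Qed.

Lemma ev_central p v : ev p * v = v * ev p.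
Proof.
elim/poly_ind: p => [|p c IH]; first by rewrite linear0 mul0r mulr0.
rewrite linearD /= rmorphM /= horner_algX horner_algC mulrDl mulrDr.
by congr (_ + _); [rewrite -mulrA central_part0 !mulrA IH | rewrite -scalerAl -scalerAr mul1r mulr1].
Qed.

(** A central element of degree 0 does not mix degrees; this makes its generalized
    eigenspaces homogeneous. *)
Lemma part_ev p q v : part q (ev p * v) = ev p * part q v.
Proof.
elim/poly_ind: p v => [|p c IH] v; first by rewrite linear0 !mul0r linear0.
rewrite linearD /= rmorphM /= horner_algX horner_algC !mulrDl -!scalerAl !mul1r.
rewrite linearD linearZ /= -!mulrA IH; congr (_ * _ + _).
by rewrite -(part_mull hb _ _ (gr_part hb 0 x)) add0r.
Qed.

Lemma chi_ev i p : chi i (ev p) = p.[chi i x].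
Proof.
elim/poly_ind: p => [|p c IH]; first by rewrite linear0 linear0 horner0.
rewrite linearD /= rmorphM /= horner_algX horner_algC linearD linearZ /= (chi1 hb) mulr1.
rewrite chi_mul_central; last exact: central_part0.
by rewrite IH (chi_part hb) eqxx hornerMXaddC.
Qed.

(** Distinct eigenvalues of a central element on the simple modules would split
    A into generalized eigenspaces, which are homogeneous ideals. *)
Lemma central_char (i j : I) : chi i x = chi j x.
Proof.
apply/eqP/negPn/negP => nij; set c := chi i x in nij.
pose P := 'X - c%:P; pose Q := \prod_(l | chi l x != c) ('X - (chi l x)%:P).
pose N := nilbound I.
have cop : coprimep (P ^+ N) (Q ^+ N).
  apply/coprimep_expl/coprimep_expr; rewrite coprimep_sym coprimep_XsubC.
  rewrite /root horner_prod; apply/prodf_neq0 => l ne.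
  by rewrite hornerXsubC subr_eq0 eq_sym.
have [u [v bez]] : exists u v, u * P ^+ N + v * Q ^+ N = 1.
  move/Bezout_coprimepP: cop => [[u v] /eqpP[[c1 c2] /= /andP[_ nc2] eq12]].
  exists ((c1 / c2) *: u), ((c1 / c2) *: v); rewrite -!scalerAl -scalerDr mulrC -scalerA eq12.
  by rewrite scalerA mulVf // scale1r.
have rPQ : rad (ev (P * Q)).
  move=> l u' w; rewrite -mulrA ev_central mulrA chi_mul_central; last exact: ev_central.
  rewrite chi_ev hornerM hornerXsubC; have [->|ne] := eqVneq (chi l x) c.
    by rewrite subrr mul0r mulr0.
  by rewrite horner_prod (bigD1 l) //= hornerXsubC subrr mul0r !mulr0.
have PQ0 : ev (P ^+ N) * ev (Q ^+ N) = 0.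
  rewrite -rmorphM -exprMn rmorphXn /= -[_ ^+ _]/(_ ^+ _).
  have := @prod_rad0 _ _ _ _ _ _ _ _ _ _ _ hb (nseq N (ev (P * Q))).
  by rewrite big_nseq iter_mulr_1 size_nseq; apply => // y /nseqP[->].
have bez' w : w = ev u * (ev (P ^+ N) * w) + ev v * (ev (Q ^+ N) * w).
  by rewrite !mulrA -mulrDl -!rmorphM -rmorphD /= bez rmorph1 mul1r.
case: indecA; exists (fun v => ev (P ^+ N) * v = 0), (fun v => ev (Q ^+ N) * v = 0).
have idl p : is_homogeneous_ideal *%R gr (fun v => ev p * v = 0).
  apply: (homogeneous_ideal_from_parts hb).
  - by split=> [|a y1 y2 h1 h2]; rewrite ?mulr0 // mulrDr -scalerAr h1 h2 scaler0 addr0.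
  - by move=> y1 y2 h; split; [rewrite mulrA ev_central -mulrA h mulr0 | rewrite mulrA h mul0r].
  - by move=> q y h; rewrite -part_ev h linear0.
split=> //.
- split; [exists (ev (Q ^+ N)) => //|exists (ev (P ^+ N))].
  + apply/eqP => /(congr1 (chi i)); rewrite linear0 chi_ev horner_exp => /eqP.
    by rewrite expf_eq0 horner_prod => /andP[_ /prodf_eq0[l]]; rewrite hornerXsubC subr_eq0 eq_sym => /negPf->.
  + by rewrite ev_central.
  apply/eqP => /(congr1 (chi j)); rewrite linear0 chi_ev horner_exp => /eqP.
  by rewrite expf_eq0 hornerXsubC subr_eq0 eq_sym (negPf nij) andbF.
- by move=> w Pw Qw; rewrite (bez' w) Pw Qw !mulr0 addr0.
move=> w; exists (ev v * (ev (Q ^+ N) * w)), (ev u * (ev (P ^+ N) * w)).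
split; last by rewrite addrC -bez'.
- by rewrite mulrA ev_central -mulrA [ev (P ^+ N) * (_ * _)]mulrA PQ0 mul0r mulr0.
- by rewrite mulrA ev_central -mulrA [ev (Q ^+ N) * (_ * _)]mulrA [ev (Q ^+ N) * ev _]ev_central PQ0 mul0r mulr0.
Qed.
End Central.
End Linkage.

(** * From heredity data to a heredity basis *)

Section Functionals.
Variables (R : comNzRingType) (V : lmodType R).

Definition mk_scalar (f : V -> R) (H : scalar f) : {scalar V} :=
  HB.pack_for {scalar V} f (GRing.isLinear.Build R V R _ f H).

Definition mk_linear (W : lmodType R) (f : V -> W) (H : linear f) : {linear V -> W} :=
  HB.pack_for {linear V -> W} f (GRing.isLinear.Build R V W *:%R f H).

Lemma coordinates (Bt : finType) (bv : Bt -> V) :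
  (forall v, exists c : Bt -> R, v = \sum_b c b *: bv b) ->
  (forall c : Bt -> R, \sum_b c b *: bv b = 0 -> forall b, c b = 0) ->
  exists cA : Bt -> {scalar V},
    (forall b b', cA b (bv b') = (b == b')%:R) /\
    (forall v, v = \sum_b cA b v *: bv b).
Proof.
move=> gen free.
have [c cP] := choice gen.
have cE v (c' : Bt -> R) : v = \sum_b c' b *: bv b -> forall b, c v b = c' b.
  move=> vE b; apply/eqP; rewrite -subr_eq0; apply/eqP.
  apply: (free (fun b => c v b - c' b)).
  under eq_bigr do rewrite scalerBl.
  by rewrite sumrB -cP -vE subrr.
have clin b : scalar (c^~ b).
  move=> a u v /=; apply: (cE _ (fun b => a * c u b + c v b)).
  under eq_bigr do rewrite scalerDl -scalerA.
  by rewrite big_split /= -scaler_sumr -!cP.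
exists (fun b => mk_scalar (clin b)); split=> [b b' /=|v]; last exact: cP.
apply: (cE _ (fun b => (b == b')%:R)).
rewrite (bigD1 b') //= eqxx scale1r big1 ?addr0 // => b'' /negPf->.
by rewrite scale0r.
Qed.
End Functionals.

Lemma productsP (k : comNzRingType) (A : algType k) (disp : Order.disp_t)
    (I : finPOrderType disp) (X Y : I -> {fset A}) v : reflect (exists i x y, [/\ x \in X i, y \in Y i & v = x * y])
  (v \in products X Y).
Proof.
apply: (iffP (bigfcupP _ _ _ _)) => [[i _ /imfset2P[x xX [y yY ->]]]|[i [x [y [xX yY ->]]]]].
  by exists i, x, y.
exists i; first by rewrite mem_index_enum.
by apply/imfset2P; exists x => //; exists y.
Qed.

Section HeredityBasis.
Variables (k : comNzRingType) (A : algType k) (gr : deg -> set A).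
Hypothesis superA : is_graded_superalgebra *%R gr.
Variables (disp : Order.disp_t) (I : finPOrderType disp).
Variables (X Y : I -> {fset A}) (e : I -> A).
Hypothesis heredA : heredity_data gr setT X Y e.
Variable (a : set A).
Hypotheses (confA : conforming gr a X Y e) (unital_a : a 1).

Local Notation Bt := (products X Y).

Lemma triple_delta i0 x0 y0 : x0 \in X i0 -> y0 \in Y i0 ->
  \sum_i \sum_(x <- X i) \sum_(y <- Y i) ((i, x, y) == (i0, x0, y0))%:R *: (x * y)
  = x0 * y0.
Proof.
move=> xX yY; rewrite (bigD1 i0) //= [X in _ + X]big1 ?addr0; last first.
  move=> i ne; apply: big1 => x _; apply: big1 => y _.
  by rewrite !xpair_eqE (negPf ne) scale0r.
rewrite (bigD1_seq x0) ?fset_uniq //= [X in _ + X]big1 ?addr0; last first.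
  by move=> x ne; apply: big1 => y _; rewrite !xpair_eqE (negPf ne) andbF scale0r.
rewrite (bigD1_seq y0) ?fset_uniq //= [X in _ + X]big1 ?addr0; last first.
  by move=> y ne; rewrite !xpair_eqE (negPf ne) andbF scale0r.
by rewrite eqxx scale1r.
Qed.

(** A coincidence between two products x y would be a linear relation. *)
Lemma triple_inj i x y i' x' y' : x \in X i -> y \in Y i -> x' \in X i' -> y' \in Y i' ->
  x * y = x' * y' -> (i, x, y) = (i', x', y').
Proof.
move=> xX yY xX' yY' eq.
have := hd_free heredA (c := fun j u v => ((j, u, v) == (i, x, y))%:R - ((j, u, v) == (i', x', y'))%:R).
under eq_bigr => j _ do under eq_bigr => u _ do under eq_bigr => v _ do rewrite scalerBl.
under eq_bigr => j _ do under eq_bigr => u _ do rewrite sumrB.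
under eq_bigr => j _ do rewrite sumrB.
rewrite sumrB !triple_delta // eq subrr => /(_ erefl i x y xX yY) /eqP.
by rewrite eqxx; case: ((i, x, y) =P (i', x', y')) => // _; rewrite subr0 oner_eq0.
Qed.

Lemma triple_of : exists tr : Bt -> I * A * A, forall b,
  [/\ (tr b).1.2 \in X (tr b).1.1, (tr b).2 \in Y (tr b).1.1 &
      val b = (tr b).1.2 * (tr b).2].
Proof.
have ex (b : Bt) : exists t : I * A * A, [/\ t.1.2 \in X t.1.1, t.2 \in Y t.1.1 & val b = t.1.2 * t.2].
  by have /productsP[i [x [y h]]] := valP b; exists (i, x, y).
by have [f fP] := choice ex; exists f.
Qed.

(** The properties of A and of the subalgebra a that enter the argument; [isa] and
    [isc] single out the products x y of two even, resp. two odd, elements, so that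
    [isa] describes the basis of a and [isc] the set B_c. *)
Record conforming_basis (cA : Bt -> {scalar A}) (dg : Bt -> deg)
    (ix : Bt -> I) (eb : I -> Bt) (isa isc : pred Bt) : Prop := ConformingBasis {
  cb_hb : heredity_basis gr (fun b : Bt => val b) cA dg ix eb;
  cb_split : forall b, ~~ isa b -> isc b || ((dg b).2 == 1);
  cb_isc_even : forall b, isc b -> (dg b).2 == 0;
  cb_isc_isa : forall b, isc b -> ~~ isa b;
  cb_Bc : forall v, v \in B_c gr X Y <-> exists2 b : Bt, isc b & v = val b;
  cb_one : forall b, cA b 1 != 0 -> isa b;
  cb_isa_mul : forall b1 b2 b, isa b1 -> isa b2 ->
    cA b (val b1 * val b2) != 0 -> isa b;
  cb_odd_factor : forall b, ~~ isa b -> exists b1 b2 : Bt,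
    val b = val b1 * val b2 /\ (((dg b1).2 == 1) || ((dg b2).2 == 1)) }.

Section Construction.
Variable tr : Bt -> I * A * A.
Hypothesis trP : forall b,
  [/\ (tr b).1.2 \in X (tr b).1.1, (tr b).2 \in Y (tr b).1.1 &
      val b = (tr b).1.2 * (tr b).2].
Local Notation ix b := (tr b).1.1.

Lemma tr_eq (b : Bt) i x y : x \in X i -> y \in Y i -> val b = x * y -> tr b = (i, x, y).
Proof.
move=> xX yY eb; case: (trP b) => tX tY tE.
rewrite -(triple_inj tX tY xX yY); first by case: (tr b) => [[]].
by rewrite -tE.
Qed.

Lemma basis_of i x y : x \in X i -> y \in Y i -> exists2 b : Bt, val b = x * y & tr b = (i, x, y).
Proof.
move=> xX yY; have h : x * y \in Bt by apply/productsP; exists i, x, y.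
by exists [` h]%fset => //; apply: tr_eq.
Qed.

Variable cA : Bt -> {scalar A}.
Hypothesis cA_val : forall b b' : Bt, cA b (val b') = (b == b')%:R.
Hypothesis cA_E : forall v, v = \sum_(b : Bt) cA b v *: val b.

Lemma free_val (c : Bt -> k) : \sum_b c b *: val b = 0 -> forall b, c b = 0.
Proof.
move=> c0 b; have := congr1 (cA b) c0; rewrite linear0 linear_sum (bigD1 b) //= big1 => [|b' nb].
  by rewrite linearZ /= cA_val eqxx mulr1 addr0.
by rewrite linearZ /= cA_val eq_sym (negPf nb) mulr0.
Qed.

Lemma supp_val (P : pred Bt) (b : Bt) : P b -> forall b', cA b' (val b) != 0 -> P b'.
Proof. by move=> Pb b'; rewrite cA_val; case: (b' =P b) => [->|]; rewrite ?eqxx. Qed.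

Definition supp_above i v := forall b, cA b v != 0 -> (i < ix b)%O.

Lemma above_supp i v : above X Y i v -> supp_above i v.
Proof.
apply: (span_sub (P := supp_above i)); first exact: (supp_submod cA (fun b => (i < ix b)%O)).
move=> _ [j [x [y [ij xX yY ->]]]]; have [b <- tb] := basis_of xX yY.
by apply: (supp_val (P := fun b => (i < ix b)%O)); rewrite tb.
Qed.

Lemma supp_mul (P Q : pred Bt) u v :
  (forall b, Q b -> forall b', cA b' (u * val b * v) != 0 -> P b') ->
  forall w, (forall b, cA b w != 0 -> Q b) -> forall b, cA b (u * w * v) != 0 -> P b.
Proof.
move=> h w Qw; rewrite [w]cA_E mulr_sumr mulr_suml.
apply: (submod_sum _ (supp_submod cA P)) => b _.
rewrite -scalerAr -scalerAl; have [->|nz] := eqVneq (cA b w) 0.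
  by rewrite scale0r; case: (supp_submod cA P).
by apply: (submodZ _ (supp_submod cA P)); apply: h; apply: Qw.
Qed.

(** Descending induction on i: by condition (b), w x is a combination of elements of
    X(i) up to terms of index above i, and dually for y w. *)
Lemma above_ideal i v w : supp_above i v -> supp_above i (w * v) /\ supp_above i (v * w).
Proof.
have [m le] := ubnP #|[pred j | (i < j)%O]|; elim: m => // m IH in i v w le *.
have IHj j u t : (i < j)%O -> above X Y j u -> supp_above i (t * u) /\ supp_above i (u * t).
  move=> ij /above_supp au; have [|h1 h2] := IH j u t _ au.
    rewrite -ltnS; apply: leq_trans le; rewrite ltnS; apply/proper_card/properP; split.
      by apply/fintype.subsetP => l; rewrite !inE; apply: lt_trans.
    by exists j; rewrite !inE ?ltxx.
  by split=> b nz; apply: lt_trans ij _; [apply: h1 | apply: h2].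
move=> av; split.
  rewrite -[w * v]mulr1; apply: (supp_mul (Q := fun b => (i < ix b)%O)) av => b ib.
  case: (trP b) => xX yY ->; rewrite mulr1.
  have [u su au] := hd_left heredA xX (v := w) Logic.I.
  have -> : w * ((tr b).1.2 * (tr b).2) = u * (tr b).2 + (w * (tr b).1.2 - u) * (tr b).2.
    by rewrite mulrA -mulrDl addrC subrK.
  apply: (submodD (supp_submod cA (fun b => (i < ix b)%O))); last exact: (proj2 (IHj _ _ _ ib au)).
  apply: (span_sub (P := fun u => supp_above i (u * (tr b).2))) su => [|x xX'].
    split=> [|c u1 u2 h1 h2]; first by rewrite mul0r; case: (supp_submod cA (fun b => (i < ix b)%O)).
    by rewrite mulrDl -scalerAl; case: (supp_submod cA (fun b => (i < ix b)%O)) => _; apply.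
  have [b' <- tb'] := basis_of xX' yY.
  by apply: (supp_val (P := fun b => (i < ix b)%O)); rewrite tb'.
rewrite -[v]mul1r; apply: (supp_mul (Q := fun b => (i < ix b)%O)) av => b ib.
case: (trP b) => xX yY ->; rewrite mul1r.
have [u su au] := hd_right heredA yY (v := w) Logic.I.
have -> : (tr b).1.2 * (tr b).2 * w = (tr b).1.2 * u + (tr b).1.2 * ((tr b).2 * w - u).
  by rewrite -mulrA -mulrDr addrC subrK.
apply: (submodD (supp_submod cA (fun b => (i < ix b)%O))); last exact: (proj1 (IHj _ _ _ ib au)).
apply: (span_sub (P := fun u => supp_above i ((tr b).1.2 * u))) su => [|y yY'].
  split=> [|c u1 u2 h1 h2]; first by rewrite mulr0; case: (supp_submod cA (fun b => (i < ix b)%O)).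
  by rewrite mulrDr -scalerAr; case: (supp_submod cA (fun b => (i < ix b)%O)) => _; apply.
have [b' <- tb'] := basis_of xX yY'.
by apply: (supp_val (P := fun b => (i < ix b)%O)); rewrite tb'.
Qed.

Variable eb : I -> Bt.
Hypothesis ebP : forall i, val (eb i) = e i /\ tr (eb i) = (i, e i, e i).
Local Notation chi i := (cA (eb i)).

Lemma chi_X i x : x \in X i -> chi i x = (x == e i)%:R.
Proof.
move=> xX; have [eX eY] := hd_initial heredA i; have [xe _] := hd_X_e heredA xX.
have [b bE tb] := basis_of xX eY; rewrite xe in bE; rewrite -bE cA_val.
congr ((nat_of_bool _)%:R); apply/eqP/eqP => [E|xe0]; first by rewrite -E (proj1 (ebP i)).
by apply/val_inj; rewrite /= xe0 (proj1 (ebP i)).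
Qed.

Lemma chi_Y i y : y \in Y i -> chi i y = (y == e i)%:R.
Proof.
move=> yY; have [eX eY] := hd_initial heredA i; have [ey _] := hd_e_Y heredA yY.
have [b bE tb] := basis_of eX yY; rewrite ey in bE; rewrite -bE cA_val.
congr ((nat_of_bool _)%:R); apply/eqP/eqP => [E|xe0]; first by rewrite -E (proj1 (ebP i)).
by apply/val_inj; rewrite /= xe0 (proj1 (ebP i)).
Qed.

Lemma chi_XY i x y : x \in X i -> y \in Y i -> chi i (x * y) = chi i x * chi i y.
Proof.
move=> xX yY; rewrite (chi_X xX) (chi_Y yY) -natrM mulnb.
have [b <- tb] := basis_of xX yY; rewrite cA_val; congr ((nat_of_bool _)%:R).
apply/eqP/andP => [E|[/eqP xe /eqP ye]].
  by move: tb; rewrite -E (proj2 (ebP i)) => -[<- <-]; rewrite !eqxx.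
apply/val_inj; have [xX' yY'] := hd_initial heredA i.
case: (trP b) => _ _ /= ->; rewrite tb /= xe ye (proj1 (ebP i)).
by case: (hd_X_e heredA xX') => ->.
Qed.

Lemma span_XY i s t : Defs.span [set` X i] s -> Defs.span [set` Y i] t ->
  chi i (s * t) = chi i s * chi i t /\ forall b, cA b (s * t) != 0 -> ix b = i.
Proof.
have sP := supp_submod cA (fun b => ix b == i).
move=> hs ht; suff: chi i (s * t) = chi i s * chi i t /\ forall b, cA b (s * t) != 0 -> ix b == i.
  by case=> -> h; split=> // b /h/eqP.
apply: (span_sub (P := fun s => chi i (s * t) = chi i s * chi i t /\
  forall b, cA b (s * t) != 0 -> ix b == i)) hs.
  split=> [|c u v [hu su] [hv sv]]; first by rewrite mul0r !linear0 mul0r; split=> // b; rewrite linear0 eqxx.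
  rewrite mulrDl -scalerAl; split; first by rewrite !linearP /= hu hv mulrDl mulrA.
  by case: sP => _; apply.
move=> x xX; apply: (span_sub (P := fun t => chi i (x * t) = chi i x * chi i t /\
  forall b, cA b (x * t) != 0 -> ix b == i)) ht.
  split=> [|c u v [hu su] [hv sv]]; first by rewrite mulr0 !linear0 mulr0; split=> // b; rewrite linear0 eqxx.
  rewrite mulrDr -scalerAr; split; first by rewrite !linearP /= hu hv mulrDr mulrCA.
  by case: sP => _; apply.
move=> y yY; split; first exact: chi_XY.
by have [b <- tb] := basis_of xX yY; apply: (supp_val (P := fun b => ix b == i)); rewrite tb.
Qed.

Lemma chi_above i v : supp_above i v -> chi i v = 0.
Proof.
move=> av; apply/eqP/negPn/negP => /av; by rewrite (proj2 (ebP i)) /= ltxx.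
Qed.

Lemma mul_e i u : exists s a', [/\ Defs.span [set` X i] s, supp_above i a' & u * e i = s + a'].
Proof.
have [eX eY] := hd_initial heredA i.
have [s ss /above_supp sa] := hd_left heredA eX (v := u) Logic.I.
by exists s, (u * e i - s); split=> //; rewrite addrC subrK.
Qed.

Lemma e_mul i u : exists s a', [/\ Defs.span [set` Y i] s, supp_above i a' & e i * u = s + a'].
Proof.
have [eX eY] := hd_initial heredA i.
have [s ss /above_supp sa] := hd_right heredA eY (v := u) Logic.I.
by exists s, (e i * u - s); split=> //; rewrite addrC subrK.
Qed.

Lemma e_idem i : e i * e i = e i.
Proof. by have [eX _] := hd_initial heredA i; case: (hd_X_e heredA eX). Qed.

Lemma e_neq0 i : e i != 0.
Proof.
apply/eqP => e0; have := cA_val (eb i) (eb i); rewrite (proj1 (ebP i)) e0 linear0 eqxx => /eqP.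
by rewrite eq_sym oner_eq0.
Qed.

Lemma chi_mule i u : chi i (u * e i) = chi i u.
Proof.
rewrite [u]cA_E mulr_suml !linear_sum; apply: eq_bigr => b _.
rewrite -scalerAl !linearZ /=; congr (_ * _).
case: (trP b) => xX yY ->; rewrite -mulrA; have [->//|ye] := hd_Y_e heredA i yY.
rewrite ye mulr0 linear0; have [_ _ <-] := trP b; rewrite cA_val.
case: eqP => // E; move: ye; rewrite -E (proj2 (ebP i)) /= e_idem => /eqP.
by rewrite (negPf (e_neq0 i)).
Qed.

Lemma chi_emul i u : chi i (e i * u) = chi i u.
Proof.
rewrite [u]cA_E mulr_sumr !linear_sum; apply: eq_bigr => b _.
rewrite -scalerAr !linearZ /=; congr (_ * _).
case: (trP b) => xX yY ->; rewrite mulrA; have [->//|ye] := hd_e_X heredA i xX.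
rewrite ye mul0r linear0; have [_ _ <-] := trP b; rewrite cA_val.
case: eqP => // E; move: ye; rewrite -E (proj2 (ebP i)) /= e_idem => /eqP.
by rewrite (negPf (e_neq0 i)).
Qed.

(** Condition (b) applied to both u e_i and e_i v writes the product, up to terms of
    index above i, as an element of the span of X(i) times one of the span of Y(i). *)
Lemma through_e i u v : exists s t a', [/\ Defs.span [set` X i] s, Defs.span [set` Y i] t,
  supp_above i a' & u * e i * v = s * t + a' /\ chi i s = chi i u /\ chi i t = chi i v].
Proof.
have [s [a1 [hs h1 us]]] := mul_e i u; have [t [a2 [ht h2 vt]]] := e_mul i v.
exists s, t, (s * a2 + (a1 * t + a1 * a2)); split=> //.
  have sP := supp_submod cA (fun b => (i < ix b)%O).
  apply: (submodD sP); first exact: (proj1 (above_ideal _ h2)).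
  by apply: (submodD sP); apply: (proj2 (above_ideal _ h1)).
split; last split.
- by rewrite -e_idem mulrA -mulrA us vt mulrDl !mulrDr -!addrA.
- by rewrite -(chi_mule i u) us linearD /= (chi_above h1) addr0.
- by rewrite -(chi_emul i v) vt linearD /= (chi_above h2) addr0.
Qed.

Lemma chi_multiplicative i u v : chi i (u * e i * v) = chi i u * chi i v.
Proof.
have [s [t [a' [hs ht ha [-> [<- <-]]]]]] := through_e i u v.
by rewrite linearD /= (chi_above ha) addr0; case: (span_XY hs ht).
Qed.

Lemma supp_through_e i u v b : cA b (u * e i * v) != 0 -> (i <= ix b)%O.
Proof.
have [s [t [a' [hs ht ha [-> _]]]]] := through_e i u v.
rewrite linearD /=; have [->|/(proj2 (span_XY hs ht)) -> //] := eqVneq (cA b (s * t)) 0.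
by rewrite add0r => /ha/ltW.
Qed.

Lemma supp_corner i u b : cA b (e i * u * e i - chi i u *: e i) != 0 -> (i < ix b)%O.
Proof.
have [s [a1 [hs h1 us]]] := mul_e i u; rewrite -mulrA us mulrDr.
have -> : e i * s = chi i s *: e i.
  apply: (span_sub (P := fun s => e i * s = chi i s *: e i)) hs.
    split=> [|c x y hx hy]; first by rewrite mulr0 linear0 scale0r.
    by rewrite mulrDr -scalerAr hx hy linearP /= scalerDl scalerA.
  move=> x xX; rewrite chi_X //; case: (hd_X_e heredA xX) => _ ->.
  by case: eqP => [->|]; rewrite ?scale1r ?scale0r.
have -> : chi i u = chi i s by rewrite -(chi_mule i u) us linearD /= (chi_above h1) addr0.
rewrite addrAC subrr add0r.
exact: (proj1 (above_ideal _ h1)).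
Qed.

End Construction.

Lemma conforming_basis_exists :
  exists cA dg ix eb isa isc, conforming_basis cA dg ix eb isa isc.
Proof.
have [tr trP] := triple_of.
pose ix b := (tr b).1.1.
have [cA [cA_val cA_E]] : exists cA : Bt -> {scalar A},
    (forall b b' : Bt, cA b (val b') = (b == b')%:R) /\
    (forall v, v = \sum_(b : Bt) cA b v *: val b).
  apply: coordinates => [v|c c0 b].
    pose P (v : A) := exists c : Bt -> k, v = \sum_b c b *: val b.
    have sP : is_submodule P.
      split=> [|c u w [cu ->] [cw ->]]; first by exists (fun _ => 0); rewrite big1 // => b _; rewrite scale0r.
      exists (fun b => c * cu b + cw b); rewrite scaler_sumr -big_split /=.
      by apply: eq_bigr => b _; rewrite scalerDl scalerA.
    have [c ->] := (proj1 (hd_span heredA v)) Logic.I.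
    apply: (submod_sum _ sP) => i _; rewrite big_seq; apply: (submod_sum _ sP) => x xX.
    rewrite big_seq; apply: (submod_sum _ sP) => y yY; apply: (submodZ _ sP).
    have [b <- _] := basis_of trP xX yY; exists (fun b' => (b' == b)%:R).
    rewrite (bigD1 b) //= eqxx scale1r big1 ?addr0 // => b' /negPf->.
    by rewrite scale0r.
  have [tX tY _] := trP b.
  pose c3 i x y := \sum_b' ((i, x, y) == tr b')%:R * c b'.
  have c30 : \sum_i \sum_(x <- X i) \sum_(y <- Y i) c3 i x y *: (x * y) = 0.
    rewrite -[RHS]c0.
    under eq_bigr => i _ do under eq_bigr => x _ do under eq_bigr => y _ do rewrite scaler_suml.
    under eq_bigr => i _ do under eq_bigr => x _ do rewrite exchange_big.
    under eq_bigr => i _ do rewrite exchange_big.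
    rewrite exchange_big; apply: eq_bigr => b' _ /=; have [tX' tY' ->] := trP b'.
    rewrite -(triple_delta tX' tY') scaler_sumr; apply: eq_bigr => i _.
    rewrite scaler_sumr; apply: eq_bigr => x _; rewrite scaler_sumr; apply: eq_bigr => y _.
    rewrite scalerA mulrC; congr (_ * (_ == _)%:R *: _).
  have := hd_free heredA c30 tX tY; rewrite /c3 (bigD1 b) //= big1 ?addr0; last first.
    move=> b' nb; have [E|_] := eqVneq _ (tr b'); last by rewrite mul0r.
    case/eqP: nb; apply/val_inj; have [_ _ /= ->] := trP b'; have [_ _ ->] := trP b.
    by rewrite -E.
  have -> : ((tr b).1.1, (tr b).1.2, (tr b).2) == tr b by case: (tr b) => [[]].
  by rewrite mul1r.
have [eb ebP] : exists eb : I -> Bt, forall i, val (eb i) = e i /\ tr (eb i) = (i, e i, e i).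
  have ex i : exists b : Bt, val b = e i /\ tr b = (i, e i, e i).
    have [eX eY] := hd_initial heredA i; have [b bE tb] := basis_of trP eX eY.
    by exists b; rewrite bE; case: (hd_X_e heredA eX) => ->.
  by have [f fP] := choice ex; exists f.
have [dg dgP] : exists dg : Bt -> deg, forall b, gr (dg b) (val b).
  have ex (b : Bt) : exists p, gr p (val b).
    have [tX tY ->] := trP b; have [_ [p gp]] := hd_X heredA tX; have [_ [q gq]] := hd_Y heredA tY.
    by exists (p + q); apply: (proj2 superA).
  by have [f fP] := choice ex; exists f.
have free := free_val cA_val.
have val1 (b : Bt) : cA b (val b) != 0 by rewrite cA_val eqxx oner_neq0.
(* Sorting the expansion of v by degree and subtracting v in degree p gives a
   vanishing sum of homogeneous vectors. *)
have grE p v : gr p v <-> forall b, cA b v != 0 -> dg b = p.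
  have [grad _] := superA; have sub q := grading_submodule grad q; split=> [gv b nz|h]; last first.
    rewrite [v]cA_E; apply: (submod_sum _ (sub p)) => b _.
    have [->|nz] := eqVneq (cA b v) 0; first by rewrite scale0r; case: (sub p).
    by apply: (submodZ _ (sub p)); rewrite -(h b nz).
  pose s := undup (p :: [seq dg b | b : Bt]).
  pose c q := \sum_(b | dg b == q) cA b v *: val b - (q == p)%:R *: v.
  have gc q : gr q (c q).
    apply: (submodB (sub q)).
      by apply: (submod_sum _ (sub q)) => b' /eqP <-; apply: (submodZ _ (sub _)).
    by case: (q =P p) => [->|_]; [apply: (submodZ _ (sub p)) | rewrite scale0r; case: (sub q)].
  have s0 : \sum_(q <- s) c q = 0.
    rewrite sumrB; apply/eqP; rewrite subr_eq0; apply/eqP.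
    have one : \sum_(q <- s) (q == p)%:R = 1 :> k.
      rewrite (bigD1_seq p) ?undup_uniq ?mem_undup ?mem_head //= eqxx.
      by rewrite big1 ?addr0 // => q /negPf->.
    rewrite -scaler_suml one scale1r.
    rewrite (exchange_big_dep xpredT) //= [RHS]cA_E; apply: eq_bigr => b' _.
    rewrite big_mkcond (bigD1_seq (dg b')) ?undup_uniq //=; last first.
      by rewrite mem_undup inE; apply/orP; right; apply/mapP; exists b'; rewrite ?mem_enum.
    by rewrite eqxx big1 ?addr0 // => q /negPf; rewrite eq_sym => ->.
  have ins : dg b \in s.
    by rewrite mem_undup inE; apply/orP; right; apply/mapP; exists b; rewrite ?mem_enum.
  have := grading_independent grad (undup_uniq _) gc s0 ins.
  have [//|ne] := eqVneq (dg b) p; rewrite /c (negPf ne) scale0r subr0.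
  rewrite big_mkcond /= => z0.
  have := free (fun b' => if dg b' == dg b then cA b' v else 0).
  rewrite (eq_bigr (fun b' => if dg b' == dg b then cA b' v *: val b' else 0)); last first.
    by move=> b' _; case: ifP => _; rewrite ?scale0r.
  by move=> /(_ z0 b); rewrite eqxx => /eqP; rewrite (negPf nz).
have mulE b b1 b2 : val b = val b1 * val b2 -> dg b = dg b1 + dg b2.
  by move=> E; apply/esym/esym; apply: (proj1 (grE _ _)) (val1 b); rewrite E; apply: (proj2 superA).
have par eps (b : Bt) : parity_part gr eps (val b) <-> (dg b).2 = eps.
  split=> [|E].
    move=> h; apply/eqP; move: (val1 b).
    apply: (span_sub (P := fun v => forall b, cA b v != 0 -> (dg b).2 == eps)) h b => [|u [m gu] b nz].
      exact: (supp_submod cA (fun b => (dg b).2 == eps)).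
    by rewrite (proj1 (grE _ _) gu b nz).
  by apply: span_in; exists (dg b).1; rewrite -E; case: (dg b) (dgP b).
(* As x = x e_i and y = e_i y, the elements of X and Y belong to B themselves. *)
have bX i x : x \in X i -> exists b : Bt, val b = x.
  move=> xX; have [_ eY] := hd_initial heredA i; have [b bE _] := basis_of trP xX eY.
  by exists b; rewrite bE; case: (hd_X_e heredA xX).
have bY i y : y \in Y i -> exists b : Bt, val b = y.
  move=> yY; have [eX _] := hd_initial heredA i; have [b bE _] := basis_of trP eX yY.
  by exists b; rewrite bE; case: (hd_e_Y heredA yY).
have psX eps i x : x \in parity_sub gr eps X i = (x \in X i) && `[< parity_part gr eps x >].
  by rewrite !inE.
have psY eps i x : x \in parity_sub gr eps Y i = (x \in Y i) && `[< parity_part gr eps x >].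
  by rewrite !inE.
pose isp eps b := ((tr b).1.2 \in parity_sub gr eps X (ix b)) && ((tr b).2 \in parity_sub gr eps Y (ix b)).
have factor (b : Bt) : exists b1 b2 : Bt, [/\ val b = val b1 * val b2, dg b = dg b1 + dg b2 &
    forall eps, isp eps b = ((dg b1).2 == eps) && ((dg b2).2 == eps)].
  have [tX tY tE] := trP b; have [b1 E1] := bX _ _ tX; have [b2 E2] := bY _ _ tY.
  exists b1, b2; rewrite E1 E2; split=> // [|eps]; first by apply: mulE; rewrite E1 E2.
  rewrite /isp psX psY tX tY -E1 -E2 /=.
  by congr (_ && _); apply/asboolP/eqP => /par.
have [[asub amul aeven] ha] := confA.
have a_isa (b : Bt) : isp 0 b -> a (val b).
  by case/andP=> hx hy; have [_ _ ->] := trP b; apply: amul; [case: (hd_X ha hx) | case: (hd_Y ha hy)].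
have isa_a v : a v -> forall b, cA b v != 0 -> isp 0 b.
  have sP := supp_submod cA (isp 0); move=> /(hd_span ha)[c ->].
  apply: (submod_sum _ sP) => i _; rewrite big_seq; apply: (submod_sum _ sP) => x xX.
  rewrite big_seq; apply: (submod_sum _ sP) => y yY; apply: (submodZ _ sP).
  have [xX' _] := andP (etrans (esym (psX _ _ _)) xX).
  have [yY' _] := andP (etrans (esym (psY _ _ _)) yY).
  have [b <- tb] := basis_of trP xX' yY'; apply: supp_val => //.
  by rewrite /isp /ix tb /= xX yY.
exists cA, dg, ix, eb, (isp 0), (isp 1); split.
- split=> //.
  + by move=> b b'; apply: (proj2 superA).
  + by move=> i; rewrite /ix (proj2 (ebP i)).
  + move=> i; have := mulE (eb i) (eb i) (eb i); rewrite (proj1 (ebP i)) e_idem => /(_ erefl).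
    by rewrite -{1}[dg _]addr0 => /addrI.
  + by move=> i /=; rewrite (proj1 (ebP i)) e_idem.
  + by move=> i u v; rewrite /= (proj1 (ebP i)); apply: (chi_multiplicative trP cA_val cA_E ebP).
  + by move=> i u v b; rewrite /= (proj1 (ebP i)); apply: (supp_through_e trP cA_val cA_E ebP).
  + by move=> i u b; rewrite /= (proj1 (ebP i)); apply: (supp_corner trP cA_val cA_E ebP).
  + move=> b; have [tX tY tE] := trP b; exists (tr b).1.2, (tr b).2.
    by rewrite /= (proj1 (ebP _)) tE; case: (hd_X_e heredA tX) => ->.
- move=> b; have [b1 [b2 [_ -> h]]] := factor b; rewrite !h /=.
  by case: (Z2_cases (dg b1).2) => ->; case: (Z2_cases (dg b2).2) => ->.
- by move=> b; have [b1 [b2 [_ -> h]]] := factor b; rewrite !h /= => /andP[/eqP-> /eqP->].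
- by move=> b; have [b1 [b2 [_ _ h]]] := factor b; rewrite !h /= => /andP[/eqP-> /eqP->].
- move=> v; split=> [/productsP[i [x [y [xX yY ->]]]]|[b /andP[hx hy] ->]].
    have [xX' _] := andP (etrans (esym (psX _ _ _)) xX).
    have [yY' _] := andP (etrans (esym (psY _ _ _)) yY).
    by have [b <- tb] := basis_of trP xX' yY'; exists b; rewrite // /isp /ix tb /= xX yY.
  by apply/productsP; have [_ _ ->] := trP b; exists (ix b), (tr b).1.2, (tr b).2.
- exact: isa_a.
- by move=> b1 b2 b h1 h2; apply: isa_a; apply: amul; apply: a_isa.
- move=> b; have [b1 [b2 [E _ h]]] := factor b; rewrite h => nb; exists b1, b2; split=> //.
  by move: nb; case: (Z2_cases (dg b1).2) => ->; case: (Z2_cases (dg b2).2) => ->.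
Qed.
End HeredityBasis.

(** * Change of scalars *)

Section Extension.
Variables (k : comNzRingType) (F : fieldType) (phi : {rmorphism k -> F}).
Variables (M : lmodType k) (N : lmodType F) (iota : {linear M -> N | phi \; *:%R}).
Hypothesis ext : is_scalar_extension iota.

Lemma iotaZ c v : iota (c *: v) = phi c *: iota v.
Proof. exact: linearZ_LR. Qed.

Lemma extend_functional (f : M -> F) :
  (forall c u v, f (c *: u + v) = phi c * f u + f v) ->
  exists g : {scalar N}, forall v, g (iota v) = f v.
Proof.
move=> flin.
pose f' : {linear M -> F^o | phi \; *:%R} :=
  HB.pack_for {linear M -> F^o | phi \; *:%R} (f : M -> F^o)
    (GRing.isLinear.Build k M F^o (phi \; *:%R) f flin).
have [g gE] := (proj1 ext) F^o f'; exists (mk_scalar (linearP g)).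
exact: gE.
Qed.

Lemma ext_eq (W : lmodType F) (g h : N -> W) : linear g -> linear h ->
  (forall v, g (iota v) = h (iota v)) -> forall w, g w = h w.
Proof.
move=> gl hl gh.
exact: (proj2 ext) W (mk_linear gl) (mk_linear hl) gh.
Qed.

Lemma extend_coordinates (Bt : finType) (bv : Bt -> M) (cM : Bt -> {scalar M}) :
  (forall v, v = \sum_b cM b v *: bv b) ->
  exists cN : Bt -> {scalar N}, (forall b v, cN b (iota v) = phi (cM b v)) /\
    forall w, w = \sum_b cN b w *: iota (bv b).
Proof.
move=> cE.
have ex b : exists g : {scalar N}, forall v, g (iota v) = phi (cM b v).
  by apply: extend_functional => c u v; rewrite linearP rmorphD rmorphM.
have [cN cNE] := choice ex; exists cN; split=> // w.
apply: (ext_eq (g := id) (h := fun w => \sum_b cN b w *: iota (bv b))) => // [c u v|v].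
  rewrite scaler_sumr -big_split; apply: eq_bigr => b _ /=.
  by rewrite linearP /= scalerDl scalerA.
rewrite {1}[v]cE linear_sum; apply: eq_bigr => b _.
by rewrite iotaZ cNE.
Qed.
End Extension.

Section ExtendAlgebra.
Variables (k : comNzRingType) (A : algType k) (gr : deg -> set A).
Variables (disp : Order.disp_t) (I : finPOrderType disp) (Bt : finType).
Variables (bv : Bt -> A) (cA : Bt -> {scalar A}) (dg : Bt -> deg).
Variables (ix : Bt -> I) (e : I -> Bt).
Hypothesis hb : heredity_basis gr bv cA dg ix e.
Variables (F : fieldType) (phi : {rmorphism k -> F}).
Variables (AF : algType F) (iotaA : {linear A -> AF | phi \; *:%R}).
Hypothesis extA : is_scalar_extension iotaA.
Hypothesis iotaA_mul : forall x y : A, iotaA (x * y) = iotaA x * iotaA y.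

(** The clauses are linear in each element of A_F, hence hold because they hold on
    the image of A, which spans. *)
Lemma extend_heredity_basis : exists cF : Bt -> {scalar AF},
  (forall b v, cF b (iotaA v) = phi (cA b v)) /\
  heredity_basis (extended_grading iotaA gr) (fun b => iotaA (bv b)) cF dg ix e.
Proof.
have [cF [cFi cFE]] := extend_coordinates extA (hb_expand hb).
exists cF; split=> //.
have coord b b' : cF b (iotaA (bv b')) = (b == b')%:R.
  by rewrite cFi (hb_coord hb) rmorph_nat.
have grE p v : extended_grading iotaA gr p v <-> forall b, cF b v != 0 -> dg b = p.
  split.
    move=> h b nz; apply/eqP; move: b nz.
    apply: (span_sub (P := fun v => forall b, cF b v != 0 -> dg b == p)) h => [|w [u gu ->] b].
      exact: (supp_submod cF (fun b => dg b == p)).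
    rewrite cFi => nz; apply/eqP; apply: (proj1 (hb_gr hb p u) gu).
    by apply: contraNneq nz => ->; rewrite rmorph0.
  move=> h; rewrite [v]cFE; apply: submod_sum => [|b _]; first exact: span_submod.
  have [->|/h <-] := eqVneq (cF b v) 0; first by rewrite scale0r; case: (span_submod (fun w => exists2 u, gr p u & w = iotaA u)).
  apply: submodZ; first exact: span_submod.
  by apply: span_in; exists (bv b) => //; apply: (gr_bv hb).
have cF_mul3 b u w v : cF b (u * w * v) =
    \sum_b1 \sum_b2 cF b1 u * cF b2 v * cF b (iotaA (bv b1) * w * iotaA (bv b2)).
  rewrite {1}[u]cFE {1}[v]cFE !mulr_suml linear_sum.
  apply: eq_bigr => b1 _; rewrite mulr_sumr linear_sum; apply: eq_bigr => b2 _.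
  by rewrite -!scalerAl -scalerAr scalerA linearZ.
split=> //.
- move=> b b'; apply/grE => b''; rewrite -iotaA_mul cFi => nz.
  apply: (proj1 (hb_gr hb _ _) (hb_deg hb b b')).
  by apply: contraNneq nz => ->; rewrite rmorph0.
- exact: (hb_ix_e hb).
- exact: (hb_e_deg hb).
- by move=> i; rewrite -iotaA_mul (hb_e_idem hb).
- move=> i u v; rewrite cF_mul3.
  transitivity (\sum_b1 \sum_b2 (cF b1 u * cF (e i) (iotaA (bv b1))) * (cF b2 v * cF (e i) (iotaA (bv b2)))).
    apply: eq_bigr => b1 _; apply: eq_bigr => b2 _.
    by rewrite -!iotaA_mul !cFi (hb_chiM hb) rmorphM mulrACA.
  rewrite [u in RHS]cFE [v in RHS]cFE !linear_sum mulr_suml; apply: eq_bigr => b1 _.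
  by rewrite mulr_sumr; apply: eq_bigr => b2 _; rewrite !linearZ.
- move=> i u v b; apply: contraNT => nb; rewrite cF_mul3 big1 // => b1 _; rewrite big1 // => b2 _.
  rewrite -!iotaA_mul cFi; have [->|/(hb_above hb)] := eqVneq (cA b (bv b1 * bv (e i) * bv b2)) 0.
    by rewrite rmorph0 mulr0.
  by rewrite (negPf nb).
- move=> i u b; apply: contraNT => nb.
  pose f w := cF b (iotaA (bv (e i)) * w * iotaA (bv (e i)) - cF (e i) w *: iotaA (bv (e i))).
  have fl : scalar f.
    move=> c x y; rewrite /f mulrDr mulrDl -scalerAr -scalerAl linearP /= scalerDl opprD addrACA.
    by rewrite -scalerA -scalerBr linearP.
  rewrite -/(f u); apply/eqP.
  apply: (ext_eq extA (W := F^o) (h := fun _ => 0) fl) => [c x y|w]; first by rewrite scaler0 addr0.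
  rewrite /f -!iotaA_mul cFi -iotaZ -linearB cFi.
  have [->|/(hb_corner hb)] := eqVneq (cA b (bv (e i) * w * bv (e i) - cA (e i) w *: bv (e i))) 0.
    by rewrite rmorph0.
  by rewrite (negPf nb).
- by move=> b; have [u [v E]] := hb_factor hb b; exists (iotaA u), (iotaA v); rewrite E !iotaA_mul.
Qed.
End ExtendAlgebra.

(** * Signs of place permutations *)

Section Signs.
Variable d : nat.
Implicit Types (p q : 'I_d -> bool) (g h : 'S_d).

(** Parity (as an element of the two-element ring) of the number of odd factors
    that pass each other when two pure tensors of parities p and q are
    multiplied. *)
Definition swaps p q : bool :=
  \sum_(m < d) \sum_(l < d) ((l < m)%N : bool) * (p m * q l).

(** Parity of the number of inversions of [g] between odd factors. *)
Definition odd_inv p g : bool :=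
  \sum_(a < d) \sum_(b < d)
    ((a < b)%N : bool) * (((g^-1%g b < g^-1%g a)%N : bool) * (p a * p b)).

Lemma reindex2 (g : 'S_d) (G : 'I_d -> 'I_d -> bool) :
  \sum_(a < d) \sum_(b < d) G a b = \sum_(a < d) \sum_(b < d) G (g a) (g b).
Proof.
rewrite (reindex_inj (@perm_inj _ g)); apply: eq_bigr => a _.
exact: (reindex_inj (@perm_inj _ g)).
Qed.

(** This makes signed place permutations multiplicative: the pairs of odd factors
    that pass each other in a product are counted before and after permuting. *)
Lemma odd_inv_add p q g :
  odd_inv (fun i => p i + q i) g + swaps p q =
  odd_inv p g + odd_inv q g + swaps (p \o g) (q \o g).
Proof.
have -> : swaps (p \o g) (q \o g) =
    \sum_(a < d) \sum_(b < d) ((g^-1%g b < g^-1%g a)%N : bool) * (p a * q b).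
  rewrite [RHS](reindex2 g); apply: eq_bigr => a _; apply: eq_bigr => b _.
  by rewrite !permK.
have -> : odd_inv (fun i => p i + q i) g = odd_inv p g + odd_inv q g +
    (\sum_(a < d) \sum_(b < d) ((a < b)%N : bool) * (((g^-1%g b < g^-1%g a)%N : bool) * (p a * q b)) +
     \sum_(a < d) \sum_(b < d) ((b < a)%N : bool) * (((g^-1%g a < g^-1%g b)%N : bool) * (p a * q b))).
  rewrite [X in _ + (_ + X)]exchange_big -!big_split; apply: eq_bigr => a _ /=.
  rewrite -!big_split; apply: eq_bigr => b _ /=.
  by case: (p a); case: (q a); case: (p b); case: (q b); case: (a < b)%N; case: (_ < _)%N.
rewrite -addrA; congr (_ + _); rewrite -!big_split; apply: eq_bigr => a _ /=.
rewrite -!big_split; apply: eq_bigr => b _ /=.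
rewrite !mulrA -!mulrDl; congr (_ * _ * _).
case: (ltngtP a b) => [ab|ab|ab].
- by rewrite mul0r mul1r !addr0.
- case: (ltngtP (g^-1%g b) (g^-1%g a)) => // /val_inj/perm_inj E; by rewrite E ltnn in ab.
- by rewrite (val_inj ab) ltnn.
Qed.

Lemma sum_upper (G : 'I_d -> 'I_d -> bool) : (forall a, G a a = 0) ->
  \sum_(a < d) \sum_(b < d) G a b = \sum_(a < d) \sum_(b < d) ((a < b)%N : bool) * (G a b + G b a).
Proof.
move=> G0.
have -> : \sum_(a < d) \sum_(b < d) ((a < b)%N : bool) * (G a b + G b a) =
   \sum_(a < d) \sum_(b < d) ((a < b)%N : bool) * G a b + \sum_(a < d) \sum_(b < d) ((b < a)%N : bool) * G a b.
  rewrite [X in _ = _ + X]exchange_big -big_split; apply: eq_bigr => a _ /=.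
  by rewrite -big_split; apply: eq_bigr => b _ /=; rewrite mulrDr.
rewrite -big_split; apply: eq_bigr => a _; rewrite -big_split; apply: eq_bigr => b _ /=.
rewrite -mulrDl; case: (ltngtP a b) => [||/val_inj->]; rewrite ?mul1r //.
Qed.

(** The cocycle identity that makes signed place permutations an action. *)
Lemma odd_inv_comp p g h : odd_inv p g + odd_inv (p \o g) h = odd_inv p (h * g)%g.
Proof.
have -> : odd_inv (p \o g) h = \sum_(a < d) \sum_(b < d) ((g^-1%g a < g^-1%g b)%N : bool) *
    (((((h * g)^-1)%g b < ((h * g)^-1)%g a)%N : bool) * (p a * p b)).
  rewrite [RHS](reindex2 g); apply: eq_bigr => a _; apply: eq_bigr => b _.
  by rewrite !invMg !permM !permK.
rewrite [X in _ + X]sum_upper => [|a]; last by rewrite !ltnn mul0r.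
rewrite -big_split; apply: eq_bigr => a _; rewrite -big_split; apply: eq_bigr => b _ /=.
case: (ltnP a b) => ab; last by rewrite !mul0r.
rewrite !mul1r [p b * p a]mulrC; set k := ((h * g)^-1)%g.
have ne : (a == b) = false by have := ltn_eqF ab; rewrite (inj_eq val_inj).
have := inj_eq (@perm_inj _ (g^-1%g)) a b; have := inj_eq (@perm_inj _ k) a b.
rewrite ne -!(inj_eq val_inj).
case: (ltngtP (g^-1%g a) (g^-1%g b)) => //; case: (ltngtP (k a) (k b)) => // _ _ _ _;
  by case: (p a); case: (p b).
Qed.

Lemma odd_inv1 p : odd_inv p 1%g = 0.
Proof.
rewrite /odd_inv big1 // => a _; rewrite big1 // => b _; rewrite invg1 !perm1.
by case: (ltngtP a b); rewrite ?mul0r ?mulr0.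
Qed.

Lemma swaps_eq0 p q : (forall i j : 'I_d, (i < j)%N -> p j && q i = false) -> swaps p q = 0.
Proof.
move=> pq; rewrite /swaps big1 // => a _; rewrite big1 // => b _.
case: (ltnP b a) => [ba|_]; last by rewrite mul0r.
by rewrite [p a * q b]pq ?mulr0.
Qed.

Lemma odd_inv_eq0 p g : (forall i, g i != i -> p i = false) -> odd_inv p g = 0.
Proof.
move=> gp; rewrite /odd_inv big1 // => a _; rewrite big1 // => b _.
have fix_inv i : p i -> g^-1%g i = i.
  by move=> pi; have [E|/gp] := eqVneq (g i) i; [rewrite -{1}E permK | rewrite pi].
case pa: (p a); last by rewrite mul0r !mulr0.
case pb: (p b); last by rewrite !mulr0.
by rewrite !fix_inv //; case: (ltngtP a b); rewrite ?mul0r ?mulr0.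
Qed.
End Signs.

Lemma odd_sum (T : Type) (r : seq T) (P : pred T) (f : T -> nat) :
  odd (\sum_(i <- r | P i) f i) = \sum_(i <- r | P i) odd (f i).
Proof. by apply: (big_morph odd) => // x y; rewrite oddD. Qed.

(** * Tensor powers of a matrix algebra *)

Section MatrixLetters.
Variables (k : comNzRingType) (A : algType k) (gr : deg -> set A).
Variables (disp : Order.disp_t) (I : finPOrderType disp) (Bt : finType).
Variables (bv : Bt -> A) (cA : Bt -> {scalar A}) (dg : Bt -> deg).
Variables (ix : Bt -> I) (e : I -> Bt).
Hypothesis hb : heredity_basis gr bv cA dg ix e.
Variable n : nat.
Local Notation L := (Bt * 'I_n * 'I_n)%type.

Definition letter_mx (l : L) : mat A n := xi_mat (bv l.1.1) l.1.2 l.2.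

Lemma cM_scalar (l : L) : scalar (fun M : mat A n => cA l.1.1 (M l.1.2 l.2)).
Proof. by move=> c u v; rewrite /= !mxE linearP. Qed.
Definition cM (l : L) : {scalar mat A n} := mk_scalar (@cM_scalar l).

Arguments cM : simpl never.

Lemma cME l (M : mat A n) : cM l M = cA l.1.1 (M l.1.2 l.2).
Proof. by []. Qed.

Lemma xi_matE (a : A) (r s i j : 'I_n) : xi_mat (k := k) a r s i j = if (i == r) && (j == s) then a else 0.
Proof. by rewrite !mxE; case: ifP; rewrite ?mulr1 ?mulr0. Qed.

Lemma cM_letter l l' : cM l (letter_mx l') = (l == l')%:R.
Proof.
rewrite cME xi_matE; case: l l' => [[b r] s] [[b' r'] s'] /=; rewrite !xpair_eqE.
case: (r == r'); case: (s == s'); rewrite ?andbF ?andbT ?linear0 //=.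
exact: (hb_coord hb).
Qed.

Lemma cM_xi l a r s : cM l (xi_mat a r s) = if (l.1.2 == r) && (l.2 == s) then cA l.1.1 a else 0.
Proof. by rewrite cME xi_matE; case: ifP; rewrite ?linear0. Qed.

Lemma cM_ext (M N : mat A n) : (forall l, cM l M = cM l N) -> M = N.
Proof.
by move=> h; apply/matrixP => r s; apply: (cA_ext hb) => b; apply: (h (b, r, s)).
Qed.

Lemma cMZ l c M : cM l (c *: M) = c * cM l M.
Proof. exact: linearZ. Qed.

Lemma cM_expand M : M = \sum_l cM l M *: letter_mx l.
Proof.
apply: cM_ext => l; rewrite linear_sum (bigD1 l) // cMZ cM_letter eqxx big1 => [|l' /andP[_ nl]].
  by rewrite [RHS]addr0 [RHS]mulr1.
by rewrite cMZ cM_letter eq_sym (negPf nl) mulr0.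
Qed.

Lemma gr_letter l : mat_grading gr (dg l.1.1) (letter_mx l).
Proof.
move=> i j; rewrite xi_matE; case: ifP => _; first exact: (gr_bv hb).
by case: (gr_submod hb (dg l.1.1)).
Qed.

Lemma gr_cM p (M : mat A n) l : mat_grading gr p M -> cM l M != 0 -> dg l.1.1 = p.
Proof. by move=> gM; apply: (proj1 (hb_gr hb p _)). Qed.

Lemma gr_mat_mul p q (M N : mat A n) : mat_grading gr p M -> mat_grading gr q N ->
  mat_grading gr (p + q) (mat_mul M N).
Proof.
move=> gM gN i j; rewrite mxE; apply: submod_sum => [|l _]; first exact: (gr_submod hb).
exact: (gr_mul hb).
Qed.

Lemma gr1 : gr 0 1.
Proof.
rewrite [1](part_sum hb); apply: submod_sum => [|p _]; first exact: (gr_submod hb).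
have [->|np] := eqVneq p 0; first exact: (gr_part hb).
rewrite -[part _ _ _ _ _]mulr1 [X in _ * X](hb_expand hb) mulr_sumr big1; last first.
  move=> b _; rewrite -scalerAr -(part_mulr hb _ _ (gr_bv hb b)) mul1r.
  rewrite (part_other hb (gr_bv hb b)) ?scaler0 //.
  by apply: contra np; rewrite -{2}[dg b]add0r => /eqP/addIr->.
by case: (gr_submod hb 0).
Qed.

Lemma gr_mat1 : mat_grading gr 0 (1%:M : mat A n).
Proof.
by move=> i j; rewrite mxE; case: (i == j); [exact: gr1 | case: (gr_submod hb 0)].
Qed.
End MatrixLetters.

Section Multilinear.
Variables (k : comNzRingType) (V : lmodType k) (L : finType) (letter_mx : L -> V).
Variables (cM : L -> {scalar V}) (d : nat).
Hypothesis cM_expand : forall v, v = \sum_l cM l v *: letter_mx l.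
Local Notation word := {ffun 'I_d -> L}.
Definition words_of (z : word) : {ffun 'I_d -> V} := [ffun i => letter_mx (z i)].

Lemma multilinear_sum (W : lmodType k) (f : {ffun 'I_d -> V} -> W) i (x : {ffun 'I_d -> V})
    (T : finType) (c : T -> k) (u : T -> V) : multilinear f ->
  f [ffun j => if j == i then \sum_t c t *: u t else x j] =
  \sum_t c t *: f [ffun j => if j == i then u t else x j].
Proof.
move=> mf; rewrite -[LHS]/(mk_linear (mf i x) _) linear_sum.
by apply: eq_bigr => t _; rewrite linearZ.
Qed.

(** The arguments outside the basis are expanded one after the other; their number
    is the induction parameter. *)
Lemma multilinear_ext (W : lmodType k) (f g : {ffun 'I_d -> V} -> W) :
  multilinear f -> multilinear g ->
  (forall z, f (words_of z) = g (words_of z)) -> forall x, f x = g x.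
Proof.
move=> mf mg fg x.
pose nb (x : {ffun 'I_d -> V}) := #|[pred i | ~~ [exists l, x i == letter_mx l]]|.
have [m] := ubnP (nb x); elim: m x => // m IH x.
case: (pickP [pred i | ~~ [exists l, x i == letter_mx l]]) => [i ni lt|n0 _]; last first.
  have ex i : exists l, x i = letter_mx l.
    by have /= := n0 i => /negbFE/existsP[l /eqP]; exists l.
  have [z zP] := choice ex.
  have -> : x = words_of [ffun i => z i] by apply/ffunP => i; rewrite !ffunE zP.
  exact: fg.
have xE : x = [ffun j => if j == i then \sum_l cM l (x i) *: letter_mx l else x j].
  by apply/ffunP => j; rewrite ffunE; case: (j =P i) => [->|//].
rewrite xE !multilinear_sum //; apply: eq_bigr => l _; congr (_ *: _); apply: IH.
rewrite -ltnS; apply: leq_trans lt; rewrite ltnS; apply/proper_card/properP; split.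
  apply/fintype.subsetP => j; rewrite !inE ffunE; case: (j =P i) => [->|//].
  by move/existsPn => /(_ l); rewrite eqxx.
exists i => //; rewrite !inE ffunE eqxx negbK; by apply/existsP; exists l.
Qed.

Lemma prod_multilinear (h : 'I_d -> {scalar V}) :
  multilinear (fun x : {ffun 'I_d -> V} => \prod_i h i (x i) : k^o).
Proof.
move=> i x c u v; rewrite !(bigD1 i (P := xpredT)) //= !ffunE eqxx linearP /= mulrDl.
rewrite -mulrA; congr (_ * (_ * _) + _ * _); apply: eq_bigr => j /negPf nj;
  by rewrite !ffunE nj.
Qed.
End Multilinear.

Definition par (p : deg) : bool := p.2 == 1.

Lemma parD p q : par (p + q) = par p + par q.
Proof.
rewrite /par -[(p + q).2]/(p.2 + q.2).
by case: (Z2_cases p.2) => ->; case: (Z2_cases q.2) => ->.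
Qed.

Section CoefficientExistence.
Variables (k : comNzRingType) (A : algType k) (gr : deg -> set A).
Variables (disp : Order.disp_t) (I : finPOrderType disp) (Bt : finType).
Variables (bv : Bt -> A) (cA : Bt -> {scalar A}) (dg : Bt -> deg).
Variables (ix : Bt -> I) (e : I -> Bt).
Hypothesis hb : heredity_basis gr bv cA dg ix e.
Variables (n d : nat) (TP : algType k) (tens : {ffun 'I_d -> mat A n} -> TP).
Hypothesis tensP : is_tensor_power tens.
Local Notation L := (Bt * 'I_n * 'I_n)%type.
Local Notation word := {ffun 'I_d -> L}.

Definition tw (z : word) : TP := tens (words_of (letter_mx bv (n := n)) z).

(** The universal property provides the functionals, and its uniqueness part
    reduces the expansion to tensors of basis letters. *)
Lemma coefficients_exist : exists coef : word -> {scalar TP},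
  (forall z x, coef z (tens x) = \prod_i cM cA (z i) (x i)) /\
  forall t, t = \sum_z coef z t *: tw z.
Proof.
have [mt gen uniq] := tensP.
have ex (z : word) : exists g : {scalar TP}, forall x, g (tens x) = \prod_i cM cA (z i) (x i).
  have [g gE] := gen k^o _ (prod_multilinear (fun i => cM cA (z i))).
  by exists (mk_scalar (linearP g)); exact: gE.
have [coef cE] := choice ex; exists coef; split=> //.
have hl : linear (fun t => \sum_z coef z t *: tw z).
  move=> c u v; rewrite scaler_sumr -big_split; apply: eq_bigr => z _ /=.
  by rewrite linearP /= scalerDl scalerA.
move=> t; apply: (uniq TP (idfun : {linear TP -> TP}) (mk_linear hl)) => x.
apply: (multilinear_ext (cM_expand hb (n := n)) (f := tens)
  (g := fun x => \sum_z coef z (tens x) *: tw z)) => [//|i y c u v /=|z].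
- rewrite scaler_sumr -big_split; apply: eq_bigr => z _ /=.
  by rewrite !cE (prod_multilinear (fun i => cM cA (z i))) /= scalerDl scalerA.
rewrite /= (bigD1 z) //= big1 ?addr0 => [|z' nz].
  by rewrite cE big1 ?scale1r // => i _; rewrite ffunE (cM_letter hb) eqxx.
have [i ni] := ffun_neq nz.
by rewrite cE (bigD1 i) // ffunE (cM_letter hb) (negPf ni) /= mul0r scale0r.
Qed.
End CoefficientExistence.

Section TensorAction.
Variables (k : comNzRingType) (A : algType k) (gr : deg -> set A).
Variables (disp : Order.disp_t) (I : finPOrderType disp) (Bt : finType).
Variables (bv : Bt -> A) (cA : Bt -> {scalar A}) (dg : Bt -> deg).
Variables (ix : Bt -> I) (e : I -> Bt).
Hypothesis hb : heredity_basis gr bv cA dg ix e.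
Variables (n d : nat) (TP : algType k) (tens : {ffun 'I_d -> mat A n} -> TP).
Hypothesis tensP : is_super_tensor_power (@mat_mul k A n) (mat_grading gr) tens.
Local Notation L := (Bt * 'I_n * 'I_n)%type.
Local Notation word := {ffun 'I_d -> L}.
Local Notation letter_mx := (letter_mx bv (n := n)).
Local Notation tw := (tw bv tens).
Variable coef : word -> {scalar TP}.
Hypothesis coef_tens : forall z x, coef z (tens x) = \prod_i cM cA (z i) (x i).
Hypothesis coef_expand : forall t, t = \sum_z coef z t *: tw z.

Definition sgn (b : bool) : k := (-1) ^+ b.

Lemma sgnD b1 b2 : sgn (b1 + b2) = sgn b1 * sgn b2.
Proof. exact: signr_addb. Qed.

Lemma coef_eq t t' : (forall z, coef z t = coef z t') -> t = t'.
Proof. by move=> h; rewrite (coef_expand t) (coef_expand t'); apply: eq_bigr => z _; rewrite h. Qed.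

Lemma coef_tw z z' : coef z (tw z') = (z == z')%:R.
Proof.
rewrite coef_tens; have [->|nz] := eqVneq z z'.
  by rewrite big1 // => i _; rewrite ffunE (cM_letter hb) eqxx.
have [i ni] := ffun_neq nz.
by rewrite (bigD1 i) // ffunE (cM_letter hb) (negPf ni) /= mul0r.
Qed.

Lemma tens_mul (p q : 'I_d -> deg) (x y : {ffun 'I_d -> mat A n}) :
  (forall i, mat_grading gr (p i) (x i)) -> (forall i, mat_grading gr (q i) (y i)) ->
  tens x * tens y = sgn (swaps (par \o p) (par \o q)) *: tens [ffun i => mat_mul (x i) (y i)].
Proof.
move=> gx gy; have -> := proj2 tensP (finfun p) (finfun q) x y; first 1 last.
- by move=> i; rewrite ffunE.
- by move=> i; rewrite ffunE.
congr (_ *: _).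
rewrite -signr_odd /sgn odd_sum; congr (_ ^+ (nat_of_bool _)); apply: eq_bigr => m _.
rewrite odd_sum big_mkcond; apply: eq_bigr => l _; rewrite !ffunE oddM /par /=.
case: ifP => _; last by rewrite mul0r.
by case: (Z2_cases (p m).2) => ->; case: (Z2_cases (q l).2) => ->.
Qed.

Definition wact (z : word) (g : 'S_d) : word := [ffun i => z (g i)].
Definition pz (z : word) (i : 'I_d) : bool := par (dg (z i).1.1).

Lemma wact1 z : wact z 1%g = z.
Proof. by apply/ffunP => i; rewrite ffunE perm1. Qed.

Lemma wactM z g h : wact (wact z g) h = wact z (h * g)%g.
Proof. by apply/ffunP => i; rewrite !ffunE permM. Qed.

Lemma wact_inj g : injective (wact^~ g).
Proof. by move=> z z' E; rewrite -[z]wact1 -[z']wact1 -(mulVg g) -!wactM E. Qed.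

Lemma pz_wact z g : pz (wact z g) = pz z \o g.
Proof. by apply/funext => i; rewrite /pz ffunE. Qed.

(** The signed place permutation of M_n(A)^{(x) d}, defined by its values on the
    basis to make it linear; [locked] prevents simplification from exposing the sum. *)
Definition act (g : 'S_d) (t : TP) : TP :=
  locked (\sum_z (coef z t * sgn (odd_inv (pz z) g)) *: tw (wact z g)).

Lemma actE g t : act g t = \sum_z (coef z t * sgn (odd_inv (pz z) g)) *: tw (wact z g).
Proof. by rewrite /act -lock. Qed.

Lemma act_linear g : linear (act g).
Proof.
move=> c u v; rewrite !actE scaler_sumr -big_split; apply: eq_bigr => z _ /=.
by rewrite linearP /= mulrDl scalerDl -mulrA -scalerA.
Qed.
HB.instance Definition _ g := GRing.isLinear.Build k TP TP _ (act g) (act_linear g).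

Lemma actZ g c t : act g (c *: t) = c *: act g t.
Proof. exact: linearZ. Qed.

Lemma act_sum g (T : finType) (P : pred T) (f : T -> TP) :
  act g (\sum_(i | P i) f i) = \sum_(i | P i) act g (f i).
Proof. exact: linear_sum. Qed.

Lemma act_tens (p : 'I_d -> deg) (x : {ffun 'I_d -> mat A n}) g : (forall i, mat_grading gr (p i) (x i)) ->
  act g (tens x) = sgn (odd_inv (par \o p) g) *: tens [ffun i => x (g i)].
Proof.
move=> gx; rewrite actE [tens [ffun _ => _]]coef_expand scaler_sumr [RHS](reindex_inj (@wact_inj g)).
apply: eq_bigr => z _; rewrite scalerA; congr (_ *: _).
rewrite !coef_tens [in RHS](reindex_inj (@perm_inj _ g^-1%g)).
under [in RHS]eq_bigr do rewrite !ffunE permKV.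
have [->|nz] := eqVneq (\prod_i cM cA (z i) (x i)) 0; first by rewrite mul0r mulr0.
rewrite mulrC; congr (sgn (odd_inv _ _) * _); apply/funext => i; rewrite /pz /=.
congr par; apply: (gr_cM hb (gx i)); apply: contraNneq nz => z0.
by rewrite (bigD1 i) // z0 /= mul0r.
Qed.

Lemma gr_words (z : word) i : mat_grading gr (dg (z i).1.1) (words_of letter_mx z i).
Proof. by rewrite ffunE; exact: (gr_letter hb). Qed.

Lemma act_tw g z : act g (tw z) = sgn (odd_inv (pz z) g) *: tw (wact z g).
Proof.
rewrite (act_tens _ (gr_words z)); congr (_ *: tens _).
by apply/ffunP => i; rewrite !ffunE.
Qed.

Lemma act_mul g t t' : act g (t * t') = act g t * act g t'.
Proof.
rewrite (coef_expand t) (coef_expand t') mulr_suml !act_sum [RHS]mulr_suml.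
apply: eq_bigr => y _; rewrite mulr_sumr !act_sum [RHS]mulr_sumr; apply: eq_bigr => z _.
rewrite -scalerAl -scalerAr !actZ -scalerAl -scalerAr; congr (_ *: (_ *: _)).
have gp i : mat_grading gr (dg (y i).1.1 + dg (z i).1.1)
    ([ffun i => mat_mul (words_of letter_mx y i) (words_of letter_mx z i)] i).
  by rewrite ffunE; apply: (gr_mat_mul hb); apply: gr_words.
rewrite (tens_mul (gr_words y) (gr_words z)) actZ (act_tens _ gp) !act_tw.
rewrite -scalerAl -scalerAr (tens_mul (gr_words _) (gr_words _)) !scalerA.
congr (_ *: tens _); last by apply/ffunP => i; rewrite !ffunE.
have -> : par \o (fun i => dg (y i).1.1 + dg (z i).1.1) = fun i => pz y i + pz z i.
  by apply/funext => i; rewrite /= parD.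
rewrite -!sgnD; congr sgn.
have -> : par \o (fun i => dg (wact y g i).1.1) = pz y \o g by apply/funext => i; rewrite /= ffunE.
have -> : par \o (fun i => dg (wact z g i).1.1) = pz z \o g by apply/funext => i; rewrite /= ffunE.
by rewrite -odd_inv_add addrC.
Qed.

Lemma act_act g h t : act h (act g t) = act (h * g)%g t.
Proof.
rewrite (coef_expand t) !act_sum; apply: eq_bigr => z _; rewrite !actZ; congr (_ *: _).
by rewrite !act_tw actZ act_tw scalerA -sgnD pz_wact wactM odd_inv_comp.
Qed.

Lemma act1 t : act 1%g t = t.
Proof.
rewrite [RHS]coef_expand actE; apply: eq_bigr => z _.
by rewrite odd_inv1 wact1 mulr1.
Qed.

Lemma coef_act z g t : coef (wact z g) (act g t) = sgn (odd_inv (pz z) g) * coef z t.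
Proof.
rewrite actE linear_sum (bigD1 z) //= linearZ /= coef_tw eqxx mulr1 mulrC big1 ?addr0 // => z' nz.
by rewrite linearZ /= coef_tw (inj_eq (@wact_inj g)) eq_sym (negPf nz) mulr0.
Qed.

Lemma tens1 : tens [ffun => 1%:M] = 1.
Proof.
have h t : tens [ffun => 1%:M] * t = t.
  rewrite [t in LHS]coef_expand [RHS]coef_expand mulr_sumr; apply: eq_bigr => z _.
  rewrite -scalerAr; congr (_ *: _).
  rewrite (@tens_mul (fun _ => 0) _ _ _ _ (gr_words z)); last by move=> i; rewrite ffunE; exact: (gr_mat1 hb).
  have -> : swaps (par \o (fun=> 0)) (par \o (fun i => dg (z i).1.1)) = 0 :> bool.
    exact: swaps_eq0.
  rewrite scale1r; congr tens; apply/ffunP => i; rewrite !ffunE; exact: mul1mx.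
by rewrite -[LHS]mulr1 h.
Qed.
End TensorAction.

(** * Young subgroups and shortest representatives *)

Section YoungSubgroup.
Variables (d : nat) (L : finType) (f : 'I_d -> L).

(** The stabilizer of a colouring is the direct product of the symmetric groups on
    its fibres; the fibres are split off one at a time. *)
Lemma young_card_seq (s : seq L) : uniq s ->
  #|[set g : 'S_d | perm_on [set i | f i \in s] g && [forall i, f (g i) == f i]]| =
  (\prod_(l <- s) (#|[set i | f i == l]|)`!)%N.
Proof.
elim: s => [_|l s IH /= /andP[ls us]].
  rewrite big_nil -[RHS](cards1 (1%g : 'S_d)); apply: eq_card => g; rewrite !inE.
  apply/andP/eqP => [[pg _]|->].
    apply: perm_on_id pg _; rewrite (eq_card0 (A := [set _ | _])) // => i.
    by rewrite inE.
  by split; [exact: perm_on1 | apply/forallP => i; rewrite perm1].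
rewrite big_cons -IH // -card_Sym.
set H := Sym _.
set K := [set g : 'S_d | perm_on [set i | f i \in s] g && [forall i, f (g i) == f i]].
have mulE : [set g : 'S_d | perm_on [set i | f i \in l :: s] g && [forall i, f (g i) == f i]]
   = (H * K)%g.
  apply/setP => g; rewrite inE; apply/andP/mulsgP => [[pg /forallP fg]|[h k0]].
    have inj : injective (fun i => if f i == l then g i else i).
      move=> i j /=; case: (f i =P l) => fi; case: (f j =P l) => fj E; first exact: perm_inj E.
      - by case: fj; rewrite -E (eqP (fg i)).
      - by case: fi; rewrite E (eqP (fg j)).
      - by [].
    pose h := perm inj; have hE i : h i = if f i == l then g i else i by rewrite permE.
    exists h (h^-1 * g)%g; last by rewrite mulKVg.
      rewrite inE; apply/fintype.subsetP => i; rewrite !inE hE.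
      by case: ifP => //; rewrite eqxx.
    have kE i : (h^-1 * g)%g i = if f i == l then i else g i.
      rewrite permM; have [j ->] : exists j, i = h j by exists (h^-1%g i); rewrite permKV.
      rewrite permK hE; case: (boolP (f j == l)) => fj; last by rewrite (negPf fj).
      by rewrite (eqP (fg j)) fj.
    rewrite inE; apply/andP; split; last by apply/forallP => i; rewrite kE; case: ifP.
    apply/fintype.subsetP => i; rewrite !inE kE; case: ifP => [|fi gi]; first by rewrite eqxx.
    have := fintype.subsetP pg i; rewrite !inE fi; exact.
  rewrite !inE => ph /andP[pk /forallP fk] ->; split.
    apply: perm_onM.
      apply/fintype.subsetP => i; move/(fintype.subsetP ph); rewrite !inE => ->//.
    by apply/fintype.subsetP => i; move/(fintype.subsetP pk); rewrite !inE => ->; rewrite orbT.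
  apply/forallP => i; rewrite permM (eqP (fk _)).
  have [fi|fi] := boolP (i \in [set i | f i == l]).
    by have := perm_closed i ph; rewrite fi !inE => /eqP->; rewrite inE in fi; rewrite (eqP fi).
  by rewrite (out_perm ph fi).
have gK : group_set K.
  apply/group_setP; split=> [|g h]; rewrite !inE.
    by rewrite perm_on1; apply/forallP => i; rewrite perm1.
  move=> /andP[pg /forallP fg] /andP[ph /forallP fh]; rewrite perm_onM //=.
  by apply/forallP => i; rewrite permM (eqP (fh _)).
rewrite mulE; apply: (@TI_cardMg _ (Sym_group [set i | f i == l]) (Group gK)).
apply/trivgP/fintype.subsetP => g; rewrite !inE => /andP[ph /andP[pk _]].
apply/eqP/permP => i; rewrite perm1; have [fi|fi] := boolP (f i == l).
  by apply: (out_perm pk); rewrite inE (eqP fi).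
by apply: (out_perm ph); rewrite inE.
Qed.

Lemma young_card : #|[set g : 'S_d | [forall i, f (g i) == f i]]| =
  (\prod_l (#|[set i | f i == l]|)`!)%N.
Proof.
rewrite -young_card_seq ?index_enum_uniq //; apply: eq_card => g; rewrite !inE.
rewrite (_ : perm_on _ _) //; apply/fintype.subsetP => i _.
by rewrite inE mem_index_enum.
Qed.
End YoungSubgroup.

Section ShortestRepresentatives.
Variable d : nat.
Implicit Types (s t : 'S_d).

(** Exchanging the two values of an inversion removes more inversions than it
    creates; [swap] matches the new inversions with old ones. *)
Lemma perm_length_tperm s (i j : 'I_d) : (i < j)%N -> (s j < s i)%N ->
  (perm_length (s * tperm (s i) (s j))%g < perm_length s)%N.
Proof.
move=> ij sji; set t := tperm i j.
have -> : (s * tperm (s i) (s j))%g = (t * s)%g.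
  by rewrite -[tperm (s i) (s j)]tpermJ conjgE !mulgA mulgV mul1g.
pose swap (p : 'I_d * 'I_d) := if (t p.1 < t p.2)%N then (t p.1, t p.2) else p.
have ttK x : t (t x) = x by rewrite tpermK.
have swapK : {in [pred p : 'I_d * 'I_d | (p.1 < p.2)%N], involutive swap}.
  move=> [a b] ab; rewrite /swap /=; case: (boolP (t a < t b)%N) => h /=; last by rewrite (negPf h).
  by rewrite !ttK; have -> : (a < b)%N := ab.
have swap_lt (p : 'I_d * 'I_d) : (p.1 < p.2)%N -> ((swap p).1 < (swap p).2)%N by rewrite /swap; case: ifP.
rewrite /perm_length.
set S' := [set p | _]; set S := [set p | _].
have sub : (i, j) |: [set swap p | p in S'] \subset S.
  rewrite finset.subUset finset.sub1set inE /= ij sji /=.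
  apply/fintype.subsetP => _ /imsetP[[a b] + ->]; rewrite !inE /= !permM => /andP[ab sba].
  rewrite (swap_lt (a, b) ab) /swap /=; case: ifP => //= /negbT; rewrite -leqNgt.
  move: ab sba; rewrite /t; case: tpermP => [->|->|/eqP ai /eqP aj]; case: tpermP => [->|->|/eqP bi /eqP bj];
    move: sji ij; lia.
apply: leq_trans (subset_leq_card sub); rewrite cardsU1.
rewrite card_in_imset ?ltn_add2r; last first.
  move=> p q; rewrite !inE => /andP[p12 _] /andP[q12 _] E.
  by rewrite -(swapK p p12) -(swapK q q12) E.
suff -> : (i, j) \notin [set swap p | p in S'] by rewrite add1n.
apply/imsetP => [[[a b]]]; rewrite !inE /= !permM => /andP[ab sba] E.
have := swapK (a, b) ab; rewrite -E /swap /= tpermL tpermR ltnNge (ltnW ij) /= => -[ai bj].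
by move: sba; rewrite -ai -bj tpermL tpermR; lia.
Qed.

Variable (W : eqType) (z : {ffun 'I_d -> W}).

(** At the first place where s and t differ, the value of each of them occurs later
    in the other, in the same fibre of z, hence is the larger of the two. *)
Lemma increasing_unique s t :
  (forall i, z (s i) = z (t i)) ->
  (forall i j : 'I_d, (i < j)%N -> z (s i) = z (s j) -> (s i < s j)%N) ->
  (forall i j : 'I_d, (i < j)%N -> z (t i) = z (t j) -> (t i < t j)%N) -> s = t.
Proof.
move=> st si ti; apply/permP => i; have [m] := ubnP i; elim: m i => // m IH i im.
apply: contrapT => /eqP ne.
have aux (s1 t1 : 'S_d) : (forall i, z (s1 i) = z (t1 i)) ->
    (forall i j : 'I_d, (i < j)%N -> z (t1 i) = z (t1 j) -> (t1 i < t1 j)%N) ->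
    s1 i != t1 i -> (forall j : 'I_d, (j < i)%N -> s1 j = t1 j) -> (t1 i < s1 i)%N.
  move=> e12 t1i ne1 lt1; set j := t1^-1%g (s1 i).
  have tj : t1 j = s1 i by rewrite permKV.
  case: (ltngtP j i) => ji.
  - by have := lt1 j ji; rewrite tj => /perm_inj E; rewrite E ltnn in ji.
  - by rewrite -tj; apply: t1i => //; rewrite tj e12.
  - by move: ne1; rewrite -tj (val_inj ji) eqxx.
have lt (j : 'I_d) : (j < i)%N -> s j = t j by move=> ji; apply: IH; lia.
have h1 := aux s t st ti ne lt.
rewrite eq_sym in ne.
have h2 := aux t s (fun i => esym (st i)) si ne (fun j ji => esym (lt j ji)).
by lia.
Qed.
End ShortestRepresentatives.

(** * Elements of T from families with an action of the symmetric group *)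

Section SchurAlgebraElements.
Variables (k : idomainType) (A : algType k) (gr : deg -> set A).
Variables (disp : Order.disp_t) (I : finPOrderType disp) (X Y : I -> {fset A}).
Local Notation Bt := (products X Y).
Variables (cA : Bt -> {scalar A}) (dg : Bt -> deg) (ix : Bt -> I) (eb : I -> Bt).
Variables (isa isc : pred Bt).
Hypothesis cb : conforming_basis gr cA dg ix eb isa isc.
Local Notation hb := (cb_hb cb).
Variables (n d : nat) (TP : algType k) (tens : {ffun 'I_d -> mat A n} -> TP).
Hypothesis tensP : is_super_tensor_power (@mat_mul k A n) (mat_grading gr) tens.
Local Notation L := (Bt * 'I_n * 'I_n)%type.
Local Notation word := {ffun 'I_d -> L}.
Local Notation bv := (fun b : Bt => val b).
Local Notation tw := (tw bv tens).
Variable coef : word -> {scalar TP}.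
Hypothesis coef_tens : forall z x, coef z (tens x) = \prod_i cM cA (z i) (x i).
Hypothesis coef_expand : forall t, t = \sum_z coef z t *: tw z.
Local Notation act := (act bv dg tens coef).
Local Notation pz := (pz dg).
Local Notation sgn := (sgn k).
Implicit Types (z y : word) (g h : 'S_d).

Definition zw (z : word) : {ffun 'I_d -> A * 'I_n * 'I_n} :=
  [ffun i => (val (z i).1.1, (z i).1.2, (z i).2)].

Lemma parity_val eps (b : Bt) : parity_part gr eps (val b) <-> (dg b).2 = eps.
Proof.
have nz : cA b (val b) != 0 by rewrite (hb_coord hb) eqxx oner_neq0.
split=> [h|<-]; last by apply: span_in; exists (dg b).1; have := gr_bv hb b; case: (dg b).
move: b nz h => b0 nz h; apply/eqP; move: nz.
apply: (span_sub (P := fun v => forall b, cA b v != 0 -> (dg b).2 == eps)) h b0 => [|u [m gu] b nz].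
  exact: (supp_submod cA (fun b => (dg b).2 == eps)).
by rewrite (proj1 (hb_gr hb _ _) gu b nz).
Qed.

Lemma odd_letterE z i : `[< odd_letter gr (zw z i) >] = pz z i.
Proof.
rewrite /odd_letter ffunE /=; apply/asboolP/eqP => [/parity_val//|E].
exact/parity_val.
Qed.

Lemma even_letterE z i : even_letter gr (zw z i) <-> ~~ pz z i.
Proof.
rewrite /even_letter ffunE /= /pz /par; split=> [/parity_val->//|].
by move=> ne; apply/parity_val; case: (Z2_cases (dg (z i).1.1).2) ne => ->.
Qed.

Lemma pure_actE z g : pure_act gr tens (zw z) g = act g (tw z).
Proof.
rewrite (act_tw hb coef_tens coef_expand) /pure_act; congr (_ *: tens _); last first.
  by apply/ffunP => i; rewrite !ffunE.
rewrite -signr_odd; congr (_ ^+ nat_of_bool _); rewrite /sign_exponent -sum1_card odd_sum.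
rewrite big_mkcond /odd_inv pair_bigA; apply: eq_bigr => -[a b] _; rewrite inE /= !odd_letterE.
by case: (_ < _)%N; case: (_ < _)%N; case: (pz z a); case: (pz z b).
Qed.

Definition triz (z : word) : bool :=
  [forall i, forall j, (i != j) && (z i == z j) ==> ~~ pz z i].

Lemma trizP z : Tri gr X Y (zw z) <-> triz z.
Proof.
have inj i j : zw z i = zw z j <-> z i = z j.
  rewrite !ffunE; split=> [|->//]; case: (z i) (z j) => [[b r] s] [[b' r'] s'] /= [+ -> ->].
  by move=> /val_inj->.
split=> [[_ h]|/forallP h].
  apply/forallP => i; apply/forallP => j; apply/implyP => /andP[ij /eqP/inj zij].
  exact/even_letterE/(h i j).
split=> [i|i j ij /inj zij]; first by rewrite ffunE /=; apply: valP.
apply/even_letterE; have /forallP/(_ j)/implyP := h i; apply.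
by rewrite ij zij eqxx.
Qed.

Lemma tri_word (w : {ffun 'I_d -> A * 'I_n * 'I_n}) : Tri gr X Y w -> exists z, w = zw z.
Proof.
move=> [h _]; exists [ffun i => ([` h i]%fset, (w i).1.2, (w i).2)].
by apply/ffunP => i; rewrite !ffunE /=; case: (w i) => [[]].
Qed.

Lemma stab_sign z g : triz z -> wact z g = z -> odd_inv (pz z) g = 0.
Proof.
move=> /forallP tz zg; apply: odd_inv_eq0 => i gi.
have /forallP/(_ (g i))/implyP := tz i; rewrite eq_sym gi -[z (g i)](ffunE (fun i => z (g i))).
by rewrite -/(wact z g) zg eqxx => /(_ isT)/negbTE.
Qed.

Lemma coset_sign z g h : triz z -> wact z g = wact z h ->
  odd_inv (pz z) g = odd_inv (pz z) h.
Proof.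
move=> tz zgh; set t := (g^-1 * h)%g.
have zt : wact z t = z by rewrite -wactM -zgh wactM mulVg wact1.
have -> : h = (g * t)%g by rewrite mulKVg.
by rewrite -odd_inv_comp (stab_sign tz zt) add0r -(pz_wact dg) zt.
Qed.

Lemma word_actE z g h : (word_act (zw z) g == word_act (zw z) h) = (wact z g == wact z h).
Proof.
apply/eqP/eqP => E; apply/ffunP => i; have := congr1 (fun f : {ffun _ -> _} => f i) E; rewrite !ffunE; last by move=> ->.
by case: (z (g i)) (z (h i)) => [[b r] s] [[b' r'] s'] /= [/val_inj-> -> ->].
Qed.

Lemma word_act_stab z g : (word_act (zw z) g == zw z) = (wact z g == z).
Proof.
rewrite -{4}[z]wact1 -word_actE; congr (_ == _).
by apply/ffunP => i; rewrite !ffunE perm1.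
Qed.

Lemma shortest_increasing z g : shortest_rep (zw z) g ->
  forall i j : 'I_d, (i < j)%N -> z (g i) = z (g j) -> (g i < g j)%N.
Proof.
move=> /forallP sg i j ij zij; case: (ltngtP (g i) (g j)) => // gij.
  have /implyP := sg (tperm (g i) (g j)); rewrite leqNgt perm_length_tperm //=.
  move=> h; have : ~~ true by apply: h; apply/eqP/ffunP => l; rewrite !ffunE; case: tpermP => [->|->|]; rewrite ?zij.
  by [].
by have := perm_inj (val_inj gij) => E; rewrite E ltnn in ij.
Qed.

Lemma shortest_exists z g : exists2 s, shortest_rep (zw z) s & wact z s = wact z g.
Proof.
case: (arg_minnP (P := fun s => wact z s == wact z g) (@perm_length d) (eqxx (wact z g))) => s /eqP sg smin.
exists s => //; apply/forallP => t; apply/implyP => zt; apply: smin.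
by rewrite word_act_stab in zt; rewrite -wactM (eqP zt) sg.
Qed.

Local Notation xi z := (Defs.xi gr tens (zw z)).
Local Notation eta z := (Defs.eta gr X Y tens (zw z)).

(** The coset of g has a single shortest representative, and its sign is that of g
    because the stabilizer of z moves even letters only. *)
Lemma coef_xi z g : triz z -> coef (wact z g) (xi z) = sgn (odd_inv (pz z) g).
Proof.
move=> tz; have [s0 short0 s0g] := shortest_exists z g.
rewrite /Defs.xi linear_sum (bigD1 s0) //= pure_actE (act_tw hb coef_tens coef_expand).
rewrite linearZ /= (coef_tw hb coef_tens) s0g eqxx mulr1 (coset_sign tz s0g).
rewrite big1 ?addr0 // => s /andP[short ne].
rewrite pure_actE (act_tw hb coef_tens coef_expand) linearZ /= (coef_tw hb coef_tens).
case: eqP => [E|]; last by rewrite mulr0.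
case/eqP: ne; apply: (increasing_unique (z := z)).
- by move=> i; have := congr1 (fun f : word => f i) (etrans (esym E) (esym s0g)); rewrite !ffunE.
- exact: shortest_increasing.
- exact: shortest_increasing.
Qed.

Lemma coef_xi_other z y : (forall g : 'S_d, y <> wact z g) -> coef y (xi z) = 0.
Proof.
move=> ny; rewrite /Defs.xi linear_sum big1 // => s _.
rewrite pure_actE (act_tw hb coef_tens coef_expand) linearZ /= (coef_tw hb coef_tens).
by case: eqP => [/ny//|]; rewrite mulr0.
Qed.

(** The place permutations that only move letters of B_c. *)
Definition Kz (z : word) : {set 'S_d} :=
  [set g : 'S_d | [forall i, (z (g i) == z i) && ((g i != i) ==> isc (z i).1.1)]].

Lemma KzP z (g : 'S_d) : reflect (forall i, z (g i) = z i /\ (g i != i -> isc (z i).1.1)) (g \in Kz z).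
Proof.
rewrite inE; apply: (iffP forallP) => h i; first by have /andP[/eqP-> /implyP] := h i.
by have [-> hi] := h i; rewrite eqxx; apply/implyP.
Qed.

Lemma prod_Bc (G : A -> nat) : (\prod_(b <- B_c gr X Y) G b)%N = (\prod_(b : Bt | isc b) G (val b))%N.
Proof.
rewrite -[RHS]big_filter -(big_map val xpredT G); apply: perm_big.
apply: uniq_perm; first exact: fset_uniq.
  by rewrite map_inj_uniq ?filter_uniq ?index_enum_uniq //; exact: val_inj.
move=> v; apply/idP/mapP => [/(proj1 (cb_Bc cb v))[b cb0 ->]|[b]].
  by exists b; rewrite // mem_filter cb0 mem_index_enum.
by rewrite mem_filter => /andP[cb0 _] ->; apply/(cb_Bc cb); exists b.
Qed.

Lemma multiplicityE z (b : Bt) (r s : 'I_n) :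
  multiplicity (zw z) (val b, r, s) = #|[set i | z i == (b, r, s)]|.
Proof.
apply: eq_card => i; rewrite !inE ffunE; case: (z i) => [[b' r'] s'] /=.
by rewrite !xpair_eqE (inj_eq val_inj).
Qed.

(** [Kz z] is the Young subgroup of a colouring: a letter of B_c is its own colour,
    while each of the other places gets a colour of its own. *)
Lemma eta_Kz z : eta z = #|Kz z|%:R *: xi z.
Proof.
rewrite /Defs.eta; congr (_%:R *: _); rewrite prod_Bc.
pose f (i : 'I_d) : L + 'I_d := if isc (z i).1.1 then inl (z i) else inr i.
have -> : Kz z = [set g : 'S_d | [forall i, f (g i) == f i]].
  apply/setP => g; rewrite [RHS]inE; apply/KzP/forallP => h i.
    have [zi ci] := h i; rewrite /f zi; case: ifP => // nc.
    by apply/eqP; congr inr; apply/eqP; apply: contraFT nc.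
  have /eqP := h i; rewrite /f.
  case: ifP => c1; case: ifP => c2 //; first by case=> ->.
  by case=> ->; rewrite eqxx.
rewrite young_card big_sumType /= [X in _ = (_ * X)%N]big1 ?muln1; last first.
  move=> i _; have : (#|[set j | f j == inr i]| <= 1)%N.
    rewrite -(cards1 i); apply/subset_leq_card/fintype.subsetP => j; rewrite !inE /f.
    by case: ifP => // _ /eqP[->].
  by case: #|_| => [|[|]].
rewrite -[RHS](pair_bigA _ (fun br s => (#|[set i | f i == inl (br, s)]|)`!)%N) /=.
rewrite -[RHS](pair_bigA _ (fun b r => \prod_(s < n) (#|[set i | f i == inl (b, r, s)]|)`!)%N) /=.
rewrite big_mkcond; apply: eq_bigr => b _; case: ifP => cb0; last first.
  rewrite big1 // => r _; rewrite big1 // => s _; rewrite (eq_card0 (A := [set _ | _])) // => i.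
  by rewrite inE /f; case: ifP => // ci; apply/eqP => -[E]; rewrite E cb0 in ci.
apply: eq_bigr => r _; apply: eq_bigr => s _; rewrite multiplicityE; congr (_`!)%N.
apply: eq_card => i; rewrite !inE /f; case: ifP => ci; first by rewrite (inj_eq (@inl_inj _ _)).
by apply/eqP => E; rewrite E cb0 in ci.
Qed.

Lemma Kz_stab z g : g \in Kz z -> wact z g = z /\ odd_inv (pz z) g = 0.
Proof.
move=> /KzP h; split; first by apply/ffunP => i; rewrite ffunE; case: (h i).
apply: odd_inv_eq0 => i gi; rewrite /pz /par; have [_ /(_ gi) ci] := h i.
by rewrite (eqP (cb_isc_even cb ci)).
Qed.

Lemma Kz1 z : 1%g \in Kz z.
Proof. by apply/KzP => i; rewrite perm1 eqxx. Qed.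

Lemma KzM z g h : g \in Kz z -> h \in Kz z -> (g * h)%g \in Kz z.
Proof.
move=> /KzP hg /KzP hh; apply/KzP => i; rewrite permM.
have [zi ci] := hg i; have [zg cg] := hh (g i); rewrite zg zi; split=> // ne.
have [E|/ci //] := eqVneq (g i) i; by move: cg ne; rewrite E; apply.
Qed.

Lemma KzV z g : g \in Kz z -> (g^-1)%g \in Kz z.
Proof.
move=> /KzP hg; apply/KzP => i; have [zi ci] := hg (g^-1 i)%g; rewrite permKV in zi ci.
by rewrite zi; split=> // ne; apply: ci; rewrite eq_sym.
Qed.

(** The orbit of [z] under place permutations, and a chosen representative. *)
Definition canonical_word (z : word) : word :=
  odflt z [pick y | [exists g, y == wact z g]].

Lemma canonical_word_orbit z : exists g, z = wact (canonical_word z) g.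
Proof.
rewrite /canonical_word; case: pickP => [y /existsP[g /eqP ->]|/(_ z)/existsP[]].
  by exists (g^-1)%g; rewrite wactM mulVg wact1.
by exists 1%g; rewrite wact1.
Qed.

Lemma canonical_word_act z g : canonical_word (wact z g) = canonical_word z.
Proof.
rewrite /canonical_word (eq_pick (Q := [pred y | [exists g, y == wact z g]])).
  case: pickP => // /(_ z)/existsP[]; by exists 1%g; rewrite wact1.
move=> y; apply/existsP/existsP => -[h /eqP ->]; first by exists (h * g)%g; rewrite wactM.
by exists (h * g^-1)%g; rewrite wactM mulgKV.
Qed.

Lemma canonical_wordK z : canonical_word (canonical_word z) = canonical_word z.
Proof. by have [g zg] := canonical_word_orbit z; rewrite {2}zg canonical_word_act. Qed.

Hypothesis char0 : [pchar k] =i pred0.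

(** The inversions of a transposition t other than (i, j) are paired by
    (a, b) |-> (t b, t a). *)
Lemma odd_inv_tperm_lt (p : 'I_d -> bool) (i j : 'I_d) : (i < j)%N -> p i -> p j ->
  odd_inv p (tperm i j) = 1.
Proof.
move=> lt pi pj; set t := tperm i j.
have pt a : p (t a) = p a by rewrite /t; case: tpermP => [->|->|//]; rewrite ?pi ?pj.
have tt a : t (t a) = a by rewrite /t tpermK.
pose G (q : 'I_d * 'I_d) : bool := ((q.1 < q.2)%N : bool) * (((t q.2 < t q.1)%N : bool) * (p q.1 * p q.2)).
have -> : odd_inv p t = \sum_q G q by rewrite /odd_inv pair_bigA tpermV.
pose th (q : 'I_d * 'I_d) := (t q.2, t q.1).
have thK : involutive th by move=> [a b]; rewrite /th /= !tt.
have Gth q : G (th q) = G q.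
  by rewrite /G /th /= !tt !pt; case: (_ < _)%N; case: (_ < _)%N; case: (p _); case: (p _).
rewrite (bigID (fun q => th q == q)) /= [X in _ + X](bigID (fun q => (enum_rank q < enum_rank (th q))%N)) /=.
have -> : \sum_(q | (th q != q) && ~~ (enum_rank q < enum_rank (th q))%N) G q =
          \sum_(q | (th q != q) && (enum_rank q < enum_rank (th q))%N) G q.
  rewrite (reindex_inj (inv_inj thK)); apply: eq_big => [q|q _]; last exact: Gth.
  rewrite thK eq_sym; case: eqP => //= ne.
  have : enum_rank q != enum_rank (th q) :> nat by rewrite (inj_eq val_inj) (inj_eq enum_rank_inj) eq_sym; apply/eqP.
  by case: ltngtP.
have -> (x : bool) : x + x = 0 by case: x.
rewrite addr0.
have tij : (t i = j) /\ (t j = i) by rewrite /t tpermL tpermR.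
rewrite (bigD1 (i, j)) /th /=; last by rewrite (proj1 tij) (proj2 tij).
rewrite big1 ?addr0 => [|[a b] /= /andP[/eqP[tb ta] ne]].
  by rewrite /G /= (proj1 tij) (proj2 tij) lt pi pj.
rewrite /G /= ta tb; case: (ltnP a b) => ab; rewrite ?mul0r // mul1r.
move: ab tb ta ne; rewrite /t; case: tpermP => [->|->|/eqP ai /eqP aj]; rewrite ?xpair_eqE.
- by move=> ab E; move: ab lt; rewrite -E; lia.
- by move=> ab E _; rewrite -E !eqxx.
- by move=> ab E; rewrite E ltnn in ab.
Qed.

Lemma odd_inv_tperm (p : 'I_d -> bool) (i j : 'I_d) : i != j -> p i -> p j ->
  odd_inv p (tperm i j) = 1.
Proof.
move=> ij pi pj; case: (ltngtP i j) => [lt|lt|/val_inj E]; last by rewrite E eqxx in ij.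
  exact: odd_inv_tperm_lt.
by rewrite tpermC; apply: odd_inv_tperm_lt.
Qed.

Definition invariant t := forall g, act g t = t.

Lemma invariant_coef t z g : invariant t ->
  coef (wact z g) t = sgn (odd_inv (pz z) g) * coef z t.
Proof. by move=> it; rewrite -{1}(it g) (coef_act hb coef_tens). Qed.

(** Exchanging two equal odd letters changes the sign of the coefficient. *)
Lemma invariant_not_tri t z : invariant t -> ~~ triz z -> coef z t = 0.
Proof.
move=> it /forallPn[i /forallPn[j]]; rewrite negb_imply negbK => /andP[/andP[ij /eqP zij] oi].
have zt : wact z (tperm i j) = z by apply/ffunP => l; rewrite ffunE; case: tpermP => [->|->|]; rewrite ?zij.
have := invariant_coef z (tperm i j) it; rewrite zt odd_inv_tperm //; last by rewrite /pz -zij.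
rewrite [sgn _]expr1 mulN1r => /eqP; rewrite -addr_eq0 -mulr2n -mulr_natr mulf_eq0.
case/orP => [/eqP//|]; by have := char0 2; rewrite !inE /= => ->.
Qed.

(** An invariant is determined by its coefficients at one word per orbit, where the
    coefficient of [eta z] is the order of [Kz z]. *)
Lemma invariant_expand t (c : word -> k) : invariant t ->
  (forall z, coef z t = #|Kz z|%:R * c z) ->
  t = \sum_(z | (canonical_word z == z) && triz z) c z *: eta z.
Proof.
move=> it tc; apply: (coef_eq coef_expand) => y; rewrite linear_sum.
have [g yg] := canonical_word_orbit y; set z := canonical_word y in yg.
have other z' : (canonical_word z' == z') && triz z' -> z' != z -> coef y (c z' *: eta z') = 0.
  move=> /andP[/eqP cz' _] ne; rewrite linearZ /= eta_Kz linearZ /= coef_xi_other ?mulr0 // => h E.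
  by case/eqP: ne; rewrite /z E canonical_word_act cz'.
have [tz|ntz] := boolP (triz z).
  rewrite (bigD1 z) /=; last by rewrite /z canonical_wordK eqxx.
  rewrite big1 ?addr0 => [|z' /andP[h ne]]; last exact: other.
  rewrite linearZ /= eta_Kz linearZ /= {1 2}yg coef_xi // invariant_coef // tc.
  by rewrite mulrC mulrCA mulrA.
rewrite yg invariant_coef // (invariant_not_tri it ntz) mulr0 big1 // => z' /andP[cz' tz'].
rewrite -yg other ?cz' //; by apply: contraNneq ntz => <-.
Qed.

(** Families indexed by a finite set with an action of the symmetric group and
    compatible with place permutations; their sums generalize the orbit sums xi
    and, unlike those, are visibly closed under products. *)
Definition equivariant (Z : finType) (zact : 'S_d -> Z -> Z) (f : Z -> TP) : Prop :=
  [/\ forall x, zact 1%g x = x,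
      forall g h x, zact h (zact g x) = zact (h * g)%g x
    & forall g x, f (zact g x) = act g (f x)].

(** At the places moved by the stabilizer of x the letters will be required to come
    from M_n(a). *)
Definition moved (Z : finType) (zact : 'S_d -> Z -> Z) (x : Z) (i : 'I_d) : Prop :=
  exists2 g : 'S_d, zact g x = x & g i != i.

Section EquivariantSum.
Variables (Z : finType) (zact : 'S_d -> Z -> Z) (f : Z -> TP).
Hypothesis eqf : equivariant zact f.

Lemma zact_inj g : injective (zact g).
Proof.
have [z1 zM _] := eqf; move=> x y E.
by rewrite -[x]z1 -[y]z1 -(mulVg g) -!zM E.
Qed.

Lemma equivariant_invariant : invariant (\sum_x f x).
Proof.
move=> g; have [_ _ fg] := eqf; rewrite act_sum [RHS](reindex_inj (@zact_inj g)).
by apply: eq_bigr => x _; rewrite fg.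
Qed.

Hypothesis even_moved : forall x i z, moved zact x i -> coef z (f x) != 0 -> isa (z i).1.1.

(** The group [Kz z] preserves the coefficient of z and acts freely on its
    support: a letter of B_c is never moved by the stabilizer of an index. *)
Lemma equivariant_coef_divisible (P : k -> Prop) z :
  P 0 -> (forall u v, P u -> P v -> P (u + v)) ->
  (forall x, P (coef z (f x))) ->
  exists2 c, P c & coef z (\sum_x f x) = #|Kz z|%:R * c.
Proof.
move=> P0 PD Pf; have [z1 zM fg] := eqf.
pose rep x := odflt x [pick y | [exists g in Kz z, y == zact g x]].
have rep_orbit x : exists2 g, g \in Kz z & x = zact g (rep x).
  rewrite /rep; case: pickP => [y /existsP[g /andP[gK /eqP->]]|no]; last by exists 1%g; rewrite ?Kz1 ?z1.
  by exists (g^-1)%g; rewrite ?KzV // zM mulVg z1.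
have rep_act x g : g \in Kz z -> rep (zact g x) = rep x.
  move=> gK; rewrite /rep (eq_pick (Q := [pred y | [exists h in Kz z, y == zact h x]])).
    case: pickP => // /(_ x)/existsP[]; by exists 1%g; rewrite Kz1 z1 eqxx.
  move=> y; apply/existsP/existsP => -[h /andP[hK /eqP->]].
    by exists (h * g)%g; rewrite KzM //= zM.
  by exists (h * g^-1)%g; rewrite KzM ?KzV //= zM mulgKV.
have coef_const x g : g \in Kz z -> coef z (f (zact g x)) = coef z (f x).
  move=> gK; have [zg sg] := Kz_stab gK; rewrite fg -{1}zg (coef_act hb coef_tens) sg.
  exact: mul1r.
pose c := \sum_(x | rep x == x) coef z (f x).
exists c; first by rewrite /c; elim/big_ind: _.
rewrite linear_sum (partition_big rep (fun x => rep x == x)) /=; last first.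
  by move=> x _; have [g gK {2}->] := rep_orbit x; rewrite rep_act.
rewrite mulr_sumr; apply: eq_bigr => r /eqP rr.
have -> : \sum_(x | rep x == r) coef z (f x) = \sum_(x | rep x == r) coef z (f r).
  apply: eq_bigr => x /eqP xr; have [g gK ->] := rep_orbit x; by rewrite xr coef_const.
have [->|nz] := eqVneq (coef z (f r)) 0; first by rewrite big1 ?mulr0.
rewrite sumr_const mulr_natl; congr (_ *+ _).
have -> : #|[pred x | rep x == r]| = #|[set zact g r | g in Kz z]|.
  apply: eq_card => x; rewrite !inE; apply/eqP/imsetP => [<-|[g gK ->]]; last by rewrite rep_act.
  by have [g gK E] := rep_orbit x; exists g.
rewrite card_in_imset // => g h gK hK E.
apply/eqP; rewrite -[_ == _]negbK; apply/negP => ne.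
have st : zact (h^-1 * g)%g r = r by rewrite -zM E zM mulVg z1.
have [i ni] : exists i, (h^-1 * g)%g i != i.
  apply/existsP; apply: contraNT ne => /existsPn no.
  rewrite -(inj_eq (mulgI h^-1)%g) mulVg; apply/eqP/permP => i; rewrite perm1.
  by apply/eqP/negPn/no.
have hgK : (h^-1 * g)%g \in Kz z by rewrite KzM ?KzV.
have [_ /(_ ni) ci] := elimT (KzP _ _) hgK i.
have mv : moved zact r i by exists (h^-1 * g)%g.
have := even_moved mv nz.
by rewrite (negPf (cb_isc_isa cb ci)).
Qed.

(** All membership proofs for T go through this lemma; P will be the kernel of the
    map from k to F, and otherwise the trivial predicate. *)
Lemma equivariant_sum_eta (P : k -> Prop) :
  P 0 -> (forall u v, P u -> P v -> P (u + v)) ->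
  (forall x z, P (coef z (f x))) ->
  exists2 c : word -> k, forall z, P (c z) &
    \sum_x f x = \sum_(z | (canonical_word z == z) && triz z) c z *: eta z.
Proof.
move=> P0 PD Pf.
have ex z : exists c, P c /\ coef z (\sum_x f x) = #|Kz z|%:R * c.
  by have [c Pc E] := equivariant_coef_divisible P0 PD (Pf^~ z); exists c.
have [c cP] := choice ex; exists c; first by move=> z; case: (cP z).
by apply: (invariant_expand equivariant_invariant) => z; case: (cP z).
Qed.
End EquivariantSum.

Lemma equivariant_mul (Z1 Z2 : finType) zact1 zact2 (f1 : Z1 -> TP) (f2 : Z2 -> TP) :
  equivariant zact1 f1 -> equivariant zact2 f2 ->
  equivariant (fun g (x : Z1 * Z2) => (zact1 g x.1, zact2 g x.2)) (fun x => f1 x.1 * f2 x.2).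
Proof.
move=> [a1 aM af] [b1 bM bf]; split=> [[x y]|g h [x y]|g [x y]] /=; first by rewrite a1 b1.
  by rewrite aM bM.
by rewrite af bf (act_mul hb tensP coef_tens coef_expand).
Qed.

Lemma sum_mul (Z1 Z2 : finType) (f1 : Z1 -> TP) (f2 : Z2 -> TP) :
  (\sum_x f1 x) * (\sum_y f2 y) = \sum_(q : Z1 * Z2) f1 q.1 * f2 q.2.
Proof. by rewrite big_distrlr /= pair_bigA. Qed.

Lemma eta_coef z g : triz z -> coef (wact z g) (eta z) = #|Kz z|%:R * sgn (odd_inv (pz z) g).
Proof. by move=> tz; rewrite eta_Kz linearZ /= coef_xi. Qed.

(** A letter outside B_c can only be permuted with equal letters; the positions
    of the letters of B_c are labelled, so that no permutation fixes the label. *)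
Definition label (z : word) (i : 'I_d) : L + 'I_d :=
  if isc (z i).1.1 then inr i else inl (z i).

Definition labact (g : 'S_d) (x : {ffun 'I_d -> L + 'I_d}) : {ffun 'I_d -> L + 'I_d} :=
  [ffun i => x (g i)].
Definition label_word z : {ffun 'I_d -> L + 'I_d} := finfun (label z).

Definition eta_family z (x : {ffun 'I_d -> L + 'I_d}) : TP :=
  if [pick g | x == labact g (label_word z)] is Some g then act g (tw z) else 0.

Lemma labact_word z g h : labact g (label_word z) = labact h (label_word z) -> wact z g = wact z h.
Proof.
move=> E; apply/ffunP => i; have := congr1 (fun x : {ffun _ -> _} => x i) E; rewrite !ffunE /label.
by case: ifP => _; case: ifP => _ // [->].
Qed.

Lemma eta_familyE z g : triz z -> eta_family z (labact g (label_word z)) = act g (tw z).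
Proof.
move=> tz; rewrite /eta_family; case: pickP => [h /eqP E|/(_ g)]; last by rewrite eqxx.
have zgh := labact_word E.
by rewrite !(act_tw hb coef_tens coef_expand) zgh (coset_sign tz zgh).
Qed.

Lemma labactM g h x : labact h (labact g x) = labact (h * g)%g x.
Proof. by apply/ffunP => i; rewrite !ffunE permM. Qed.

Lemma labact1 x : labact 1%g x = x.
Proof. by apply/ffunP => i; rewrite !ffunE perm1. Qed.

Lemma eta_family_equivariant z : triz z -> equivariant labact (eta_family z).
Proof.
move=> tz; split=> [x|g h x|g x]; [exact: labact1|exact: labactM|].
have [/existsP[h /eqP ->]|no] := boolP [exists h, x == labact h (label_word z)].
  by rewrite labactM !eta_familyE // (act_act hb coef_tens coef_expand).
have zero v : ~~ [exists h, v == labact h (label_word z)] -> eta_family z v = 0.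
  by move=> /existsPn n0; rewrite /eta_family; case: pickP => // h; rewrite (negPf (n0 h)).
rewrite !zero ?linear0 //; apply: contra no => /existsP[h /eqP E].
by apply/existsP; exists (g^-1 * h)%g; rewrite -labactM -E labactM mulVg labact1.
Qed.

Lemma eta_family_case z x : eta_family z x = 0 \/
  exists2 g, x = labact g (label_word z) & eta_family z x = act g (tw z).
Proof.
by rewrite /eta_family; case: pickP => [g /eqP ->|_]; [right; exists g | left].
Qed.

Lemma eta_moved z g i : triz z -> moved labact (labact g (label_word z)) i -> isa (z (g i)).1.1.
Proof.
move=> tz [h]; rewrite labactM => E hi.
have := congr1 (fun x : {ffun _ -> _} => x i) E; rewrite !ffunE /label permM.
have ne : g (h i) != g i by rewrite (inj_eq perm_inj).
case: ifP => _; case: ifP => nc //; first by case=> E'; rewrite E' eqxx in ne.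
case=> zE; have /forallP/(_ (g i))/forallP/(_ (g (h i)))/implyP := tz.
rewrite zE eq_sym ne eqxx => /(_ isT) ev; apply/negPn/negP => /(cb_split cb).
by rewrite nc /=; apply/negP.
Qed.

(** Both sides are invariant. At z, the nonzero terms on the right are those of the
    labels obtained by permuting places within [Kz z]. *)
Lemma eta_sum z : triz z -> eta z = \sum_x eta_family z x.
Proof.
move=> tz; have inv := equivariant_invariant (eta_family_equivariant tz).
have coef_z : coef z (\sum_x eta_family z x) = #|Kz z|%:R.
  rewrite linear_sum.
  have -> : \sum_x coef z (eta_family z x) = \sum_(x in [set labact g (label_word z) | g in Kz z]) 1.
    rewrite [RHS]big_mkcond; apply: eq_bigr => x _; case: imsetP => [[g gK ->]|no].
      have [zg sg] := Kz_stab gK.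
      by rewrite eta_familyE // (act_tw hb coef_tens coef_expand) linearZ /= (coef_tw hb coef_tens) zg eqxx sg mul1r.
    have [->|[g xg ->]] := eta_family_case z x; first by rewrite linear0.
    rewrite (act_tw hb coef_tens coef_expand) linearZ /= (coef_tw hb coef_tens).
    case: eqP => [zg|]; last by rewrite mulr0.
    have zgi i : z (g i) = z i by rewrite {2}zg ffunE.
    have inj : injective (fun i => if isc (z i).1.1 then g i else i).
      move=> i j /=; case: ifP => ci; case: ifP => cj // E; first exact: perm_inj E.
        by rewrite -E zgi ci in cj.
      by rewrite E zgi cj in ci.
    case: no; exists (perm inj).
      by apply/KzP => i; rewrite permE; case: ifP => ci; rewrite ?zgi ?eqxx.
    rewrite xg; apply/ffunP => i; rewrite !ffunE /label permE zgi; case: ifP => ci; rewrite ?zgi ?ci //.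
  rewrite sumr_const card_in_imset // => g h gK hK E; apply/permP => i.
  have [zg cg] := elimT (KzP _ _) gK i; have [zh ch] := elimT (KzP _ _) hK i.
  have := congr1 (fun x : {ffun _ -> _} => x i) E; rewrite !ffunE /label zg zh.
  case: ifP => [_ [//]|nc _].
  have fix_i (g0 : 'S_d) : (g0 i != i -> isc (z i).1.1) -> g0 i = i.
    by move=> h0; apply/eqP; apply: contraFT nc.
  by rewrite (fix_i g cg) (fix_i h ch).
apply: (coef_eq coef_expand) => y.
have [/existsP[g /eqP ->]|no] := boolP [exists g, y == wact z g].
  by rewrite eta_coef // invariant_coef // coef_z mulrC.
rewrite eta_Kz linearZ /= coef_xi_other ?mulr0 => [|g E]; last by case/existsP: no; exists g; rewrite E.
rewrite linear_sum big1 // => x _; have [->|[g _ ->]] := eta_family_case z x; first by rewrite linear0.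
rewrite (act_tw hb coef_tens coef_expand) linearZ /= (coef_tw hb coef_tens).
by case: eqP => [E|]; rewrite ?mulr0 //; case/existsP: no; exists g; rewrite E.
Qed.

(** The sets [at_ t] stand for a multiplicative filtration of A, later the preimages
    of the powers of the radical. A place that is moved must carry a matrix over a and
    has filtration degree 0; the other places may contribute positive degrees. *)
Section Filtration.
Variable at_ : nat -> set A.
Hypothesis at_sub : forall t, is_submodule (at_ t).
Hypothesis at0 : forall v, at_ 0 v.
Hypothesis at_mul : forall s t u v, at_ s u -> at_ t v -> at_ (s + t)%N (u * v).
Hypothesis at_not_isa : forall b : Bt, ~~ isa b -> at_ 1 (val b).

Definition over_a (M : mat A n) : Prop := forall l, cM cA l M != 0 -> isa l.1.1.

Definition filtered_pure (mv : 'I_d -> Prop) (t : nat) (u : TP) : Prop :=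
  exists (w : {ffun 'I_d -> mat A n}) (q : 'I_d -> deg) (tau : 'I_d -> nat),
  [/\ u = tens w, forall i, mat_grading gr (q i) (w i),
      forall i, mv i -> tau i = 0%N /\ over_a (w i),
      forall i r s, at_ (tau i) (w i r s) & (t <= \sum_i tau i)%N].

Definition filtered (t : nat) (u : TP) : Prop :=
  exists (Z : finType) (zact : 'S_d -> Z -> Z) (f : Z -> TP),
  [/\ equivariant zact f,
      forall x, Defs.span (filtered_pure (moved zact x) t) (f x) & u = \sum_x f x].

Lemma over_a_mul M N : over_a M -> over_a N -> over_a (mat_mul M N).
Proof.
move=> aM aN l; rewrite cME mxE linear_sum => nz.
have [j nj] : exists j, cA l.1.1 (M l.1.2 j * N j l.2) != 0.
  by apply/existsP; apply: contraNT nz => /existsPn no; rewrite big1 // => j _; apply/eqP/negPn/no.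
move: nj; rewrite (cA_mul hb) => nj.
have [b1] : exists b1, \sum_b2 cA b1 (M l.1.2 j) * cA b2 (N j l.2) * cA l.1.1 (val b1 * val b2) != 0.
  by apply/existsP; apply: contraNT nj => /existsPn no; rewrite big1 // => b _; apply/eqP/negPn/no.
move=> nb1; have [b2 nb2] : exists b2, cA b1 (M l.1.2 j) * cA b2 (N j l.2) * cA l.1.1 (val b1 * val b2) != 0.
  by apply/existsP; apply: contraNT nb1 => /existsPn no; rewrite big1 // => b _; apply/eqP/negPn/no.
move: nb2; rewrite !mulf_eq0 !negb_or => /andP[/andP[n1 n2] n3].
exact: (cb_isa_mul cb (aM (b1, l.1.2, j) n1) (aN (b2, j, l.2) n2) n3).
Qed.

Lemma filtered_pure_mul mv1 mv2 s t u v : filtered_pure mv1 s u -> filtered_pure mv2 t v ->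
  Defs.span (filtered_pure (fun i => mv1 i /\ mv2 i) (s + t)) (u * v).
Proof.
move=> [w1 [q1 [tau1 [-> g1 m1 a1 l1]]]] [w2 [q2 [tau2 [-> g2 m2 a2 l2]]]].
rewrite (tens_mul tensP g1 g2); apply: (submodZ _ (span_submod _)); apply: span_in.
exists [ffun i => mat_mul (w1 i) (w2 i)], (fun i => q1 i + q2 i), (fun i => (tau1 i + tau2 i)%N).
split=> //.
- by move=> i; rewrite ffunE; apply: (gr_mat_mul hb).
- move=> i [/m1[-> h1] /m2[-> h2]]; rewrite ffunE; split=> //; exact: over_a_mul.
- move=> i r c; rewrite ffunE mxE; apply: submod_sum => [|j _]; first exact: at_sub.
  by apply: at_mul.
- by rewrite big_split leq_add.
Qed.

Lemma filtered_mul s t u v : filtered s u -> filtered t v -> filtered (s + t) (u * v).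
Proof.
move=> [Z1 [a1 [f1 [e1 h1 ->]]]] [Z2 [a2 [f2 [e2 h2 ->]]]].
exists (Z1 * Z2)%type, (fun g (x : Z1 * Z2) => (a1 g x.1, a2 g x.2)), (fun x => f1 x.1 * f2 x.2).
split; [exact: equivariant_mul | move=> [x y] /= | exact: sum_mul].
set mv := moved _ _.
have sub : is_submodule (Defs.span (filtered_pure mv (s + t))) by apply: span_submod.
apply: (span_sub (P := fun u => Defs.span (filtered_pure mv (s + t)) (u * f2 y))) (h1 x).
  split=> [|c p q hp hq]; first by rewrite mul0r; case: sub.
  by rewrite mulrDl -scalerAl; apply: submodD => //; apply: submodZ.
move=> p hp; apply: (span_sub (P := fun u => Defs.span (filtered_pure mv (s + t)) (p * u))) (h2 y).
  split=> [|c p' q hp' hq]; first by rewrite mulr0; case: sub.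
  by rewrite mulrDr -scalerAr; apply: submodD => //; apply: submodZ.
move=> q hq; apply: (span_sub _ _ (filtered_pure_mul hp hq)) => // r [w [qq [tau [-> gw mw aw lw]]]].
apply: span_in; exists w, qq, tau; split=> // i [g [gx gy] gi]; apply: mw.
by split; exists g.
Qed.

Lemma filtered_eta (t : nat) z : triz z ->
  (t = 0 \/ (t = 1 /\ exists i, ~~ isa (z i).1.1))%N -> filtered t (eta z).
Proof.
move=> tz ht; exists {ffun 'I_d -> L + 'I_d}, labact, (eta_family z); split.
- exact: eta_family_equivariant.
- move=> x; have [->|[g xg ->]] := eta_family_case z x; first by case: (span_submod (filtered_pure (moved labact x) t)).
  rewrite (act_tw hb coef_tens coef_expand); apply: (submodZ _ (span_submod _)); apply: span_in.
  exists (words_of (letter_mx bv (n := n)) (wact z g)), (fun i => dg (wact z g i).1.1).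
  exists (fun i => if isa (wact z g i).1.1 then 0 else t)%N; split=> //.
  + exact: (gr_words hb).
  + move=> i; rewrite xg => /(eta_moved tz) ia; rewrite !ffunE ia; split=> // l.
    by rewrite (cM_letter hb); case: (l =P z (g i)) => [->|]; rewrite ?eqxx.
  + move=> i r s; rewrite !ffunE xi_matE; case: ifP => ia; first exact: at0.
    case: ifP => _; last by case: (at_sub t).
    by case: ht => [->|[-> _]]; [apply: at0 | apply: at_not_isa; rewrite ia].
  case: ht => [->|[-> [j nj]]] //; rewrite (bigD1 (g^-1%g j)) //= ffunE permKV.
  by rewrite (negPf nj) leq_addr.
- exact: eta_sum.
Qed.

Lemma filtered_even_moved mv t u i z : Defs.span (filtered_pure mv t) u -> mv i ->
  coef z u != 0 -> isa (z i).1.1.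
Proof.
move=> su mi; move: u su z.
suff h u : Defs.span (filtered_pure mv t) u -> forall z, coef z u != 0 -> isa (z i).1.1 by [].
apply: (span_sub (P := fun u => forall z, coef z u != 0 -> isa (z i).1.1)).
  split=> [z|c p q hp hq z]; first by rewrite linear0 eqxx.
  rewrite linearP /=; have [->|/hp//] := eqVneq (coef z p) 0.
  by rewrite mulr0 add0r => /hq.
move=> _ [w [q [tau [-> _ mw _ _]]]] z; rewrite coef_tens => /prodf_neq0/(_ i isT).
exact: (proj2 (mw i mi)).
Qed.

Lemma filtered_in_T t u : filtered t u -> Defs.span (etas gr X Y tens) u.
Proof.
move=> [Z [zact [f [ef hf ->]]]].
have em x i z : moved zact x i -> coef z (f x) != 0 -> isa (z i).1.1.
  by move=> mi; apply: filtered_even_moved (hf x) mi.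
have [//|//|//|c _ ->] := equivariant_sum_eta ef em (P := fun _ => True).
apply: submod_sum => [|z /andP[_ tz]]; first exact: span_submod.
apply: (submodZ _ (span_submod _)); apply: span_in; exists (zw z) => //.
exact/trizP.
Qed.

(** As soon as t exceeds d N, some place has degree above N. It matters that P holds
    for the coefficients of the eta's and not just for those of u: the factorials
    between the two may become zero in F. *)
Lemma filtered_vanish (P : k -> Prop) N t u :
  P 0 -> (forall c1 c2, P c1 -> P c2 -> P (c1 + c2)) -> (forall c1 c2, P c2 -> P (c1 * c2)) ->
  (forall b v, at_ N v -> P (cA b v)) -> (forall s v, at_ s.+1 v -> at_ s v) ->
  (d * N < t)%N -> filtered t u ->
  exists2 c : word -> k, forall z, P (c z) &
    u = \sum_(z | (canonical_word z == z) && triz z) c z *: eta z.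
Proof.
move=> P0 PD PZ PN at_dec lt [Z [zact [f [ef hf ->]]]].
have em x i z : moved zact x i -> coef z (f x) != 0 -> isa (z i).1.1.
  by move=> mi; apply: filtered_even_moved (hf x) mi.
apply: (equivariant_sum_eta ef em) => //.
move=> x z; apply: (span_sub (P := fun u => P (coef z u))) (hf x).
  split=> [|c p q hp hq]; first by rewrite linear0.
  by rewrite linearP; apply: PD => //; apply: PZ.
move=> _ [w [q [tau [-> _ _ aw lw]]]]; rewrite coef_tens.
have [i lti] : exists i, (N < tau i)%N.
  apply/existsP; apply: contraLR lt => /existsPn no; rewrite -leqNgt; apply: leq_trans lw _.
  have -> : (d * N = \sum_(i < d) N)%N by rewrite sum_nat_const card_ord.
  by apply: leq_sum => i _; rewrite leqNgt no.
have atN m s v : at_ (m + s)%N v -> at_ s v by elim: m => // m IH; rewrite addSn => /at_dec.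
have -> : \prod_j cM cA (z j) (w j) = (\prod_(j | j != i) cM cA (z j) (w j)) * cM cA (z i) (w i).
  by rewrite (bigD1 i) //= mulrC.
apply: PZ; rewrite cME; apply: PN.
by apply: (atN (tau i - N)%N); rewrite subnK ?(ltnW lti).
Qed.

Lemma filtered_one : filtered 0 1.
Proof.
have g1 (i : 'I_d) : mat_grading gr 0 ([ffun => 1%:M] i : mat A n) by rewrite ffunE; exact: (gr_mat1 hb).
exists unit, (fun _ => id), (fun _ => 1); split.
- split=> // g _; rewrite -(tens1 hb tensP coef_expand) (act_tens hb coef_tens coef_expand _ g1).
  have -> : odd_inv (par \o (fun _ : 'I_d => (0 : deg))) g = 0 by apply: odd_inv_eq0.
  by rewrite [sgn _]expr0 scale1r; congr tens; apply/ffunP => i; rewrite !ffunE.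
- move=> x; apply: span_in; exists [ffun => 1%:M], (fun _ => 0), (fun _ => 0%N); split=> //.
  + by rewrite (tens1 hb tensP coef_expand).
  + move=> i _; split=> // l; rewrite cME ffunE mxE; case: (l.1.2 == l.2); last by rewrite linear0 eqxx.
    exact: (cb_one cb).
- by rewrite big_const card_unit /= addr0.
Qed.

Definition Sym_tens (u : TP) : TP := \sum_(g : 'S_d) act g u.

Lemma filtered_Sym (w : {ffun 'I_d -> mat A n}) (q : 'I_d -> deg) : (forall i, mat_grading gr (q i) (w i)) ->
  filtered 0 (Sym_tens (tens w)).
Proof.
move=> gw; exists ('S_d : finType), (fun h g => (h * g)%g), (fun g => act g (tens w)); split=> //.
  split=> [g|g h x|g x]; [exact: mul1g | exact: mulgA | by rewrite (act_act hb coef_tens coef_expand)].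
move=> g; rewrite (act_tens hb coef_tens coef_expand _ gw); apply: (submodZ _ (span_submod _)).
apply: span_in; exists [ffun i => w (g i)], (q \o g), (fun _ => 0%N); split=> //.
- by move=> i; rewrite ffunE; apply: gw.
- move=> i [h hg hi]; have h1 : h = 1%g by apply: (mulIg g); rewrite hg mul1g.
  by rewrite h1 perm1 eqxx in hi.
Qed.
End Filtration.

Lemma Sym_sum (T : finType) (P : pred T) (f : T -> TP) :
  Sym_tens (\sum_(i | P i) f i) = \sum_(i | P i) Sym_tens (f i).
Proof.
rewrite /Sym_tens exchange_big; apply: eq_bigr => g _; exact: act_sum.
Qed.

Lemma SymZ c u : Sym_tens (c *: u) = c *: Sym_tens u.
Proof. by rewrite /Sym_tens scaler_sumr; apply: eq_bigr => g _; apply: actZ. Qed.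

Lemma Sym0 : Sym_tens 0 = 0.
Proof. by rewrite -[X in Sym_tens X](scale0r (0 : TP)) SymZ scale0r. Qed.

Lemma Sym_invariant u : invariant (Sym_tens u).
Proof.
move=> h; rewrite /Sym_tens act_sum [RHS](reindex_inj (@mulgI _ h)).
by apply: eq_bigr => g _; rewrite (act_act hb coef_tens coef_expand).
Qed.

Lemma invariant_mul_Sym t u : invariant t -> t * Sym_tens u = Sym_tens (t * u).
Proof.
move=> it; rewrite /Sym_tens mulr_sumr; apply: eq_bigr => g _.
by rewrite (act_mul hb tensP coef_tens coef_expand) it.
Qed.

Lemma Sym_mul u v : Sym_tens u * Sym_tens v = \sum_h Sym_tens (act h u * v).
Proof. by rewrite (invariant_mul_Sym _ (Sym_invariant u)) /Sym_tens mulr_suml -/(Sym_tens _) -Sym_sum. Qed.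

Lemma xi_mat_mul (a b : A) (r s s' t : 'I_n) :
  mat_mul (xi_mat a r s) (xi_mat b s' t) = if s == s' then xi_mat (k := k) (a * b) r t else 0.
Proof.
apply/matrixP => i j; rewrite mxE (bigD1 s) //= big1 ?addr0 => [|l nl]; last first.
  by rewrite xi_matE (negPf nl) andbF mul0r.
rewrite !xi_matE eqxx andbT; have [_|ne] := eqVneq s s'; last by rewrite mxE andFb mulr0.
rewrite xi_matE; case: (i == r); case: (j == t); by rewrite ?mul0r ?mulr0.
Qed.

Lemma gr_xi p (a : A) (r s : 'I_n) : gr p a -> mat_grading gr p (xi_mat (k := k) a r s).
Proof. by move=> ga i j; rewrite xi_matE; case: ifP => // _; case: (gr_submod hb p). Qed.

Lemma tens_zero (w : {ffun 'I_d -> mat A n}) i : w i = 0 -> tens w = 0.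
Proof.
move=> w0; apply: (coef_eq coef_expand) => z; rewrite coef_tens linear0.
have -> : \prod_j cM cA (z j) (w j) = cM cA (z i) (w i) * \prod_(j | j != i) cM cA (z j) (w j).
  by rewrite (bigD1 i).
by rewrite w0 linear0 mul0r.
Qed.

Hypothesis le_dn : (d <= n)%N.
Definition col (i : 'I_d) : 'I_n := widen_ord le_dn i.

Lemma col_inj : injective col.
Proof. by move=> i j /(congr1 val)/= /val_inj. Qed.

(** With the distinct columns 1, ..., d the orbit sums multiply like elements of
    the wreath product of A with the symmetric group. *)
Definition wreath (v : 'I_d -> A) (s : 'S_d) : TP :=
  Sym_tens (tens [ffun i => xi_mat (v i) (col (s i)) (col i)]).

Lemma wreathE v s : wreath v s = Sym_tens (tens [ffun i => xi_mat (v i) (col (s i)) (col i)]).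
Proof. by []. Qed.

Lemma wreath_mul (p q : 'I_d -> deg) v w s t :
  (forall i, gr (p i) (v i)) -> (forall i, gr (q i) (w i)) ->
  wreath v s * wreath w t =
  sgn (odd_inv (par \o p) t + swaps (par \o p \o t) (par \o q)) *:
    wreath (fun i => v (t i) * w i) (t * s)%g.
Proof.
move=> gv gw; rewrite Sym_mul.
have gx i : mat_grading gr (p i) ([ffun i => xi_mat (v i) (col (s i)) (col i)] i).
  by rewrite ffunE; apply: gr_xi.
have gy i : mat_grading gr (q i) ([ffun i => xi_mat (w i) (col (t i)) (col i)] i).
  by rewrite ffunE; apply: gr_xi.
have prod h : act h (tens [ffun i => xi_mat (v i) (col (s i)) (col i)]) *
    tens [ffun i => xi_mat (w i) (col (t i)) (col i)] =
    (sgn (odd_inv (par \o p) h) * sgn (swaps (par \o (p \o h)) (par \o q))) *: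
    tens [ffun i => mat_mul (xi_mat (v (h i)) (col (s (h i))) (col (h i))) (xi_mat (w i) (col (t i)) (col i))].
  rewrite (act_tens hb coef_tens coef_expand _ gx) -scalerAl.
  rewrite (@tens_mul _ _ _ _ _ _ _ tensP (p \o h) q) //; last by move=> i; rewrite ffunE; apply: gx.
  rewrite scalerA; congr (_ *: tens _); apply/ffunP => i; by rewrite !ffunE.
rewrite (bigD1 t) //= prod big1 ?addr0 => [|h nh].
  rewrite SymZ -sgnD; congr (_ *: Sym_tens (tens _)); apply/ffunP => i.
  by rewrite !ffunE xi_mat_mul eqxx permM.
have [i ni] := perm_neq nh.
rewrite prod (tens_zero (i := i)) ?scaler0 ?Sym0 // ffunE xi_mat_mul.
by rewrite (inj_eq col_inj) (negPf ni).
Qed.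

Definition frame (s : 'I_d -> 'I_n) : TP := tens [ffun i => xi_mat 1 (s i) (col i)].
Definition theta (s : 'I_d -> 'I_n) : TP := Sym_tens (frame s).

Lemma gr_frame (f g : 'I_d -> 'I_n) i : mat_grading gr 0 ([ffun i => xi_mat 1 (f i) (g i)] i : mat A n).
Proof. by rewrite ffunE; apply: gr_xi; exact: (gr1 hb). Qed.

Lemma swaps0l (p : 'I_d -> bool) : swaps (par \o (fun _ => (0 : deg))) p = 0.
Proof. exact: swaps_eq0. Qed.

Lemma swaps0r (p : 'I_d -> bool) : swaps p (par \o (fun _ => (0 : deg))) = 0.
Proof. by apply: swaps_eq0 => i j _; rewrite andbF. Qed.

Lemma tw_frame z s : tw z * frame s =
  if [forall i, (z i).2 == s i] then tw [ffun i => ((z i).1, col i)] else 0.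
Proof.
rewrite (tens_mul tensP (gr_words hb z) (gr_frame s col)) swaps0r scale1r.
case: ifP => [/forallP zs|/negbT/forallPn[i ni]].
  congr tens; apply/ffunP => i; rewrite !ffunE /letter_mx xi_mat_mul (zs i) mulr1 //.
by apply: (tens_zero (i := i)); rewrite !ffunE /letter_mx xi_mat_mul (negPf ni).
Qed.

Lemma mul_frame t s : t * frame s =
  \sum_(z : word | [forall i, (z i).2 == s i]) coef z t *: tw [ffun i => ((z i).1, col i)].
Proof.
rewrite {1}(coef_expand t) mulr_suml [RHS]big_mkcond; apply: eq_bigr => z _.
by rewrite -scalerAl tw_frame; case: ifP; rewrite ?scaler0.
Qed.

(** Right multiplication by [theta s] selects the words with column indices s and
    replaces these by 1, ..., d; as the new indices are distinct, only the identity
    permutation contributes. *)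
Lemma coef_theta t s z : invariant t -> (forall i, (z i).2 = col i) ->
  coef z (t * theta s) = coef [ffun i => ((z i).1, s i)] t.
Proof.
move=> it zc; rewrite invariant_mul_Sym // mul_frame /Sym_tens linear_sum (bigD1 1%g) //= (act1 _ coef_expand).
rewrite [X in _ + X]big1 ?addr0 => [|g ng].
  rewrite linear_sum (bigD1 [ffun i => ((z i).1, s i)]) /=; last by apply/forallP => i; rewrite ffunE.
  rewrite linearZ /= (coef_tw hb coef_tens).
  have -> : z == [ffun i => (([ffun i0 => ((z i0).1, s i0)] i).1, col i)].
    by apply/eqP/ffunP => i; rewrite !ffunE /= -zc; case: (z i).
  rewrite mulr1 big1 ?addr0 // => y /andP[/forallP ys ny]; rewrite linearZ /= (coef_tw hb coef_tens).
  case: eqP => [zy|]; last by rewrite mulr0.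
  case/eqP: ny; apply/ffunP => i; rewrite zy !ffunE /= -(eqP (ys i)); by case: (y i).
rewrite act_sum linear_sum big1 // => y _; rewrite actZ (act_tw hb coef_tens coef_expand).
rewrite !linearZ /= (coef_tw hb coef_tens); case: eqP => [zy|]; last by rewrite !mulr0.
case/eqP: ng; apply/permP => i; rewrite perm1; apply: col_inj.
by have := zc i; rewrite zy !ffunE.
Qed.

Lemma theta_col_tw z : theta col * tw z = \sum_(h : 'S_d | [forall i, (z i).1.2 == col (h i)]) tw z.
Proof.
rewrite /theta /Sym_tens mulr_suml [RHS]big_mkcond; apply: eq_bigr => h _.
rewrite (act_tens hb coef_tens coef_expand _ (gr_frame col col)).
have -> : odd_inv (par \o (fun _ : 'I_d => (0 : deg))) h = 0 by apply: odd_inv_eq0.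
rewrite [sgn _]expr0 scale1r.
rewrite (@tens_mul _ _ _ _ _ _ _ tensP (fun _ => 0) _ _ _ _ (gr_words hb z)); last by move=> i; have := gr_frame col col (h i); rewrite !ffunE.
rewrite swaps0l scale1r; case: ifP => [/forallP zs|/negbT/forallPn[i ni]].
  congr tens; apply/ffunP => i; rewrite !ffunE /letter_mx xi_mat_mul -(eqP (zs i)) eqxx mul1r //.
by apply: (tens_zero (i := i)); rewrite !ffunE /letter_mx xi_mat_mul eq_sym (negPf ni).
Qed.

Lemma theta_theta s : theta s * theta col = theta s.
Proof.
rewrite {1}/theta Sym_mul (bigD1 1%g) //= (act1 _ coef_expand) big1 ?addr0 => [|h nh].
  congr Sym_tens; rewrite (tens_mul tensP (gr_frame s col) (gr_frame col col)) swaps0r scale1r.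
  by congr tens; apply/ffunP => i; rewrite !ffunE xi_mat_mul eqxx mulr1.
rewrite (act_tens hb coef_tens coef_expand _ (gr_frame s col)) -scalerAl.
rewrite (@tens_mul _ _ _ _ _ _ _ tensP (fun _ => 0) _ _ _ _ (gr_frame col col)); last by move=> i; have := gr_frame s col (h i); rewrite !ffunE.
have [i ni] : exists i, h i != i.
  by have [i ni] := perm_neq nh; exists i; rewrite perm1 in ni.
rewrite (tens_zero (i := i)) ?scaler0 ?Sym0 // !ffunE xi_mat_mul.
by rewrite (inj_eq col_inj) (negPf ni).
Qed.

Definition wreath_word (b : {ffun 'I_d -> Bt}) (g : 'S_d) : word :=
  [ffun i => (b i, col (g i), col i)].

(** The two factors select the words whose row and column indices are permutations
    of 1, ..., d, and the symmetrization sorts the columns. *)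
Lemma corner_expand t : invariant t ->
  theta col * (t * theta col) =
  \sum_(g : 'S_d) \sum_(b : {ffun 'I_d -> Bt}) coef (wreath_word b g) t *: wreath (fun i => val (b i)) g.
Proof.
move=> it; rewrite (invariant_mul_Sym _ it) mul_frame Sym_sum mulr_sumr.
under eq_bigr => z _ do rewrite SymZ -scalerAr (invariant_mul_Sym _ (Sym_invariant (frame col))) -/(theta col) theta_col_tw Sym_sum scaler_sumr.
rewrite (exchange_big_dep xpredT) //=; apply: eq_bigr => g _.
rewrite (reindex_onto (fun b => wreath_word b g) (fun z : word => [ffun i => (z i).1.1])) /=; last first.
  move=> z /andP[/forallP zc /forallP zr]; apply/ffunP => i; rewrite !ffunE.
  move: (eqP (zc i)) (zr i); rewrite ffunE /= => <- /eqP <-; by case: (z i) => [[]].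
apply: eq_big => [b|b _].
  apply/andP; split; last by apply/eqP/ffunP => i; rewrite !ffunE.
  by apply/andP; split; apply/forallP => i; rewrite !ffunE /=.
by congr (_ *: Sym_tens (tens _)); apply/ffunP => i; rewrite !ffunE.
Qed.
End SchurAlgebraElements.

(** * Wreath products modulo nilpotents *)

Section WreathCorner.
Variables (F : fieldType) (A : algType F) (gr : deg -> set A).
Variables (disp : Order.disp_t) (I : finPOrderType disp) (Bt : finType).
Variables (bv : Bt -> A) (cA : Bt -> {scalar A}) (dg : Bt -> deg).
Variables (ix : Bt -> I) (e : I -> Bt).
Hypothesis hb : heredity_basis gr bv cA dg ix e.
Variables (d : nat) (C : lmodType F) (mulC : {bilinear C -> C -> C}).
Variable wb : 'S_d -> {ffun 'I_d -> Bt} -> C.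

Local Notation chi i := (cA (e i)).
Local Notation rad := (rad cA e).
Local Notation rad_pow := (rad_pow cA e).
Local Notation part := (part bv cA dg).
Implicit Types (g h s : 'S_d) (v w : 'I_d -> A).

(** The multilinear extension of a family that is indexed by a permutation and a word
    of basis vectors. *)
Definition wr g v : C := \sum_(b : {ffun 'I_d -> Bt}) (\prod_i cA (b i) (v i)) *: wb g b.

Lemma eq_wr g v w : v =1 w -> wr g v = wr g w.
Proof. by move=> vw; apply: eq_bigr => b _; congr (_ *: _); apply: eq_bigr => i _; rewrite vw. Qed.

Lemma wr_basis g (b : {ffun 'I_d -> Bt}) : wr g (fun i => bv (b i)) = wb g b.
Proof.
rewrite /wr (bigD1 b) //= [X in X *: _]big1 => [|i _]; last by rewrite (hb_coord hb) eqxx.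
rewrite scale1r big1 ?addr0 // => b' nb.
have [i ni] := ffun_neq nb.
by rewrite (bigD1 i) //= (hb_coord hb) (negPf ni) mul0r scale0r.
Qed.

Lemma wr_zero g v i : v i = 0 -> wr g v = 0.
Proof.
move=> v0; apply: big1 => b _.
by rewrite (bigD1 i) //= v0 linear0 mul0r scale0r.
Qed.

Lemma wr_expand (J : finType) g (a : 'I_d -> J -> F) (u : 'I_d -> J -> A) :
  wr g (fun i => \sum_j a i j *: u i j) =
  \sum_(t : {ffun 'I_d -> J}) (\prod_i a i (t i)) *: wr g (fun i => u i (t i)).
Proof.
rewrite /wr; under [RHS]eq_bigr do rewrite scaler_sumr.
rewrite exchange_big; apply: eq_bigr => b _ /=.
under [RHS]eq_bigr do rewrite scalerA; rewrite -scaler_suml; congr (_ *: _).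
under eq_bigr => i _ do rewrite linear_sum; rewrite bigA_distr_bigA.
by apply: eq_bigr => t _; rewrite -big_split; apply: eq_bigr => i _; rewrite linearZ.
Qed.

Hypothesis wr_mul : forall (p q : 'I_d -> deg) g h v w,
  (forall i, gr (p i) (v i)) -> (forall i, gr (q i) (w i)) ->
  mulC (wr g v) (wr h w) =
  sgn F (odd_inv (par \o p) h + swaps (par \o p \o h) (par \o q)) *:
    wr (h * g)%g (fun i => v (h i) * w i).

Local Notation one := (wr 1%g (fun => 1)).

Lemma wr_one_l (q : 'I_d -> deg) g v : (forall i, gr (q i) (v i)) -> mulC one (wr g v) = wr g v.
Proof.
move=> gv; rewrite (wr_mul _ _ (p := fun => 0) _ gv) => [|i]; last exact: (gr1 hb).
rewrite odd_inv_eq0 // swaps_eq0 // scale1r mulg1.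
by apply: eq_wr => i; rewrite mul1r.
Qed.

Lemma wr_one_r (q : 'I_d -> deg) g v : (forall i, gr (q i) (v i)) -> mulC (wr g v) one = wr g v.
Proof.
move=> gv; rewrite (wr_mul _ _ (q := fun => 0) gv) => [|i]; last exact: (gr1 hb).
rewrite odd_inv1 swaps_eq0 ?scale1r ?mul1g => [|i j _]; last by rewrite andbF.
by apply: eq_wr => i; rewrite mulr1 perm1.
Qed.

(** The filtration by the total power of the radical over all places, which is zero
    from degree d * nilbound + 1 on. *)
Definition filW t : set C := Defs.span (fun x => exists s v (q : 'I_d -> deg) (tau : 'I_d -> nat),
  [/\ x = wr s v, forall i, gr (q i) (v i), forall i, rad_pow (tau i) (v i)
    & (t <= \sum_i tau i)%N]).

Lemma filW_sub t : is_submodule (filW t). Proof. exact: span_submod. Qed.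

Lemma filW_mul t t' x y : filW t x -> filW t' y -> filW (t + t')%N (mulC x y).
Proof.
have [W0 WZ] := filW_sub (t + t')%N.
move=> hx hy; apply: (span_sub (P := fun x => filW (t + t')%N (mulC x y))) hx => [|_ [g [v [p [tau [-> gv rv lt]]]]]].
  by split=> [|c x1 x2 h1 h2]; [rewrite linear0l | rewrite linearPl; apply: WZ].
apply: (span_sub (P := fun y => filW (t + t')%N (mulC (wr g v) y))) hy => [|_ [h [w [q [tau' [-> gw rw lt']]]]]].
  by split=> [|c x1 x2 h1 h2]; [rewrite linear0r | rewrite linearPr; apply: WZ].
rewrite (wr_mul _ _ gv gw); apply: (submodZ _ (filW_sub _)); apply: span_in.
exists (h * g)%g, (fun i => v (h i) * w i), (fun i => p (h i) + q i), (fun i => tau (h i) + tau' i)%N.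
split=> //.
- by move=> i; apply: (gr_mul hb).
- by move=> i; apply: rad_pow_mul.
rewrite big_split leq_add //=; by rewrite (reindex_inj (@perm_inj _ h)) in lt.
Qed.

Lemma filW_zero t x : (d * nilbound I < t)%N -> filW t x -> x = 0.
Proof.
move=> lt; apply: (span_sub (P := fun x => x = 0)) => [|_ [s [v [q [tau [-> _ rv le]]]]]].
  by split=> // c x1 x2 -> ->; rewrite scaler0 addr0.
have [i lti] : exists i, (nilbound I < tau i)%N.
  apply/existsP; apply: contraLR lt => /existsPn no; rewrite -leqNgt; apply: leq_trans le _.
  have -> : (d * nilbound I = \sum_(i < d) nilbound I)%N by rewrite sum_nat_const card_ord.
  by apply: leq_sum => i _; rewrite leqNgt no.
by apply: (@wr_zero _ _ i); apply: (rad_pow_nil hb (ltnW lti)).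
Qed.

(** The entries need not be homogeneous, as their components stay in the radical. *)
Lemma filW_wr t s v (tau : pred 'I_d) : (forall i, tau i -> rad (v i)) ->
  (t <= \sum_i tau i)%N -> filW t (wr s v).
Proof.
move=> rv le; pose D := degs dg.
have vE i : v i = \sum_(j < size D) 1 *: part (nth 0 D j) (v i).
  rewrite {1}(part_sum hb (v i)) (big_nth 0) big_mkord.
  by apply: eq_bigr => j _; rewrite scale1r.
rewrite (eq_wr s vE) wr_expand; apply: submod_sum => [|t' _]; first exact: filW_sub.
apply: (submodZ _ (filW_sub _)); apply: span_in.
exists s, (fun i => part (nth 0 D (t' i)) (v i)), (fun i => nth 0 D (t' i)), (fun i => tau i : nat).
split=> // i; first exact: (gr_part hb).
have [/rv r|_] := boolP (tau i); last exact: rad_pow0.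
by apply/rad_pow1/(rad_part hb).
Qed.

Variable cW : 'S_d -> {ffun 'I_d -> Bt} -> {scalar C}.
Hypothesis cW_coord : forall g b h b', cW g b (wb h b') = ((g == h) && (b == b'))%:R.

Lemma cW_wr s b g v : cW s b (wr g v) = (s == g)%:R * \prod_i cA (b i) (v i).
Proof.
rewrite /wr linear_sum (bigD1 b) //= [X in _ + X]big1 ?addr0 => [|b' nb].
  by rewrite linearZ /= cW_coord eqxx andbT mulrC.
by rewrite linearZ /= cW_coord (eq_sym b) (negPf nb) andbF mulr0.
Qed.

Definition spanned (x : C) := x = \sum_s \sum_b cW s b x *: wb s b.

Lemma spanned_sum (c : 'S_d -> {ffun 'I_d -> Bt} -> F) : spanned (\sum_s \sum_b c s b *: wb s b).
Proof.
apply: eq_bigr => s _; apply: eq_bigr => b _; congr (_ *: _).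
rewrite linear_sum (bigD1 s) //= linear_sum (bigD1 b) //= linearZ /= cW_coord !eqxx mulr1.
rewrite !big1 ?addr0 // => [h nh|b' nb].
  by rewrite linear_sum big1 // => b' _; rewrite linearZ /= cW_coord eq_sym (negPf nh) mulr0.
by rewrite linearZ /= cW_coord (eq_sym b) (negPf nb) andbF mulr0.
Qed.

Lemma spanned_wr g v : spanned (wr g v).
Proof.
rewrite /spanned (bigD1 g) //= [X in _ + X]big1 ?addr0 => [|h nh].
  by apply: eq_bigr => b _; rewrite cW_wr eqxx mul1r.
by apply: big1 => b _; rewrite cW_wr (negPf nh) mul0r scale0r.
Qed.

(** A functional is applied at every place of the part of x at the permutation s. *)
Definition Psi s (hs : 'I_d -> {scalar A}) (x : C) : F :=
  \sum_(b : {ffun 'I_d -> Bt}) (\prod_i hs i (bv (b i))) * cW s b x.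

Lemma Psi_linear s hs : scalar (Psi s hs).
Proof.
move=> c x y; rewrite mulr_sumr -big_split; apply: eq_bigr => b _ /=.
by rewrite linearP mulrDr mulrCA.
Qed.
HB.instance Definition _ s hs := GRing.isLinear.Build F C F _ (Psi s hs) (Psi_linear s hs).

Lemma Psi_wr s hs g v : Psi s hs (wr g v) = (s == g)%:R * \prod_i hs i (v i).
Proof.
rewrite /Psi; under [LHS]eq_bigr => b _ do rewrite cW_wr mulrCA -big_split /=.
rewrite -mulr_sumr; congr (_ * _).
under [RHS]eq_bigr => i _ do rewrite {1}(hb_expand hb (v i)) linear_sum.
rewrite bigA_distr_bigA; apply: eq_bigr => b _; apply: eq_bigr => i _.
by rewrite linearZ /= mulrC.
Qed.

(** Applying functionals at all places but l leaves an element of A. *)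
Definition slot s (hs : 'I_d -> {scalar A}) l (x : C) : A :=
  \sum_(b : {ffun 'I_d -> Bt}) (\prod_(i | i != l) hs i (bv (b i)) * cW s b x) *: bv (b l).

Definition upd (hs : 'I_d -> {scalar A}) l (f : {scalar A}) : 'I_d -> {scalar A} :=
  fun i => if i == l then f else hs i.

Lemma prod_upd hs l f v : \prod_i upd hs l f i (v i) = f (v l) * \prod_(i | i != l) hs i (v i).
Proof.
rewrite (bigD1 l) //= /upd eqxx; congr (_ * _).
by apply: eq_bigr => i /negPf->.
Qed.

Lemma slotE s hs l (f : {scalar A}) x : f (slot s hs l x) = Psi s (upd hs l f) x.
Proof.
rewrite linear_sum; apply: eq_bigr => b _.
by rewrite linearZ /= (prod_upd hs l f (fun i => bv (b i))) mulrC mulrA.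
Qed.

Definition at_place l (u : A) : 'I_d -> A := fun i => if i == l then u else 1.
Definition deg_place l (p : deg) : 'I_d -> deg := fun i => if i == l then p else 0.
Local Notation single l u := (wr 1%g (at_place l u)).

Lemma gr_place l p u : gr p u -> forall i, gr (deg_place l p i) (at_place l u i).
Proof. by move=> gu i; rewrite /deg_place /at_place; case: ifP => // _; exact: (gr1 hb). Qed.

Definition kills_rad (f : {scalar A}) := forall u, rad u -> f u = 0.

Lemma swaps_single l (p q : 'I_d -> bool) :
  (forall i, i != l -> p i = false) -> (forall i, i != l -> q i = false) -> swaps p q = 0.
Proof.
move=> pl ql; apply: swaps_eq0 => i j ij; case: (eqVneq j l) => [jl|/pl-> //].
by rewrite ql ?andbF //; apply: contraTneq ij => ->; rewrite jl ltnn.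
Qed.

Lemma Psi_single_mul s hs j p u x : spanned x -> gr p u ->
  Psi s hs (mulC (single j u) x) =
  \sum_b cW s b x * (sgn F (odd_inv (par \o deg_place j p) s +
      swaps (par \o deg_place j p \o s) (par \o (fun i => dg (b i)))) *
    \prod_i hs i (at_place j u (s i) * bv (b i))).
Proof.
move=> sx gu; rewrite {1}sx linear_sumr linear_sum (bigD1 s) //=.
have E h b : mulC (single j u) (wb h b) =
   sgn F (odd_inv (par \o deg_place j p) h +
      swaps (par \o deg_place j p \o h) (par \o (fun i => dg (b i)))) *:
     wr h (fun i => at_place j u (h i) * bv (b i)).
  have gb i : gr (dg (b i)) (bv (b i)) := gr_bv hb (b i).
  by rewrite -wr_basis (wr_mul 1%g h (gr_place j gu) gb) mulg1.
rewrite [X in _ + X]big1 ?addr0 => [|h nh].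
  rewrite linear_sumr linear_sum; apply: eq_bigr => b _.
  by rewrite linearZr_LR linearZ /= E linearZ /= Psi_wr eqxx mul1r.
rewrite linear_sumr linear_sum big1 // => b _.
by rewrite linearZr_LR linearZ /= E linearZ /= Psi_wr eq_sym (negPf nh) mul0r !mulr0.
Qed.

Lemma Psi_mul_single s hs j p u x : spanned x -> gr p u ->
  Psi s hs (mulC x (single j u)) =
  \sum_b cW s b x * (sgn F (swaps (par \o (fun i => dg (b i))) (par \o deg_place j p)) *
    \prod_i hs i (bv (b i) * at_place j u i)).
Proof.
move=> sx gu; rewrite {1}sx linear_sumlz linear_sum (bigD1 s) //=.
have E h b : mulC (wb h b) (single j u) =
   sgn F (swaps (par \o (fun i => dg (b i))) (par \o deg_place j p)) *:
     wr h (fun i => bv (b i) * at_place j u i).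
  have gb i : gr (dg (b i)) (bv (b i)) := gr_bv hb (b i).
  rewrite -wr_basis (wr_mul h 1%g gb (gr_place j gu)).
  rewrite mul1g odd_inv1 add0r; congr (sgn F (swaps _ _) *: _); last by apply: eq_wr => i; rewrite perm1.
  by apply/funext => i; rewrite /= perm1.
rewrite [X in _ + X]big1 ?addr0 => [|h nh].
  rewrite linear_sumlz linear_sum; apply: eq_bigr => b _.
  by rewrite linearZl_LR linearZ /= E linearZ /= Psi_wr eqxx mul1r.
rewrite linear_sumlz linear_sum big1 // => b _.
by rewrite linearZl_LR linearZ /= E linearZ /= Psi_wr eq_sym (negPf nh) mul0r !mulr0.
Qed.

Hypothesis oddJ : forall x, parity_part gr 1 x -> jacobson_radical x.

Lemma kills_odd (f : {scalar A}) b : kills_rad f -> f (bv b) != 0 -> par (dg b) = false.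
Proof.
move=> kf; apply: contraNF => /eqP od; rewrite kf //.
apply: (odd_rad hb oddJ (m := (dg b).1)).
by rewrite -od; have := gr_bv hb b; case: (dg b).
Qed.

Section Slot.
Variables (s : 'S_d) (hs : 'I_d -> {scalar A}) (l : 'I_d) (x : C).
Hypotheses (hs_rad : forall i, i != l -> kills_rad (hs i)) (sx : spanned x).

Lemma hs_even (b : {ffun 'I_d -> Bt}) : \prod_(i | i != l) hs i (bv (b i)) != 0 ->
  forall i, i != l -> par (dg (b i)) = false.
Proof. by move=> /prodf_neq0 nz i il; apply: (kills_odd (hs_rad il)); apply: nz. Qed.

(** The functionals at the other places kill the radical, hence all odd basis vectors;
    this makes the sign independent of the word, and it can be taken out of the sum. *)
Lemma Psi_single_slot (f : {scalar A}) p u : gr p u ->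
  Psi s (upd hs l f) (mulC (single (s l) u) x) =
  sgn F (odd_inv (par \o deg_place (s l) p) s) * f (u * slot s hs l x).
Proof.
move=> gu; rewrite (Psi_single_mul _ _ _ sx gu) mulr_sumr linear_sum mulr_sumr.
apply: eq_bigr => b _; rewrite (prod_upd _ _ _ (fun i => at_place (s l) u (s i) * bv (b i))).
rewrite -scalerAr linearZ /= {1}/at_place eqxx.
have -> : \prod_(i | i != l) hs i (at_place (s l) u (s i) * bv (b i)) = \prod_(i | i != l) hs i (bv (b i)).
  by apply: eq_bigr => i il; rewrite /at_place (inj_eq perm_inj) (negPf il) mul1r.
have [->|nz] := eqVneq (\prod_(i | i != l) hs i (bv (b i))) 0; first by rewrite !(mulr0, mul0r).
rewrite (@swaps_single l) ?addr0 => [|i il|i il].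
- by rewrite mulrCA; congr (_ * _); rewrite mulrCA [RHS]mulrC [X in _ = _ * X]mulrC.
- by rewrite /= /deg_place (inj_eq perm_inj) (negPf il).
- exact: hs_even.
Qed.

Lemma Psi_slot_single (f : {scalar A}) p u : gr p u ->
  Psi s (upd hs l f) (mulC x (single l u)) = f (slot s hs l x * u).
Proof.
move=> gu; rewrite (Psi_mul_single _ _ _ sx gu) mulr_suml linear_sum.
apply: eq_bigr => b _; rewrite (prod_upd _ _ _ (fun i => bv (b i) * at_place l u i)).
rewrite -scalerAl linearZ /= {1}/at_place eqxx.
have -> : \prod_(i | i != l) hs i (bv (b i) * at_place l u i) = \prod_(i | i != l) hs i (bv (b i)).
  by apply: eq_bigr => i il; rewrite /at_place (negPf il) mulr1.
have [->|nz] := eqVneq (\prod_(i | i != l) hs i (bv (b i))) 0; first by rewrite !(mulr0, mul0r).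
rewrite (@swaps_single l) => [|i il|i il].
- by rewrite mul1r mulrCA [RHS]mulrC [X in _ = _ * X]mulrC.
- exact: hs_even.
- by rewrite /= /deg_place (negPf il).
Qed.

Lemma Psi_single_rad (f : {scalar A}) j p u : s l != j -> gr p u -> rad u ->
  Psi s (upd hs l f) (mulC (single j u) x) = 0.
Proof.
move=> ne gu ru; rewrite (Psi_single_mul _ _ _ sx gu) big1 // => b _.
have jl : s^-1%g j != l by apply: contra ne => /eqP <-; rewrite permKV.
rewrite (prod_upd _ _ _ (fun i => at_place j u (s i) * bv (b i))) (bigD1 (s^-1%g j)) //=.
rewrite /at_place permKV eqxx (hs_rad jl) ?(mul0r, mulr0) //.
exact: (proj2 (rad_mul _ ru)).
Qed.

Lemma Psi_rad_single (f : {scalar A}) j p u : l != j -> gr p u -> rad u ->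
  Psi s (upd hs l f) (mulC x (single j u)) = 0.
Proof.
move=> ne gu ru; rewrite (Psi_mul_single _ _ _ sx gu) big1 // => b _.
have jl : j != l by rewrite eq_sym.
rewrite (prod_upd _ _ _ (fun i => bv (b i) * at_place j u i)) (bigD1 j) //=.
rewrite /at_place eqxx (hs_rad jl) ?(mul0r, mulr0) //.
exact: (proj1 (rad_mul _ ru)).
Qed.

Hypothesis x_comm : forall j p u, gr p u -> mulC (single j u) x = mulC x (single j u).

(** An element u of the radical placed at s l on the left of x reaches the slot l; on
    the right of x it stays at the place s l <> l, where the functional kills it. The
    two products agree, so u annihilates the slot, and dually on the other side. *)
Lemma slot_annihilates : s l != l -> annihilates_rad cA e (slot s hs l x).
Proof.
move=> sl.
have hom p u : gr p u -> rad u -> u * slot s hs l x = 0 /\ slot s hs l x * u = 0.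
  move=> gu ru; split; apply: (cA_ext hb) => b; rewrite linear0.
    have ls : l != s l by rewrite eq_sym.
    have := Psi_single_slot (cA b) gu; rewrite (x_comm _ gu) (Psi_rad_single _ ls gu ru).
    by move/esym/eqP; rewrite mulf_eq0 signr_eq0 => /eqP.
  by rewrite -(Psi_slot_single (cA b) gu) -(x_comm _ gu) (Psi_single_rad _ sl gu ru).
move=> u ru; move: (slot s hs l x) hom => y hom.
rewrite (part_sum hb u) mulr_suml mulr_sumr; by split; apply: big1 => p _; have [h1 h2] := hom _ _ (gr_part hb p u) (rad_part hb p ru).
Qed.

(** For the identity permutation both products reach the slot. *)
Lemma slot_central : s = 1%g -> forall u, slot s hs l x * u = u * slot s hs l x.
Proof.
move=> s1; have hom p u : gr p u -> slot s hs l x * u = u * slot s hs l x.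
  move=> gu; apply: (cA_ext hb) => b.
  rewrite -(Psi_slot_single (cA b) gu) -(x_comm _ gu).
  have := Psi_single_slot (cA b) gu.
  have -> : s l = l by rewrite s1 perm1.
  by rewrite odd_inv_eq0 ?mul1r // => i; rewrite s1 perm1 eqxx.
move=> u; move: (slot s hs l x) hom => y hom.
rewrite (part_sum hb u) mulr_suml mulr_sumr; apply: eq_bigr => p _.
exact: (hom _ _ (gr_part hb p u)).
Qed.
End Slot.

Hypothesis indecA : indecomposable *%R gr.
Variables (i0 i1 : I).
Hypothesis i01 : i0 != i1.

Lemma mcoef_linear (t : I * Bt * Bt) : scalar (fun v : A => chi t.1.1 (bv t.1.2 * v * bv t.2)).
Proof. by move=> c u v; rewrite mulrDr mulrDl -scalerAr -scalerAl linearP. Qed.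

(** Matrix coefficients of the simple modules of A. *)
Definition mcoef t : {scalar A} := locked (mk_scalar (mcoef_linear t)).

Lemma mcoefE i b1 b2 (v : A) : mcoef (i, b1, b2) v = chi i (bv b1 * v * bv b2).
Proof. by rewrite /mcoef -lock. Qed.

Lemma mcoef_rad t : kills_rad (mcoef t).
Proof. by case: t => [[i b1] b2] u ru; rewrite mcoefE. Qed.

Lemma rad_mcoef u : (forall t, mcoef t u = 0) -> rad u.
Proof. by move=> h i; apply: (chi_basis hb) => b1 b2; rewrite -mcoefE. Qed.

Definition unit_mcoef : I * Bt * Bt := (i0, e i0, e i0).

Lemma mcoef_unit u : mcoef unit_mcoef u = chi i0 u.
Proof. by rewrite mcoefE (chi_er hb) (chi_el hb). Qed.

Lemma mcoef_central u : (forall v : A, u * v = v * u) -> forall t, mcoef t u = mcoef t 1 * mcoef unit_mcoef u.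
Proof.
move=> cu [[i b1] b2]; rewrite mcoef_unit !mcoefE mulr1 -mulrA cu mulrA.
rewrite (chi_mul_central hb); last by move=> v; rewrite cu.
by rewrite (central_char hb indecA cu i i0).
Qed.

(** A vector with the same matrix coefficients as v, built from them alone. *)
Lemma rad_projection : exists K : I * Bt * Bt -> Bt -> F, forall v : A,
  rad (v - \sum_t \sum_b (mcoef t v * K t b) *: bv b).
Proof.
have [K KE] := generalized_inverse (fun b t => mcoef t (bv b)).
exists K => v; apply: rad_mcoef => t; rewrite linearB /=; apply/eqP; rewrite subr_eq0; apply/eqP.
rewrite linear_sum {1}(hb_expand hb v). rewrite linear_sum.
under [RHS]eq_bigr => t' _ do rewrite linear_sum.
transitivity (\sum_b cA b v * \sum_t' \sum_b' mcoef t' (bv b) * K t' b' * mcoef t (bv b')).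
  by apply: eq_bigr => b _; rewrite linearZ /= KE.
under [LHS]eq_bigr => b _ do rewrite mulr_sumr; rewrite exchange_big; apply: eq_bigr => t' _ /=.
under [LHS]eq_bigr => b _ do rewrite mulr_sumr; rewrite exchange_big; apply: eq_bigr => b' _ /=.
rewrite linearZ /= {2}(hb_expand hb v) linear_sum !mulr_suml.
by apply: eq_bigr => b _; rewrite linearZ /= !mulrA.
Qed.

(** Replacing every entry by the vector that [rad_projection] builds from its matrix
    coefficients gives 0, and the difference has an entry in the radical. *)
Lemma filW_of_Psi x : spanned x -> (forall s t, Psi s (fun i => mcoef (t i)) x = 0) -> filW 1 x.
Proof.
move=> sx h; have [K KE] := rad_projection.
pose pr (v : A) := \sum_(tb : (I * Bt * Bt) * Bt) (mcoef tb.1 v * K tb.1 tb.2) *: bv tb.2.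
have prE (v : A) : rad (v - pr v).
  have -> : pr v = \sum_t \sum_b (mcoef t v * K t b) *: bv b by rewrite pair_bigA.
  exact: KE.
rewrite sx; apply: submod_sum => [|s _]; first exact: filW_sub.
have zero : \sum_(b : {ffun 'I_d -> Bt}) cW s b x *: wr s (fun i => pr (bv (b i))) = 0.
  under eq_bigr => b _ do rewrite wr_expand scaler_sumr.
  rewrite exchange_big big1 // => t _ /=.
  under eq_bigr => b _ do rewrite big_split /= scalerA mulrA [cW s b x * _]mulrC.
  rewrite -scaler_suml -mulr_suml.
  by have := h s (fun i => (t i).1); rewrite /Psi => ->; rewrite mul0r scale0r.
have -> : \sum_(b : {ffun 'I_d -> Bt}) cW s b x *: wb s b =
    \sum_b (cW s b x *: wb s b - cW s b x *: wr s (fun i => pr (bv (b i)))).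
  by rewrite sumrB zero subr0.
apply: submod_sum => [|b _]; first exact: filW_sub.
rewrite -scalerBr; apply: (submodZ _ (filW_sub _)); rewrite -wr_basis.
pose cut i (c : bool) := if c then pr (bv (b i)) else bv (b i) - pr (bv (b i)).
have bE i : bv (b i) = \sum_(c : bool) 1 *: cut i c.
  by rewrite big_bool /= !scale1r addrC subrK.
rewrite (eq_wr s bE) wr_expand (bigD1 [ffun => true]) //= big1 ?scale1r => [|i _ //].
have -> : wr s (fun i => cut i ([ffun => true] i)) = wr s (fun i => pr (bv (b i))).
  by apply: eq_wr => i; rewrite ffunE.
rewrite addrAC subrr add0r; apply: submod_sum => [|t nt]; first exact: filW_sub.
rewrite scale1r; have [i ti] : exists i, t i = false.
  apply: contrapT => no; case/eqP: nt; apply/ffunP => i; rewrite ffunE.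
  by apply/negPn/negP => /negPf ti; apply: no; exists i.
apply: (@filW_wr _ _ _ [pred i | ~~ t i]) => [j /negPf tj|]; first by rewrite /cut tj; apply: prE.
by rewrite (bigD1 i) //= ti.
Qed.

Section Corner.
Variable x : C.
Hypothesis sx : spanned x.
Hypothesis x_comm : forall j p u, gr p u -> mulC (single j u) x = mulC x (single j u).

Lemma Psi_off_diagonal s t : s != 1%g -> Psi s (fun i => mcoef (t i)) x = 0.
Proof.
move=> s1; have [l sl] : exists l, s l != l.
  by have [i ni] := perm_neq s1; exists i; rewrite perm1 in ni.
have hr i : i != l -> kills_rad (mcoef (t i)) by move=> _; apply: mcoef_rad.
have := slot_annihilates hr sx x_comm sl.
move=> /(ann_sub_rad hb indecA i01)/(@mcoef_rad (t l)); rewrite slotE => <-.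
by congr (Psi s _ x); apply/funext => i; rewrite /upd; case: eqP => [->|].
Qed.

(** The slots are central, so the matrix coefficient can be exchanged for the one of
    a fixed label at one place after the other. *)
Lemma Psi_diagonal t : Psi 1%g (fun i => mcoef (t i)) x =
  (\prod_i mcoef (t i) 1) * Psi 1%g (fun => mcoef unit_mcoef) x.
Proof.
pose hs m (i : 'I_d) := if (i < m)%N then mcoef (t i) else mcoef unit_mcoef.
have step m : (m <= d)%N -> Psi 1%g (hs m) x =
    (\prod_(i < d | (i < m)%N) mcoef (t i) 1) * Psi 1%g (fun => mcoef unit_mcoef) x.
  elim: m => [_|m IH lt]; first by rewrite big_pred0 ?mul1r // => i; rewrite ltn0.
  pose l := Ordinal lt.
  have hr i : i != l -> kills_rad (hs m i) by move=> _; rewrite /hs; case: ifP => _; apply: mcoef_rad.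
  have hu : hs m.+1 = upd (hs m) l (mcoef (t l)).
    apply/funext => i; rewrite /upd /hs ltnS leq_eqVlt -(inj_eq val_inj) /=.
    by case: eqVneq => [E|//]; congr (mcoef (t _)); apply: val_inj.
  have hu0 : hs m = upd (hs m) l (mcoef unit_mcoef).
    by apply/funext => i; rewrite /upd; case: eqP => [->|//]; rewrite /hs ltnn.
  rewrite hu -slotE (mcoef_central (slot_central hr sx x_comm erefl)) slotE -hu0.
  rewrite IH ?(ltnW lt) // mulrA; congr (_ * _).
  rewrite [RHS](bigD1 l) ?ltnSn //=; congr (_ * _); apply: eq_bigl => i.
  by rewrite -(inj_eq val_inj) /= ltnS ltn_neqAle andbC.
rewrite -[LHS]/(Psi _ _ _) -(_ : hs d = fun i => mcoef (t i)); last first.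
  by apply/funext => i; rewrite /hs ltn_ord.
by rewrite step //; congr (_ * _); apply: eq_bigl => i; rewrite ltn_ord.
Qed.

Lemma corner_scalar : exists c, filW 1 (x - c *: one).
Proof.
have s1 := spanned_wr 1%g (fun => 1); exists (Psi 1%g (fun => mcoef unit_mcoef) x); set c := Psi _ _ _.
apply: filW_of_Psi => [|s t].
  rewrite /spanned {1}sx {1}s1 scaler_sumr -sumrB; apply: eq_bigr => s _.
  rewrite scaler_sumr -sumrB; apply: eq_bigr => b _.
  have -> : cW s b (x - c *: one) = cW s b x - c * cW s b (one).
    by rewrite linearB linearZ.
  by rewrite scalerBl scalerA.
rewrite linearB linearZ /= Psi_wr; have [->|ne] := eqVneq s 1%g.
  by rewrite Psi_diagonal mul1r -/c mulrC subrr.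
by rewrite Psi_off_diagonal // mul0r mulr0 subrr.
Qed.
End Corner.

(** Write x as c times the unit plus a nilpotent r. If c = 0, the idempotent x is
    nilpotent; if not, 0 = x y gives y = - c^-1 r y. *)
Lemma wr_corner_indecomposable x y : spanned x ->
  (forall j p u, gr p u -> mulC (single j u) x = mulC x (single j u)) ->
  x + y = one -> mulC x x = x -> mulC x y = 0 ->
  mulC (one) y = y -> x = 0 \/ y = 0.
Proof.
have s1 := spanned_wr 1%g (fun => 1); move=> sx cx xy xx xy0 y1; have [c r1] := corner_scalar sx cx.
have fx0 z : spanned z -> filW 0 z.
  move=> ->; apply: submod_sum => [|s _]; first exact: filW_sub.
  apply: submod_sum => [|b _]; first exact: filW_sub.
  by apply: (submodZ _ (filW_sub _)); rewrite -wr_basis; apply: (@filW_wr _ _ _ pred0).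
have [c0|nc] := eqVneq c 0.
  left; rewrite c0 scale0r subr0 in r1.
  have h m : filW m x.
    elim: m => [|m IH]; first exact: fx0.
    rewrite -xx. exact: (filW_mul r1 IH).
  exact: (filW_zero (ltnSn _) (h _)).
right; set r := x - _ in r1; have yE : y = - c^-1 *: mulC r y.
  rewrite /r linearBl linearZl_LR /= xy0 y1 sub0r scalerN scaleNr opprK scalerA mulVf // scale1r //.
have h m : filW m y.
  elim: m => [|m IH]; last first.
    by rewrite yE; apply: (submodZ _ (filW_sub _)); apply: (filW_mul r1 IH).
  have -> : y = one - x by rewrite -xy addrAC subrr add0r.
  by apply: (submodB (filW_sub _)); apply: fx0.
exact: (filW_zero (ltnSn _) (h _)).
Qed.

(** The component of the unit in J1 is idempotent, is orthogonal to the component in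
    J2, and commutes with all elements placed at a single position. *)
Lemma wr_unit_in_summand (J1 J2 : set C) :
  (forall x, spanned (mulC one (mulC x one))) ->
  is_submodule J1 -> is_submodule J2 ->
  (forall u v : C, J1 v -> J1 (mulC u v) /\ J1 (mulC v u)) ->
  (forall u v : C, J2 v -> J2 (mulC u v) /\ J2 (mulC v u)) ->
  (forall v : C, J1 v -> J2 v -> v = 0) ->
  (forall v : C, exists v1 v2 : C, [/\ J1 v1, J2 v2 & v = v1 + v2]) ->
  J1 one \/ J2 one.
Proof.
move=> corner s1 s2 m1 m2 dir dec; have [x [y [J1x J2y xy]]] := dec one.
have comp (u1 u2 v1 v2 : C) : J1 u1 -> J2 u2 -> J1 v1 -> J2 v2 -> u1 + u2 = v1 + v2 -> u1 = v1 /\ u2 = v2.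
  move=> hu1 hu2 hv1 hv2 E; have E' : u1 - v1 = v2 - u2.
    by apply/eqP; rewrite subr_eq addrAC eq_sym subr_eq E addrC.
  have z : u1 - v1 = 0 by apply: dir; [apply: submodB | rewrite E'; apply: submodB].
  by split; apply/eqP; [rewrite -subr_eq0 z | rewrite eq_sym -subr_eq0 -E' z].
have g1 i : gr ((fun => 0) i) ((fun _ : 'I_d => (1 : A)) i) := gr1 hb.
have one_one : mulC one one = one by apply: (wr_one_l 1%g g1).
have [ox oy] : mulC one x = x /\ mulC one y = y.
  apply: comp => //; [exact: (proj1 (m1 _ _ J1x))|exact: (proj1 (m2 _ _ J2y))|].
  by rewrite -linearDr -xy one_one.
have [xo yo] : mulC x one = x /\ mulC y one = y.
  apply: comp => //; [exact: (proj2 (m1 _ _ J1x))|exact: (proj2 (m2 _ _ J2y))|].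
  by rewrite -linearDl -xy one_one.
have xy0 : mulC x y = 0 by apply: dir; [exact: (proj2 (m1 _ _ J1x))|exact: (proj1 (m2 _ _ J2y))].
have xx : mulC x x = x by rewrite -[RHS]xo xy linearDr /= xy0 addr0.
have sx : spanned x by have := corner x; rewrite xo ox.
have cx j p u : gr p u -> mulC (single j u) x = mulC x (single j u).
  move=> gu; have gp := gr_place j gu.
  have [] // : mulC (single j u) x = mulC x (single j u) /\ mulC (single j u) y = mulC y (single j u).
  apply: comp; [exact: (proj1 (m1 _ _ J1x))|exact: (proj1 (m2 _ _ J2y))|
    exact: (proj2 (m1 _ _ J1x))|exact: (proj2 (m2 _ _ J2y))|].
  by rewrite -linearDr -linearDl -xy (wr_one_r _ gp) (wr_one_l _ gp).
have [x0|y0] := wr_corner_indecomposable sx cx (esym xy) xx xy0 oy.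
- by right; rewrite xy x0 add0r.
- by left; rewrite xy y0 addr0.
Qed.
End WreathCorner.

(** * The algebra T over the field *)

Section ExtendedSchurAlgebra.
Variables (k : idomainType) (n d : nat).
Hypotheses (char0 : [pchar k] =i pred0) (le_dn : (d <= n)%N).
Variables (A : algType k) (gr : deg -> set A).
Variables (disp : Order.disp_t) (I : finPOrderType disp) (X Y : I -> {fset A}).
Local Notation Bt := (products X Y).
Variables (cA : Bt -> {scalar A}) (dg : Bt -> deg) (ix : Bt -> I) (eb : I -> Bt).
Variables (isa isc : pred Bt).
Hypothesis cb : conforming_basis gr cA dg ix eb isa isc.
Variables (F : fieldType) (phi : {rmorphism k -> F}).
Variables (AF : algType F) (iotaA : {linear A -> AF | phi \; *:%R}).
Hypothesis iotaA_mul : forall x y : A, iotaA (x * y) = iotaA x * iotaA y.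
Variable cF : Bt -> {scalar AF}.
Hypothesis cF_iota : forall b v, cF b (iotaA v) = phi (cA b v).
Local Notation grF := (extended_grading iotaA gr).
Local Notation bF := (fun b : Bt => iotaA (val b)).
Hypothesis hbF : heredity_basis grF bF cF dg ix eb.
Hypothesis oddJ : forall x, parity_part grF 1 x -> jacobson_radical x.
Hypothesis indecF : indecomposable *%R grF.
Variables (i0 i1 : I).
Hypothesis i01 : i0 != i1.
Variables (TP : algType k) (tens : {ffun 'I_d -> mat A n} -> TP).
Hypothesis tensP : is_super_tensor_power (@mat_mul k A n) (mat_grading gr) tens.
Local Notation L := (Bt * 'I_n * 'I_n)%type.
Local Notation word := {ffun 'I_d -> L}.
Local Notation bv := (fun b : Bt => val b).
Local Notation tw := (tw bv tens).
Variable coef : word -> {scalar TP}.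
Hypothesis coef_tens : forall z x, coef z (tens x) = \prod_i cM cA (z i) (x i).
Hypothesis coef_expand : forall t, t = \sum_z coef z t *: tw z.
Local Notation T := (schurT gr X Y tens).
Variables (TF : lmodType F) (mulTF : {bilinear TF -> TF -> TF}).
Variable (iotaT : {linear T -> TF | phi \; *:%R}).
Hypothesis extT : is_scalar_extension iotaT.
Hypothesis iotaT_mul : forall x y z : T,
  val z = val x * val y -> iotaT z = mulTF (iotaT x) (iotaT y).

Local Notation hb := (cb_hb cb).
Local Notation chi i := (cF (eb i)).
Local Notation rad := (rad cF eb).
Local Notation rad_pow := (rad_pow cF eb).
Local Notation eta z := (Defs.eta gr X Y tens (zw z)).
Local Notation Kz := (Kz isc).
Local Notation triz := (triz dg).
Local Notation invariant := (invariant dg tens coef).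
Implicit Types (z : word) (g h : 'S_d).

Lemma iotaA_sub t : is_submodule (fun v : A => rad_pow t (iotaA v)).
Proof.
have [r0 rZ] := rad_pow_submod cF eb t.
by split=> [|c u v hu hv]; rewrite ?linear0 // linearD iotaZ; apply: rZ.
Qed.

Lemma rad_pow_dec s v : rad_pow s.+1 v -> rad_pow s v.
Proof.
apply: span_sub; first exact: rad_pow_submod.
move=> _ [u [[|x l] [// ll rl ->]]]; apply: span_in; exists (u * x), l; split=> //.
- by case: ll.
- by move=> y yl; apply: rl; rewrite inE yl orbT.
- by rewrite big_cons mulrA.
Qed.

(** Such a b has an odd factor, which lies in the radical. *)
Lemma not_isa_rad (b : Bt) : ~~ isa b -> rad (iotaA (val b)).
Proof.
move=> /(cb_odd_factor cb)[b1 [b2 [-> h]]]; rewrite iotaA_mul.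
have odd b' : (dg b').2 == 1 -> rad (iotaA (val b')).
  move=> /eqP od; apply: (odd_rad hbF oddJ (m := (dg b').1)).
  by rewrite -od; have := gr_bv hbF b'; case: (dg b').
by case/orP: h => /odd r; [apply: (proj2 (rad_mul _ r)) | apply: (proj1 (rad_mul _ r))].
Qed.

Definition filt t u := filtered gr cA dg isa tens coef (fun s v => rad_pow s (iotaA v)) t u.

Lemma filt_mul s t u v : filt s u -> filt t v -> filt (s + t) (u * v).
Proof.
apply: (filtered_mul cb tensP coef_tens coef_expand iotaA_sub) => s' t' x y hx hy.
by rewrite iotaA_mul; apply: rad_pow_mul.
Qed.

Lemma filt_eta t z : triz z ->
  (t = 0 \/ (t = 1 /\ exists i, ~~ isa (z i).1.1))%N -> filt t (eta z).
Proof.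
apply: (filtered_eta cb coef_tens coef_expand iotaA_sub) => [v|b nb]; first exact: rad_pow0.
exact/rad_pow1/not_isa_rad.
Qed.

Definition inT u := Defs.span (etas gr X Y tens) u.

Lemma filt_inT t u : filt t u -> inT u.
Proof. exact: (filtered_in_T cb coef_tens coef_expand char0). Qed.

Lemma inT_sub : is_submodule inT. Proof. exact: span_submod. Qed.

Lemma inT_eta_ind (P : TP -> Prop) : is_submodule P ->
  (forall z, triz z -> P (eta z)) -> forall u, inT u -> P u.
Proof.
move=> sP h u; apply: span_sub => // _ [w tw ->].
by have [z wz] := tri_word tw; rewrite wz in tw *; apply: h; apply/(trizP cb).
Qed.

Lemma inT_mul u v : inT u -> inT v -> inT (u * v).
Proof.
have [T0 TZ] := inT_sub.
move=> hu hv; apply: (inT_eta_ind (P := fun u => inT (u * v))) hu => [|z tz].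
  by split=> [|c x y hx hy]; [rewrite mul0r | rewrite mulrDl -scalerAl; apply: TZ].
apply: (inT_eta_ind (P := fun v => inT (eta z * v))) hv => [|y ty].
  by split=> [|c x y hx hy]; [rewrite mulr0 | rewrite mulrDr -scalerAr; apply: TZ].
by apply: (@filt_inT (0 + 0)%N); apply: filt_mul; apply: filt_eta; auto.
Qed.

Lemma inT_invariant u : inT u -> invariant u.
Proof.
apply: inT_eta_ind => [|z tz].
  split=> [g|c x y hx hy g]; first exact: linear0.
  by rewrite act_linear hx hy.
rewrite (eta_sum cb coef_tens coef_expand tz); apply: equivariant_invariant.
exact: (eta_family_equivariant cb coef_tens coef_expand tz).
Qed.

(** The factorials are divided out before passing to F, where they may vanish. *)
Lemma inT_divisible u : inT u -> forall z, exists c, coef z u = #|Kz z|%:R * c.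
Proof.
move=> hu z; apply: (inT_eta_ind (P := fun u => exists c, coef z u = #|Kz z|%:R * c)) hu => [|z' tz'].
  split=> [|c x y [cx hx] [cy hy]]; first by exists 0; rewrite linear0 mulr0.
  by exists (c * cx + cy); rewrite linearP /= hx hy mulrDr mulrCA.
have [Z [zact [f [ef hf ->]]]] := filt_eta (t := 0) tz' (or_introl erefl).
have em x i y : moved zact x i -> coef y (f x) != 0 -> isa (y i).1.1.
  by move=> mi; apply: (filtered_even_moved coef_tens (hf x) mi).
by have [//|//|//|c _ ->] := equivariant_coef_divisible cb coef_tens ef em (P := fun _ => True) (z := z); exists c.
Qed.

(** The map from T to T_F on elements of the tensor power, which spares the subtype. *)
Definition iT (u : TP) : TF := iotaT (insubd (0 : T) u).

Lemma toT u : inT u -> val (insubd (0 : T) u) = u.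
Proof. by move=> hu; apply: insubdK; apply/asboolP. Qed.

Lemma valT (t : T) : inT (val t).
Proof. by apply/asboolP; exact: (valP t). Qed.

Lemma iT_val (t : T) : iT (val t) = iotaT t.
Proof. by rewrite /iT valKd. Qed.

Lemma iTD u v : inT u -> inT v -> iT (u + v) = iT u + iT v.
Proof.
move=> hu hv; rewrite /iT -linearD; congr (iotaT _); apply: val_inj.
by rewrite toT ?raddfD /= ?toT //; apply: submodD => //; exact: inT_sub.
Qed.

Lemma iTZ c u : inT u -> iT (c *: u) = phi c *: iT u.
Proof.
move=> hu; rewrite /iT -iotaZ; congr (iotaT _); apply: val_inj.
by rewrite toT ?linearZ /= ?toT //; apply: submodZ => //; exact: inT_sub.
Qed.

Lemma iT0 : iT 0 = 0.
Proof. by rewrite -[0 in LHS](scale0r (0 : TP)) iTZ ?rmorph0 ?scale0r //; case: inT_sub. Qed.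

Lemma iT_sum (J : finType) (P : pred J) (f : J -> TP) : (forall j, P j -> inT (f j)) ->
  iT (\sum_(j | P j) f j) = \sum_(j | P j) iT (f j).
Proof.
move=> hf; suff [_ E] : inT (\sum_(j | P j) f j) /\ iT (\sum_(j | P j) f j) = \sum_(j | P j) iT (f j) by [].
apply: (big_ind2 (fun u v => inT u /\ iT u = v)) => [|u1 v1 u2 v2 [h1 <-] [h2 <-]|j Pj].
- by split; [case: inT_sub | exact: iT0].
- by split; [apply: submodD => //; exact: inT_sub | exact: iTD].
- by split=> //; apply: hf.
Qed.

Lemma iTM u v : inT u -> inT v -> iT (u * v) = mulTF (iT u) (iT v).
Proof.
move=> hu hv; rewrite /iT; apply: iotaT_mul; rewrite !toT //.
exact: inT_mul.
Qed.

Lemma eqTF (W : lmodType F) (f g : TF -> W) : linear f -> linear g ->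
  (forall u, inT u -> f (iT u) = g (iT u)) -> forall v, f v = g v.
Proof.
move=> fl gl h; apply: (ext_eq extT fl gl) => t; rewrite -iT_val; apply: h.
exact: valT.
Qed.

Lemma mulTF_l w : linear (fun v => mulTF v w).
Proof. by move=> c u v; rewrite linearPl. Qed.

Lemma mulTF_r w : linear (mulTF w).
Proof. by move=> c u v; rewrite linearPr. Qed.

Lemma functionalT (f : TP -> k) : (forall c u v, inT u -> inT v -> f (c *: u + v) = c * f u + f v) ->
  exists g : {scalar TF}, forall u, inT u -> g (iT u) = phi (f u).
Proof.
move=> fl; have [|g gE] := extend_functional extT (f := fun t : T => phi (f (val t))).
  move=> c u v; have -> : val (c *: u + v) = c *: val u + val v by [].
  by rewrite fl ?rmorphD ?rmorphM //; apply: valT.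
by exists g => u hu; rewrite /iT gE toT.
Qed.

Lemma coefF_exists : exists coefF : word -> {scalar TF},
  forall z u, inT u -> coefF z (iT u) = phi (coef z u).
Proof.
have ex z : exists g : {scalar TF}, forall u, inT u -> g (iT u) = phi (coef z u).
  by apply: functionalT => c u v _ _; exact: linearP.
by have [f fE] := choice ex; exists f.
Qed.

Lemma card_Kz_neq0 z : #|Kz z|%:R != 0 :> k.
Proof. by rewrite ((proj1 (pcharf0P _)) char0) -lt0n; apply/card_gt0P; exists 1%g; exact: Kz1. Qed.

(** The images of the eta's stay linearly independent: their coordinates on T are the
    coefficients divided by the orders of the groups [Kz], and extend to T_F. *)
Lemma eta_coordinates : exists C : word -> {scalar TF},
  (forall z c u, inT u -> coef z u = #|Kz z|%:R * c -> C z (iT u) = phi c) /\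
  forall v, v = \sum_(z | (canonical_word z == z) && triz z) C z v *: iT (eta z).
Proof.
have ex z : exists g : {scalar TF}, forall c u, inT u -> coef z u = #|Kz z|%:R * c -> g (iT u) = phi c.
  have exc u : exists c, inT u -> coef z u = #|Kz z|%:R * c.
    have [hu|nu] := pselect (inT u); last by exists 0.
    by have [c E] := inT_divisible hu z; exists c.
  have [f fE] := choice exc.
  have fu u c : inT u -> coef z u = #|Kz z|%:R * c -> f u = c.
    by move=> hu; rewrite (fE _ hu) => /(mulfI (card_Kz_neq0 z)).
  have [|g gE] := functionalT (f := f).
    move=> c u v hu hv; apply: fu; first by case: inT_sub => _; apply.
    by rewrite linearP /= (fE _ hu) (fE _ hv) mulrDr mulrCA.
  by exists g => c u hu E; rewrite gE // (fu u c).
have [C CE] := choice ex; exists C; split=> //.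
apply: (eqTF (f := id)) => // [c u v|u hu].
  rewrite scaler_sumr -big_split; apply: eq_bigr => z _ /=.
  by rewrite linearP /= scalerDl scalerA.
have [c cE] := choice (inT_divisible hu).
have uE := invariant_expand cb coef_tens coef_expand char0 (inT_invariant hu) cE.
rewrite {1}uE iT_sum => [|z /andP[_ tz]]; last first.
  by apply: (submodZ _ inT_sub); apply: (@filt_inT 0); apply: filt_eta; auto.
apply: eq_bigr => z /andP[_ tz]; rewrite iTZ; last by apply: (@filt_inT 0); apply: filt_eta; auto.
by rewrite (CE z (c z) u).
Qed.

Variable coefF : word -> {scalar TF}.
Hypothesis coefFE : forall z u, inT u -> coefF z (iT u) = phi (coef z u).

Definition filF t : set TF := Defs.span (fun v => exists2 u, filt t u & v = iT u).

Lemma filF_sub t : is_submodule (filF t). Proof. exact: span_submod. Qed.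

Lemma filF_mul s t v w : filF s v -> filF t w -> filF (s + t) (mulTF v w).
Proof.
have [F0 FZ] := filF_sub (s + t).
move=> hv hw; apply: (span_sub (P := fun v => filF (s + t) (mulTF v w))) hv => [|_ [u hu ->]].
  by split=> [|c x y hx hy]; [rewrite linear0l | rewrite mulTF_l; apply: FZ].
apply: (span_sub (P := fun w => filF (s + t) (mulTF (iT u) w))) hw => [|_ [u' hu' ->]].
  by split=> [|c x y hx hy]; [rewrite linear0r | rewrite mulTF_r; apply: FZ].
rewrite -iTM; [|exact: filt_inT hu|exact: filt_inT hu'].
by apply: span_in; exists (u * u') => //; apply: filt_mul.
Qed.

Lemma filF_zero t v : (d * nilbound I < t)%N -> filF t v -> v = 0.
Proof.
move=> lt; apply: (span_sub (P := fun v => v = 0)) => [|_ [u hu ->]].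
  by split=> // c x y -> ->; rewrite scaler0 addr0.
have [|||||c c0 ->] := filtered_vanish cb coef_tens coef_expand char0 (P := fun c => phi c = 0) _ _ _ _ _ lt hu.
- exact: rmorph0.
- by move=> c1 c2 h1 h2; rewrite rmorphD h1 h2 addr0.
- by move=> c1 c2 h2; rewrite rmorphM h2 mulr0.
- by move=> b x hx; rewrite -cF_iota (rad_pow_nil hbF _ hx) ?linear0.
- by move=> s x; apply: rad_pow_dec.
rewrite iT_sum => [|z /andP[_ tz]]; last by apply: (submodZ _ inT_sub); apply: (@filt_inT 0); apply: filt_eta; auto.
by rewrite big1 // => z /andP[_ tz]; rewrite iTZ ?c0 ?scale0r //; apply: (@filt_inT 0); apply: filt_eta; auto.
Qed.

Lemma filF_idem f : filF 1 f -> mulTF f f = f -> f = 0.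
Proof.
move=> f1 ff; have h m : filF m.+1 f.
  by elim: m => // m IH; rewrite -ff -addn1; apply: filF_mul.
exact: (filF_zero (ltnSn (d * nilbound I))).
Qed.

(** The coefficients at words in the basis of M_n(a) are not divided by any
    factorial, so they survive the change of scalars and determine an element
    up to the nilpotent ideal [filF 1]. *)
Lemma filF1_of_coef v : (forall z, (forall i, isa (z i).1.1) -> coefF z v = 0) -> filF 1 v.
Proof.
move=> v0; have [C [CE vE]] := eta_coordinates.
rewrite (vE v); apply: submod_sum => [|z /andP[_ tz]]; first exact: filF_sub.
have [/forallP az|/forallPn[i ni]] := boolP [forall i, isa (z i).1.1]; last first.
  by apply: (submodZ _ (filF_sub 1)); apply: span_in; exists (eta z) => //; apply: filt_eta => //; right; split=> //; exists i.
suff -> : C z v = 0 by rewrite scale0r; case: (filF_sub 1).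
have K1 : #|Kz z|%:R = 1 :> k.
  suff -> : Kz z = [set 1%g] by rewrite cards1.
  apply/setP => g; apply/idP/set1P => [/KzP gK|->]; last exact: Kz1.
  apply/permP => i; rewrite perm1; apply/eqP/negPn/negP => gi.
  by have [_ /(_ gi)/(cb_isc_isa cb)] := gK i; rewrite az.
have -> : C z v = coefF z v; last exact: v0.
apply: (eqTF (W := F^o) (f := C z) (g := coefF z)) => [c x y|c x y|u hu]; [exact: linearP|exact: linearP|].
by rewrite coefFE //; apply: CE => //; rewrite K1 mul1r.
Qed.

Lemma mulTF_1r v : mulTF v (iT 1) = v.
Proof.
have T1 : inT 1.
  apply: (@filt_inT 0); apply: (filtered_one cb tensP coef_tens coef_expand) => x.
  exact: rad_pow0.
apply: (eqTF (f := fun v => mulTF v (iT 1)) (g := id)) => [|//|u hu]; first exact: mulTF_l.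
by rewrite -iTM // mulr1.
Qed.

Local Notation wreath := (wreath dg tens coef le_dn).
Local Notation theta := (theta dg tens coef le_dn).
Local Notation col := (col le_dn).
Local Notation wreath_word := (wreath_word (X := X) (Y := Y) le_dn).

Lemma inT_Sym (w : {ffun 'I_d -> mat A n}) (q : 'I_d -> deg) : (forall i, mat_grading gr (q i) (w i)) ->
  inT (Sym_tens dg tens coef (tens w)).
Proof.
move=> gw; apply: (@filt_inT 0); apply: (filtered_Sym cb coef_tens coef_expand _ gw) => x.
exact: rad_pow0.
Qed.

Lemma inT_theta s : inT (theta s).
Proof. exact: (inT_Sym (gr_frame cb s col)). Qed.

Lemma inT_wreath (p : 'I_d -> deg) v g : (forall i, gr (p i) (v i)) -> inT (wreath v g).
Proof. by move=> gv; apply: (inT_Sym (q := p)) => i; rewrite ffunE; apply: (gr_xi cb). Qed.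

Lemma inT_wreath_basis (b : {ffun 'I_d -> Bt}) g : inT (wreath (fun i => val (b i)) g).
Proof. by apply: (inT_wreath (p := fun i => dg (b i))) => i; apply: (gr_bv hb). Qed.

Lemma coefF_theta v (s : 'I_d -> 'I_n) z : (forall i, (z i).2 = col i) ->
  coefF z (mulTF v (iT (theta s))) = coefF [ffun i => ((z i).1, s i)] v.
Proof.
move=> zc; move: v; apply: (eqTF (W := F^o) (f := fun v => coefF z (mulTF v (iT (theta s))))) => [c x y|c x y|u hu].
- by rewrite mulTF_l linearP.
- exact: linearP.
have hs := inT_theta s; rewrite -iTM // !coefFE //; last exact: inT_mul.
by rewrite (coef_theta cb tensP coef_tens coef_expand) //; apply: inT_invariant.
Qed.

Definition corner_unit : TF := iT (theta col).

Lemma corner_expandF v : mulTF corner_unit (mulTF v corner_unit) =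
  \sum_g \sum_b coefF (wreath_word b g) v *: iT (wreath (fun i => val (b i)) g).
Proof.
move: v; apply: (eqTF (f := fun v => mulTF corner_unit (mulTF v corner_unit))) => [c x y|c x y|u hu].
- by rewrite mulTF_l mulTF_r.
- rewrite scaler_sumr -big_split; apply: eq_bigr => g _ /=.
  rewrite scaler_sumr -big_split; apply: eq_bigr => b _ /=.
  by rewrite linearP /= scalerDl scalerA.
have ht := inT_theta col; have hut := inT_mul hu ht; have htut := inT_mul ht hut.
rewrite /corner_unit -!iTM // (corner_expand cb tensP coef_tens coef_expand) ?iT_sum; last exact: inT_invariant.
  apply: eq_bigr => g _; rewrite iT_sum => [|b _]; last exact/(submodZ _ inT_sub)/inT_wreath_basis.
  by apply: eq_bigr => b _; rewrite iTZ ?coefFE //; apply: inT_wreath_basis.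
move=> g _; apply: submod_sum => [|b _]; first exact: inT_sub.
exact/(submodZ _ inT_sub)/inT_wreath_basis.
Qed.

Lemma wreath_expand v g :
  wreath v g = \sum_(b : {ffun 'I_d -> Bt}) (\prod_i cA (b i) (v i)) *: wreath (fun i => val (b i)) g.
Proof.
rewrite wreathE; under eq_bigr do rewrite wreathE -SymZ; rewrite -Sym_sum; congr Sym_tens.
apply: (coef_eq coef_expand) => z; rewrite linear_sum coef_tens.
transitivity (\prod_i \sum_(b : Bt) cA b (v i) * cM cA (z i) (xi_mat (val b) (col (g i)) (col i))).
  apply: eq_bigr => i _; rewrite ffunE cM_xi; under eq_bigr do rewrite cM_xi.
  case: ifP => _; last by rewrite big1 // => b _; rewrite mulr0.
  rewrite {1}(hb_expand hb (v i)) linear_sum; apply: eq_bigr => b _; exact: linearZ.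
rewrite bigA_distr_bigA; apply: eq_bigr => b _; rewrite linearZ /= coef_tens -big_split.
by apply: eq_bigr => i _; rewrite ffunE.
Qed.

Definition wreathT g (b : {ffun 'I_d -> Bt}) : TF := iT (wreath (fun i => val (b i)) g).
Local Notation wreathF := (wr cF wreathT).

Lemma wreathF_iota (p : 'I_d -> deg) g v : (forall i, gr (p i) (v i)) ->
  wreathF g (fun i => iotaA (v i)) = iT (wreath v g).
Proof.
move=> gv; rewrite wreath_expand iT_sum => [|b _]; last exact/(submodZ _ inT_sub)/inT_wreath_basis.
apply: eq_bigr => b _; rewrite iTZ; last exact: inT_wreath_basis.
by rewrite rmorph_prod; congr (_ *: _); apply: eq_bigr => i _; rewrite cF_iota.
Qed.

(** On basis vectors this is [wreath_mul]; in the expansion of homogeneous entries only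
    words of the same parities occur, so the sign is common to all terms. *)
Lemma wreathF_mul (p q : 'I_d -> deg) g h v w :
  (forall i, grF (p i) (v i)) -> (forall i, grF (q i) (w i)) ->
  mulTF (wreathF g v) (wreathF h w) =
  sgn F (odd_inv (par \o p) h + swaps (par \o p \o h) (par \o q)) *:
    wreathF (h * g)%g (fun i => v (h i) * w i).
Proof.
move=> gv gw.
have -> : wreathF (h * g)%g (fun i => v (h i) * w i) =
   wreathF (h * g)%g (fun i => \sum_(bc : Bt * Bt) (cF bc.1 (v (h i)) * cF bc.2 (w i)) *: (bF bc.1 * bF bc.2)).
  apply: eq_wr => i; rewrite {1}(hb_expand hbF (v (h i))) {1}(hb_expand hbF (w i)) mulr_suml.
  rewrite -(pair_bigA _ (fun b c => (cF b (v (h i)) * cF c (w i)) *: (bF b * bF c))) /=.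
  apply: eq_bigr => b _; rewrite mulr_sumr; apply: eq_bigr => c _.
  by rewrite -scalerAl -scalerAr scalerA.
rewrite wr_expand {1 2}/wr /wreathT.
have -> : mulTF (\sum_(b : {ffun 'I_d -> Bt}) (\prod_i cF (b i) (v i)) *: iT (wreath (fun i => val (b i)) g))
   (\sum_(b : {ffun 'I_d -> Bt}) (\prod_i cF (b i) (w i)) *: iT (wreath (fun i => val (b i)) h)) =
   \sum_(b : {ffun 'I_d -> Bt}) \sum_(c : {ffun 'I_d -> Bt}) ((\prod_i cF (b i) (v i)) * (\prod_i cF (c i) (w i))) *:
     mulTF (iT (wreath (fun i => val (b i)) g)) (iT (wreath (fun i => val (c i)) h)).
  rewrite linear_sumlz; apply: eq_bigr => b _; rewrite linear_sumr; apply: eq_bigr => c _.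
  by rewrite linearZl_LR linearZr_LR /= scalerA.
rewrite pair_bigA scaler_sumr /=.
rewrite (reindex (fun t : {ffun 'I_d -> Bt * Bt} =>
   ([ffun i => (t (h^-1 i)%g).1], [ffun i => (t i).2]))) /=; last first.
  exists (fun bc : {ffun 'I_d -> Bt} * {ffun 'I_d -> Bt} => [ffun i => (bc.1 (h i), bc.2 i)]) => [t _|[b c] _].
    by apply/ffunP => i; rewrite !ffunE permK; case: (t i).
  by congr pair; apply/ffunP => i; rewrite !ffunE ?permKV.
apply: eq_bigr => t _.
set b := [ffun i => (t (h^-1 i)%g).1]; set c := [ffun i => (t i).2].
have prodE : \prod_i (cF (t i).1 (v (h i)) * cF (t i).2 (w i)) =
   (\prod_i cF (b i) (v i)) * (\prod_i cF (c i) (w i)).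
  rewrite big_split [X in _ = X * _](reindex_inj (@perm_inj _ h)) /=.
  by congr (_ * _); apply: eq_bigr => i _; rewrite ffunE ?permK.
rewrite prodE; have [->|nz] := eqVneq ((\prod_i cF (b i) (v i)) * (\prod_i cF (c i) (w i))) 0.
  by rewrite !scale0r scaler0.
move: nz; rewrite mulf_eq0 negb_or => /andP[/prodf_neq0 nb /prodf_neq0 nc].
have pE : par \o p = par \o (fun i => dg (b i)).
  by apply/funext => i /=; rewrite (proj1 (hb_gr hbF _ _) (gv i) _ (nb i isT)).
have qE : par \o q = par \o (fun i => dg (c i)).
  by apply/funext => i /=; rewrite (proj1 (hb_gr hbF _ _) (gw i) _ (nc i isT)).
rewrite [RHS]scalerA [sgn _ _ * _]mulrC -[RHS]scalerA; congr (_ *: _).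
rewrite -iTM; [|exact: inT_wreath_basis|exact: inT_wreath_basis].
have gb i : gr (dg (b i)) (val (b i)) by apply: (gr_bv hb).
have gc i : gr (dg (c i)) (val (c i)) by apply: (gr_bv hb).
rewrite (wreath_mul cb tensP coef_tens coef_expand le_dn g h gb gc).
have gbc i : gr (dg (b (h i)) + dg (c i)) (val (b (h i)) * val (c i)) by apply: (gr_mul hb).
rewrite iTZ; last exact: (inT_wreath _ gbc).
rewrite -pE -qE rmorph_sign -(wreathF_iota _ gbc); congr (_ *: _).
by apply: eq_wr => i; rewrite iotaA_mul !ffunE permK.
Qed.

Lemma iotaA1 : iotaA 1 = 1.
Proof.
rewrite -[LHS]mulr1 (hb_expand hbF 1) mulr_sumr; apply: eq_bigr => b _.
by rewrite -scalerAr -iotaA_mul mul1r.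
Qed.

Lemma corner_unitE : corner_unit = wreathF 1%g (fun => 1).
Proof.
have g1 i : gr ((fun => 0) i) ((fun _ : 'I_d => (1 : A)) i) := gr1 hb.
have -> : wreathF 1%g (fun => 1) = wreathF 1%g (fun => iotaA 1).
  by apply: eq_wr => i; rewrite iotaA1.
rewrite (wreathF_iota _ g1) /corner_unit; congr (iT (Sym_tens _ _ _ (tens _))).
by apply/ffunP => i; rewrite !ffunE perm1.
Qed.

Lemma coef_wreath g (b : {ffun 'I_d -> Bt}) h (b' : {ffun 'I_d -> Bt}) :
  coef (wreath_word b g) (wreath (fun i => val (b' i)) h) = ((g == h) && (b == b'))%:R.
Proof.
have -> : wreath (fun i => val (b' i)) h = Sym_tens dg tens coef (tw (wreath_word b' h)).
  by congr (Sym_tens _ _ _ (tens _)); apply/ffunP => i; rewrite !ffunE.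
rewrite /Sym_tens linear_sum (bigD1 1%g) //= (act1 _ coef_expand) (coef_tw hb coef_tens).
rewrite big1 ?addr0 => [|s s1].
  congr (nat_of_bool _)%:R; apply/eqP/andP => [E|[/eqP-> /eqP->] //]; split; apply/eqP.
    apply/permP => i; apply: (col_inj (le_dn := le_dn)).
    by have := congr1 (fun z : word => (z i).1.2) E; rewrite !ffunE.
  by apply/ffunP => i; have := congr1 (fun z : word => (z i).1.1) E; rewrite !ffunE.
rewrite (act_tw hb coef_tens coef_expand) linearZ /= (coef_tw hb coef_tens).
case: (_ =P _) => [E|]; last by rewrite mulr0.
case/eqP: s1; apply/permP => i; rewrite perm1; apply: (col_inj (le_dn := le_dn)).
by have := congr1 (fun z : word => (z i).2) E; rewrite !ffunE.
Qed.

Definition wreath_coord g b : {scalar TF} := coefF (wreath_word b g).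

Lemma wreath_coordE g (b : {ffun 'I_d -> Bt}) h (b' : {ffun 'I_d -> Bt}) :
  wreath_coord g b (wreathT h b') = ((g == h) && (b == b'))%:R.
Proof. by rewrite /wreath_coord coefFE ?coef_wreath ?rmorph_nat //; apply: inT_wreath_basis. Qed.

(** The component f of 1 in J1 kills every [theta s], which is a multiple of the unit
    of the corner and so lies in J2. All coefficients of f at words over a therefore
    vanish, and f is both idempotent and of positive filtration degree. *)
Lemma summand_zero (J1 J2 : set TF) : is_submodule J1 -> is_submodule J2 ->
  (forall u v, J1 v -> J1 (mulTF u v) /\ J1 (mulTF v u)) ->
  (forall u v, J2 v -> J2 (mulTF u v) /\ J2 (mulTF v u)) ->
  (forall v, J1 v -> J2 v -> v = 0) ->
  (forall v, exists v1 v2, [/\ J1 v1, J2 v2 & v = v1 + v2]) ->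
  J2 corner_unit -> forall v, J1 v -> v = 0.
Proof.
move=> s1 s2 m1 m2 dir dec Jc; have [f [f' [J1f J2f' ff']]] := dec (iT 1).
have f_theta s : mulTF f (iT (theta s)) = 0.
  apply: dir; first exact: (proj2 (m1 _ _ J1f)).
  apply: (proj1 (m2 _ _ _)).
  rewrite -(theta_theta cb tensP coef_tens coef_expand le_dn s) iTM; [|exact: inT_theta|exact: inT_theta].
  exact: (proj1 (m2 _ _ Jc)).
have f1 : filF 1 f.
  apply: filF1_of_coef => z _.
  pose y : word := [ffun i => ((z i).1, col i)].
  have yc i : (y i).2 = col i by rewrite ffunE.
  have := coefF_theta f (fun i => (z i).2) yc; rewrite f_theta linear0 => E; rewrite E.
  by congr (coefF _ f); apply/ffunP => i; rewrite !ffunE /=; case: (z i).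
have ff : mulTF f f = f.
  have z : mulTF f f' = 0 by apply: dir; [exact: (proj2 (m1 _ _ J1f))|exact: (proj1 (m2 _ _ J2f'))].
  by rewrite -[RHS]mulTF_1r ff' linearDr /= z addr0.
have f0 : f = 0 := filF_idem f1 ff.
move=> v J1v; apply: dir => //; rewrite -[v]mulTF_1r ff' f0 add0r.
exact: (proj1 (m2 _ _ J2f')).
Qed.

Lemma extension_indecomposable grT : indecomposable mulTF grT.
Proof.
move=> [J1 [J2 [[h1 h2] [[v1 J1v nv1] [v2 J2v nv2]] dir dec]]].
have [s1 m1 _] := h1; have [s2 m2 _] := h2.
have cor x : spanned wreathT wreath_coord (mulTF (wreathF 1%g (fun => 1)) (mulTF x (wreathF 1%g (fun => 1)))).
  rewrite -corner_unitE corner_expandF; exact: (spanned_sum wreath_coordE).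
case: (wr_unit_in_summand hbF wreathF_mul wreath_coordE oddJ indecF i01 cor s1 s2 m1 m2 dir dec); rewrite -corner_unitE => Jc.
  have dir' v : J2 v -> J1 v -> v = 0 by move=> a b; apply: dir.
  have dec' v : exists v1 v2, [/\ J2 v1, J1 v2 & v = v1 + v2].
    by have [a [b [ha hb' ->]]] := dec v; exists b, a; rewrite addrC.
  by case/eqP: nv2; apply: (summand_zero s2 s1 m2 m1 dir' dec' Jc).
by case/eqP: nv1; apply: (summand_zero s1 s2 m1 m2 dir dec Jc).
Qed.
End ExtendedSchurAlgebra.

Theorem theorem3
  (k : idomainType) (char0 : [pchar k] =i pred0)
  (n d : nat) (n_gt0 : (0 < n)%N) (le_dn : (d <= n)%N)
  (* the unital graded superalgebra A with conforming heredity data *)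
  (A : algType k) (gr : deg -> set A)
  (superA : is_graded_superalgebra *%R gr)
  (disp : Order.disp_t) (I : finPOrderType disp)
  (X Y : I -> {fset A}) (e : I -> A)
  (heredA : heredity_data gr setT X Y e)
  (a : set A) (confA : conforming gr a X Y e) (unital_a : a 1)
  (F : fieldType) (phi : {rmorphism k -> F})
  (* A_F *)
  (AF : algType F) (iotaA : {linear A -> AF | phi \; *:%R})
  (extA : is_scalar_extension iotaA)
  (iotaA_mul : forall x y : A, iotaA (x * y) = iotaA x * iotaA y)
  (* the superalgebra M_n(A)^{(x) d} *)
  (TP : algType k) (tens : {ffun 'I_d -> mat A n} -> TP)
  (tensP : is_super_tensor_power (@mat_mul k A n) (mat_grading gr) tens)
  (* T_F, for T = schurT gr X Y tens *)
  (TF : lmodType F) (mulTF : {bilinear TF -> TF -> TF})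
  (iotaT : {linear schurT gr X Y tens -> TF | phi \; *:%R})
  (extT : is_scalar_extension iotaT)
  (iotaT_mul : forall x y z : schurT gr X Y tens,
     val z = val x * val y -> iotaT z = mulTF (iotaT x) (iotaT y)) :
  (forall x, parity_part (extended_grading iotaA gr) 1 x ->
     jacobson_radical x) ->
  indecomposable *%R (extended_grading iotaA gr) ->
  (1 < #|I|)%N ->
  indecomposable mulTF
    (extended_grading iotaT (schurT_grading gr X Y tens)).
Proof.
move=> oddJ indec I_gt1.
have [cA [dg [ix [eb [isa [isc cb]]]]]] := conforming_basis_exists superA heredA confA unital_a.
have [cF [cF_iota hbF]] := extend_heredity_basis (cb_hb cb) extA iotaA_mul.
have [coef [coef_tens coef_expand]] := coefficients_exist (cb_hb cb) (proj1 tensP).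
have [coefF coefFE] := coefF_exists coef extT.
have [i0 [i1 [_ _ i01]]] := card_gt1P I_gt1.
exact: (extension_indecomposable char0 le_dn cb iotaA_mul cF_iota hbF oddJ indec i01
  tensP coef_tens coef_expand extT iotaT_mul coefFE).
Qed.
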